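(* In the setting described in the context, for each $N$ there exists a unique pair of functions $(\mathbf{T}(z),\widetilde{\mathbf{T}}(z))\in\mathcal{S}_{ML}(\mathbb{R}^+)\times\mathcal{S}_N(\mathbb{R}^+)$ that satisfies, for each $z\in\mathbb{C}\setminus\mathbb{R}^+$, $$\mathbf{T}(z)=-\frac1z\left(\mathbf{I}_{ML}+\Psi\left(\widetilde{\mathbf{T}}^{T}(z)\right)\right)^{-1},\qquad \widetilde{\mathbf{T}}(z)=-\frac1z\left(\mathbf{I}_{N}+c_N\overline{\Psi}^{T}\left(\mathbf{T}(z)\right)\right)^{-1}.$$ Moreover, there exist two nice constants $\eta$ and $\tilde\eta$ such that, for each $z\in\mathbb{C}\setminus\mathbb{R}^+$, $$\mathbf{T}(z)\mathbf{T}^H(z)\ge\frac{\delta_z^2}{16(\eta^2+|z|^2)^2}\mathbf{I}_{ML},\qquad \widetilde{\mathbf{T}}(z)\widetilde{\mathbf{T}}^H(z)\ge\frac{\delta_z^2}{16(\tilde\eta^2+|z|^2)^2}\mathbf{I}_{N}.$$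
   Context: Dimensions: $M=M_N$ and $L=L_N$ are positive integers indexed by $N\ge 1$, with $M\to+\infty$ and $c_N=\frac{ML}{N}\to c$, $0<c<+\infty$, as $N\to+\infty$. Spectral densities: for each $M$, $\mathcal{S}_1,\ldots,\mathcal{S}_M$ are positive functions on $[0,1]$ and $r_m(k)=\int_0^1\mathcal{S}_m(\nu)e^{2\mathrm{i}\pi\nu k}d\nu$, $k\in\mathbb{Z}$. It is assumed that $\sup_M\sum_{n\in\mathbb{Z}}\left(\frac1M\sum_{m=1}^M|r_m(n)|^2\right)^{1/2}<+\infty$ (so each $\mathcal{S}_m$ is continuous), $\sup_M\sup_{m\le M}\max_{\nu}\mathcal{S}_m(\nu)<+\infty$ and $\inf_M\inf_{m\le M}\min_{\nu}\mathcal{S}_m(\nu)>0$. Operators: $\mathbf{d}_R(\nu)=(1,e^{2\mathrm{i}\pi\nu},\ldots,e^{2\mathrm{i}\pi(R-1)\nu})^T$, $\mathbf{a}_R(\nu)=\mathbf{d}_R(\nu)/\sqrt R$. For an $R\times R$ matrix $\mathbf{M}$, $\Psi_K^{(m)}(\mathbf{M})=\int_0^1\mathcal{S}_m(\nu)\,\mathbf{a}_R^H(\nu)\mathbf{M}\mathbf{a}_R(\nu)\,\mathbf{d}_K(\nu)\mathbf{d}_K^H(\nu)\,d\nu$, a $K\times K$ matrix. For an $N\times N$ matrix $\mathbf{M}$, $\Psi(\mathbf{M})$ is the $ML\times ML$ block-diagonal matrix with $m$-th $L\times L$ diagonal block $\Psi_L^{(m)}(\mathbf{M})$. For an $ML\times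 ML$ matrix $\mathbf{M}$ with $m$-th $L\times L$ diagonal block $\mathbf{M}^{m,m}$, $\overline{\Psi}(\mathbf{M})=\frac1M\sum_{m=1}^M\Psi_N^{(m)}(\mathbf{M}^{m,m})$ ($N\times N$), and $\overline{\Psi}^T(\mathbf{M})$ denotes its transpose. $(\cdot)^H$ is conjugate transpose; inequalities between Hermitian matrices are in the Loewner order. Class $\mathcal{S}_K(\mathbb{R}^+)$: the set of $K\times K$ matrix-valued functions on $\mathbb{C}\setminus\mathbb{R}^+$ of the form $\int_{\mathbb{R}^+}\frac{d\boldsymbol\mu(\lambda)}{\lambda-z}$, where $\boldsymbol\mu$ is a positive $K\times K$ matrix-valued measure carried by $\mathbb{R}^+$ with $\boldsymbol\mu(\mathbb{R}^+)=\mathbf{I}_K$. $\delta_z=\mathrm{dist}(z,\mathbb{R}^+)$. A nice constant is a positive constant independent of $L,M,N$ and $z$. *)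

(* Defs.v *)
From HB Require Import structures.
From mathcomp Require Export all_boot all_order all_algebra.
From mathcomp Require Export complex.
From mathcomp Require Export all_classical all_reals all_analysis.

#[export] Set Implicit Arguments.
#[export] Unset Strict Implicit.
#[export] Unset Printing Implicit Defensive.

Import Order.TTheory GRing.Theory Num.Theory.
Import numFieldNormedType.Exports.

Local Open Scope classical_set_scope.
Local Open Scope sesquilinear_scope.
Local Open Scope complex_scope.
Local Open Scope ring_scope.

(* The modulus with values in R; the norm `|z| of R[i] has values in R[i]. *)
Definition cmod (R : rcfType) (z : R[i]) : R := Normc.normc z.

Section MatrixOrder.
Variable R : realType.
Notation C := R[i].

(* In R[i], 0 <= w says that w is real and nonnegative, so a matrix satisfying
   psdmx is automatically Hermitian.                                          *)
Definition psdmx (K : nat) (A : 'M[C]_K) : Prop :=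
  forall x : 'cV[C]_K, 0 <= (x^t* *m A *m x) 0 0.

Definition loewner_ge (K : nat) (A B : 'M[C]_K) : Prop := psdmx (A - B).

End MatrixOrder.

Section CutPlane.
Variable R : realType.
Notation C := R[i].

(* C \ [0, +oo[, since 0 <= z in R[i] iff Im z = 0 and Re z >= 0. *)
Definition cut_plane : Type := {z : C | ~~ (0 <= z)}.

Definition delta (z : C) : R :=
  inf [set cmod (z - x%:C) | x in [set x : R | 0 <= x]].

End CutPlane.

Section ComplexIntegral.
Variable R : realType.
Notation C := R[i].

Definition cintegral01 (f : R -> C) : C :=
  (\int[lebesgue_measure]_(nu in `[0, 1]) complex.Re (f nu))
  +i* (\int[lebesgue_measure]_(nu in `[0, 1]) complex.Im (f nu)).

Definition mxintegral01 (p q : nat) (F : R -> 'M[C]_(p, q)) : 'M[C]_(p, q) :=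
  \matrix_(i, j) cintegral01 (fun nu => F nu i j).

(* Integral of a real function against a signed measure, through its
   Jordan decomposition.                                             *)
Definition charge_integral (nu : {charge set R -> \bar R}) (D : set R)
    (f : R -> R) : R :=
  let hP := cid (Hahn_decomposition nu) in
  let hN := cid (projT2 hP) in
  (\int[jordan_pos (projT2 hN)]_(x in D) f x)
  - (\int[jordan_neg (projT2 hN)]_(x in D) f x).

(* A K x K matrix of complex Borel measures on R, each entry being given by
   its real and imaginary parts, which are finite signed measures.          *)
Record mx_measure (K : nat) := MxMeasure {
  mxm_re : 'I_K -> 'I_K -> {charge set R -> \bar R} ;
  mxm_im : 'I_K -> 'I_K -> {charge set R -> \bar R} }.

Definition mxm_val (K : nat) (mu : mx_measure K) (A : set R) : 'M[C]_K :=
  \matrix_(i, j) (fine (mxm_re mu i j A) +i* fine (mxm_im mu i j A)).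

Definition mxm_integral (K : nat) (mu : mx_measure K) (D : set R)
    (f : R -> C) : 'M[C]_K :=
  let u := fun x => complex.Re (f x) in
  let v := fun x => complex.Im (f x) in
  \matrix_(i, j)
    ((charge_integral (mxm_re mu i j) D u - charge_integral (mxm_im mu i j) D v)
     +i* (charge_integral (mxm_re mu i j) D v
          + charge_integral (mxm_im mu i j) D u)).

Definition mxm_positive (K : nat) (mu : mx_measure K) : Prop :=
  forall A : set R, measurable A -> psdmx (mxm_val mu A).

Definition mxm_carried_by (K : nat) (mu : mx_measure K) (D : set R) : Prop :=
  forall A : set R, measurable A -> A `&` D = set0 -> mxm_val mu A = 0.

Definition stieltjes_class (K : nat) (F : cut_plane R -> 'M[C]_K) : Prop :=
  exists mu : mx_measure K,
    [/\ mxm_positive mu,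
        mxm_carried_by mu `[0, +oo[,
        mxm_val mu `[0, +oo[ = 1%:M
      & forall z : cut_plane R,
          F z = mxm_integral mu `[0, +oo[ (fun x => (x%:C - val z)^-1)].

End ComplexIntegral.

Section Operators.
Variable R : realType.
Notation C := R[i].

(* exp (2 i pi t) *)
Definition e2ipi (t : R) : C := cos (2 * pi * t) +i* sin (2 * pi * t).

Definition dvec (K : nat) (nu : R) : 'cV[C]_K :=
  \col_(k < K) e2ipi (k%:R * nu).

Definition avec (K : nat) (nu : R) : 'cV[C]_K :=
  ((Num.sqrt K%:R)^-1)%:C *: dvec K nu.

Definition fourier_coef (s : R -> R) (k : int) : C :=
  cintegral01 (fun nu => (s nu)%:C * e2ipi (nu * k%:~R)).

(* The operator Psi_K^(m) on P x P matrices, with s the density S_m. *)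
Definition PsiK (s : R -> R) (P K : nat) (A : 'M[C]_P) : 'M[C]_K :=
  mxintegral01 (fun nu =>
    ((s nu)%:C * ((avec P nu)^t* *m A *m avec P nu) 0 0)
      *: (dvec K nu *m (dvec K nu)^t*)).

(* The dimension ML, in the form used by the block matrices of the library. *)
Definition dimML (M L : nat) : nat := (\sum_(m < M) L)%N.

Lemma dimMLE (M L : nat) : dimML M L = (M * L)%N.
Proof. by rewrite /dimML sum_nat_const card_ord. Qed.

Definition Psi (M L N : nat) (S : 'I_M -> R -> R) (A : 'M[C]_N) :
    'M[C]_(dimML M L) :=
  \mxdiag_(m < M) (PsiK (S m) L A).

Definition Psibar (M L N : nat) (S : 'I_M -> R -> R) (A : 'M[C]_(dimML M L)) :
    'M[C]_N :=
  (M%:R)^-1 *: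
    \sum_(m < M) PsiK (S m) N (@submxblock C M M (fun=> L) (fun=> L) A m m).

Definition ratio (M L N : nat) : R := (M * L)%:R / N%:R.

(* invmx A = A when A is singular, so invertibility is stated explicitly. *)
Definition canonical_equations (M L N : nat) (S : 'I_M -> R -> R)
    (T : cut_plane R -> 'M[C]_(dimML M L)) (Tt : cut_plane R -> 'M[C]_N) :
    Prop :=
  forall z : cut_plane R,
    let A := 1%:M + Psi L S (Tt z)^T in
    let B := 1%:M + (ratio M L N)%:C *: (Psibar N S (T z))^T in
    [/\ A \in unitmx, T z = - (val z)^-1 *: invmx A,
        B \in unitmx & Tt z = - (val z)^-1 *: invmx B].

Definition canonical_solution (M L N : nat) (S : 'I_M -> R -> R)
    (T : (cut_plane R -> 'M[C]_(dimML M L)) * (cut_plane R -> 'M[C]_N)) :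
    Prop :=
  [/\ stieltjes_class T.1, stieltjes_class T.2
    & canonical_equations S T.1 T.2].

Definition lower_bound (eta : R) (K : nat) (F : cut_plane R -> 'M[C]_K)
    (z : cut_plane R) : Prop :=
  loewner_ge (F z *m (F z)^t*)
    (delta (val z) ^+ 2
       / (16 * (eta ^+ 2 + cmod (val z) ^+ 2) ^+ 2))%:C%:M.

End Operators.

Section SpectralDensities.
Variable R : realType.
(* S M m is the density S_(m+1) of the M-dimensional time series. *)
Variable S : forall M : nat, 'I_M -> R -> R.

(* Measurability is what makes the integrals of the densities meaningful. *)
Definition positive_densities : Prop :=
  forall (M : nat) (m : 'I_M),
    measurable_fun (`[0, 1] : set R) (S m) /\ forall nu : R, nu \in `[0, 1] -> 0 < S m nu.

Definition summable_covariances : Prop :=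
  (ereal_sup [set (\esum_(n in [set: int])
      (Num.sqrt (M%:R^-1 * \sum_(m < M) cmod (fourier_coef (S m) n) ^+ 2))%:E)%E
    | M in [set M | (0 < M)%N]] < +oo)%E.

Definition bounded_above_densities : Prop :=
  exists b : R, forall (M : nat) (m : 'I_M) (nu : R),
    nu \in `[0, 1] -> S m nu <= b.

Definition bounded_below_densities : Prop :=
  exists2 a : R, 0 < a & forall (M : nat) (m : 'I_M) (nu : R),
    nu \in `[0, 1] -> a <= S m nu.

End SpectralDensities.

(* Main.v *)
(* Let w be the square root of z with Im w > 0, P = w T and Q = w Tt. The
   equations become P = - (w + Phi1 Q)^-1 and Q = - (w + Phi2 P)^-1, where Phi1
   and Phi2 are completely positive and, by Parseval, map 1 below a constant h
   which does not depend on N.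

   Two solutions with nonnegative imaginary part satisfy
   P - P' = P (Phi1 (Q - Q')) P' and Im P = P (Im w + Phi1 (Im Q)) P^*, so that a
   bound |x^* (Q - Q') y| <= d (x^* (Im Q) x + y^* (Im Q') y) / 2 passes from Q to
   P with the constant d multiplied by some k < 1. This gives uniqueness, and it
   also shows that the increments of the iteration started at 0 tend to 0 at
   every z.

   By a Schur complement, every iterate is a finite sum of the form
   V^* diag (1 / (l_k - z)) V with V^* V = 1, l_k >= 0 and V^* diag l V <= h.
   Along an ultrafilter the distribution functions of the corresponding measures
   converge, and the first moment bound prevents a loss of mass, so the iterates
   converge to functions of the Stieltjes class, which solve the equations since
   the increments vanish.

   The lower bound follows from T^-1 = - z (1 + Phi1 Tt), whose norm is at most
   |z| (1 + h / delta z). *)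
From HB Require Import structures.
Require Import Defs.
From mathcomp Require Import ring lra measurable_realfun.
Import Order.TTheory GRing.Theory Num.Theory.
Import numFieldNormedType.Exports.
Local Open Scope classical_set_scope.
Local Open Scope sesquilinear_scope.
Local Open Scope complex_scope.
Local Open Scope ring_scope.

(** * Positive maps and the fixed point equation *)

Section Forms.
Variable C : numClosedFieldType.

(** The factor w treats all z of the cut plane alike. For x >= 0 the imaginary part of w / (x - w^2)
    is Im w (x + |w|^2) / |x - w^2|^2, which is positive even for real z < 0, where T itself is
    Hermitian and its imaginary part dominates nothing. The contraction therefore acts at each fixed
    z, and no analytic continuation enters.

    A plain norm estimate does not contract: it gives |P - P'| <= h b^2 |Q - Q'| with b = |w| /
    delta z, and h b^2 may exceed 1. Weighting by the imaginary parts replaces this factor by k = h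
    b / (Im w + h b), which is below 1 for every z.

    For existence, the difficulty is to keep the limit in the Stieltjes class. No representation
    theorem is invoked: the iterates carry explicit finite spectral measures mu, only the scalar
    distribution functions of x^* mu x have to converge, one vector x at a time, and the matrix
    measure is rebuilt from these scalar limits by polarization. For uniqueness, an arbitrary member
    of the class is reached through Riemann sums, which have the same finite form. *)

Definition form m n (x : 'cV[C]_m) (A : 'M[C]_(m, n)) (y : 'cV[C]_n) : C :=
  (x^t* *m A *m y) 0 0.

Lemma trmxCD m n (A B : 'M[C]_(m, n)) : (A + B)^t* = A^t* + B^t*.
Proof. by rewrite linearD map_mxD. Qed.

Lemma trmxCN m n (A : 'M[C]_(m, n)) : (- A)^t* = - A^t*.
Proof. by rewrite linearN map_mxN. Qed.

Lemma trmxCZ m n a (A : 'M[C]_(m, n)) : (a *: A)^t* = a^* *: A^t*.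
Proof. by rewrite linearZ map_mxZ. Qed.

Lemma trmxCM m n p (A : 'M[C]_(m, n)) (B : 'M[C]_(n, p)) :
  (A *m B)^t* = B^t* *m A^t*.
Proof. by rewrite trmx_mul map_mxM. Qed.

Lemma trmxC_scalar n (a : C) : (a%:M : 'M[C]_n)^t* = (a^*)%:M.
Proof. by rewrite tr_scalar_mx map_scalar_mx. Qed.

Lemma trmxC1 n : (1%:M : 'M[C]_n)^t* = 1%:M.
Proof. by rewrite trmxC_scalar rmorph1. Qed.

Lemma trmxC_diag n (d : 'rV[C]_n) : (diag_mx d)^t* = diag_mx (map_mx Num.conj d).
Proof. by rewrite tr_diag_mx map_diag_mx. Qed.

Section FormAlgebra.
Variables (m n : nat).
Implicit Types (A B : 'M[C]_(m, n)) (x : 'cV[C]_m) (y : 'cV[C]_n).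

Lemma formD x A B y : form x (A + B) y = form x A y + form x B y.
Proof. by rewrite /form mulmxDr mulmxDl mxE. Qed.

Lemma formN x A y : form x (- A) y = - form x A y.
Proof. by rewrite /form mulmxN mulNmx mxE. Qed.

Lemma formB x A B y : form x (A - B) y = form x A y - form x B y.
Proof. by rewrite formD formN. Qed.

Lemma formZ a x A y : form x (a *: A) y = a * form x A y.
Proof. by rewrite /form -scalemxAr -scalemxAl mxE. Qed.

Lemma form_sum I (r : seq I) (P : pred I) (F : I -> 'M[C]_(m, n)) x y :
  form x (\sum_(i <- r | P i) F i) y = \sum_(i <- r | P i) form x (F i) y.
Proof. by rewrite /form mulmx_sumr mulmx_suml summxE. Qed.

Lemma form0 x y : form x 0 y = 0.
Proof. by rewrite /form mulmx0 mul0mx mxE. Qed.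

Lemma formDl x x' A y : form (x + x') A y = form x A y + form x' A y.
Proof. by rewrite /form trmxCD !mulmxDl mxE. Qed.

Lemma formDr x A y y' : form x A (y + y') = form x A y + form x A y'.
Proof. by rewrite /form mulmxDr mxE. Qed.

Lemma formZl a x A y : form (a *: x) A y = a^* * form x A y.
Proof. by rewrite /form trmxCZ -!scalemxAl mxE. Qed.

Lemma formZr a x A y : form x A (a *: y) = a * form x A y.
Proof. by rewrite /form -scalemxAr mxE. Qed.

Lemma form0l A y : form 0 A y = 0.
Proof. by rewrite -(scale0r (0 : 'cV[C]_m)) formZl rmorph0 mul0r. Qed.

Lemma form0r x A : form x A 0 = 0.
Proof. by rewrite /form mulmx0 mxE. Qed.

Lemma conj_form x A y : (form x A y)^* = form y (A^t*) x.
Proof.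
rewrite /form; transitivity (((x^t* *m A *m y)^t* ) 0 0); first by rewrite !mxE.
by rewrite !trmxCM trmxCK mulmxA.
Qed.

Lemma form_delta A i j : form (delta_mx i 0) A (delta_mx j 0) = A i j.
Proof.
by rewrite /form trmx_delta map_delta_mx -rowE -colE !mxE.
Qed.

Lemma form_mulmx p q x (P : 'M[C]_(m, p)) (A : 'M[C]_(p, q))
    (Q : 'M[C]_(q, n)) y :
  form x (P *m A *m Q) y = form (P^t* *m x) A (Q *m y).
Proof. by rewrite /form trmxCM trmxCK !mulmxA. Qed.

End FormAlgebra.

Definition sqn n (x : 'cV[C]_n) : C := form x 1%:M x.

Lemma sqnE n (x : 'cV[C]_n) : sqn x = \sum_i `|x i 0| ^+ 2.
Proof.
rewrite /sqn /form mulmx1 mxE; apply: eq_bigr => i _.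
by rewrite !mxE mulrC normCK.
Qed.

Lemma sqn_ge0 n (x : 'cV[C]_n) : 0 <= sqn x.
Proof. by rewrite sqnE sumr_ge0// => i _; rewrite exprn_ge0. Qed.

Lemma sqnZ n a (x : 'cV[C]_n) : sqn (a *: x) = `|a| ^+ 2 * sqn x.
Proof. by rewrite /sqn formZl formZr mulrA (mulrC a^*) -normCK. Qed.

Lemma sqnM m n (A : 'M[C]_(m, n)) (x : 'cV[C]_n) :
  sqn (A *m x) = form x (A^t* *m A) x.
Proof.
by rewrite -[A^t*]mulmx1 form_mulmx trmxCK.
Qed.

Lemma form_scalar n (a : C) (x y : 'cV[C]_n) : form x a%:M y = a * form x 1%:M y.
Proof. by rewrite -formZ scale_scalar_mx mulr1. Qed.

Definition psd n (A : 'M[C]_n) : Prop := forall x : 'cV[C]_n, 0 <= form x A x.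

Lemma psdD n (A B : 'M[C]_n) : psd A -> psd B -> psd (A + B).
Proof. by move=> hA hB x; rewrite formD addr_ge0. Qed.

Lemma psd_gram m n (A : 'M[C]_(m, n)) : psd (A^t* *m A).
Proof. by move=> x; rewrite -sqnM sqn_ge0. Qed.

Lemma form_inj m n (A B : 'M[C]_(m, n)) :
  (forall x y, form x A y = form x B y) -> A = B.
Proof. by move=> AB; apply/matrixP => i j; rewrite -!form_delta AB. Qed.

(* Polarization: taking x + y and x + i y recovers the sesquilinear form. *)
Lemma quad_form_inj n (A B : 'M[C]_n) :
  (forall x, form x A x = form x B x) -> A = B.
Proof.
move=> AB; apply/subr0_eq/form_inj => x y; rewrite form0.
set D := A - B; have {AB}D0 z : form z D z = 0 by rewrite formB AB subrr.
have := D0 (x + y); rewrite !formDl !formDr !D0 addr0 add0r => e1.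
have := D0 (x + 'i *: y); rewrite !formDl !formDr !formZl !formZr !D0 conjCi.
rewrite !mulr0 addr0 add0r => e2.
have e3 : 'i * (form x D y - form y D x) = 0 by rewrite mulrBr -e2; ring.
move/eqP: e3; rewrite mulf_eq0 (negbTE (neq0Ci C))/= subr_eq0 => /eqP e3.
move: e1; rewrite -e3 => /eqP; rewrite -mulr2n mulrn_eq0/= => /eqP.
by [].
Qed.

Lemma psd_herm n (A : 'M[C]_n) : psd A -> A^t* = A.
Proof.
move=> hA; apply: quad_form_inj => x.
by rewrite -conj_form; apply/CrealP; rewrite ger0_real.
Qed.

Lemma psd_spectral n (A : 'M[C]_n) : psd A ->
  exists (U : 'M[C]_n) (d : 'rV[C]_n),
    [/\ U^t* *m U = 1%:M, U *m U^t* = 1%:M, forall i, 0 <= d 0 i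
      & A = U^t* *m diag_mx d *m U].
Proof.
move=> hA.
have hh : A \is hermsymmx.
  apply/is_hermitianmxP; rewrite /= expr0 scale1r.
  by rewrite -[LHS](psd_herm hA).
have uU := spectral_unitarymx A.
have /orthomx_spectralP eA := hermitian_normalmx hh.
rewrite invmx_unitary// in eA.
set U := spectralmx A in uU eA; set d := spectral_diag A in eA.
have UU : U *m U^t* = 1%:M by apply/unitarymxP.
exists U, d; split=> //; first exact: mulmx1C.
move=> i; have := hA (U^t* *m delta_mx i 0).
rewrite -[form _ _ _](form_mulmx _ (U)) ?trmxCK.
rewrite {1}eA !mulmxA UU mul1mx -mulmxA UU mulmx1 form_delta.
by rewrite mxE eqxx mulr1n.
Qed.

Lemma psd_factor n (A : 'M[C]_n) : psd A -> exists E : 'M[C]_n, A = E^t* *m E.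
Proof.
move=> /psd_spectral[U [d [_ _ d0 ->]]].
exists (diag_mx (\row_i sqrtC (d 0 i)) *m U).
rewrite trmxCM !mulmxA; congr (_ *m _); rewrite -mulmxA; congr (_ *m _).
apply/matrixP => i j; rewrite trmxC_diag mul_diag_mx !mxE.
have [->|ij] := eqVneq i j; last by rewrite !mulr0n mulr0.
rewrite !mulr1n -[LHS]sqrtCK expr2; congr (_ * _).
by apply/esym/CrealP; rewrite ger0_real// sqrtC_ge0.
Qed.

(* [dom Y1 Y2 D] says that the block matrix [[Y1, D], [D^t*, Y2]] is
   positive semidefinite.                                             *)
Definition dom n (Y1 Y2 D : 'M[C]_n) : Prop := forall x y : 'cV[C]_n,
  0 <= form x Y1 x + form y Y2 y + form x D y + form y (D^t* ) x.

(** The sign is negative so that, after multiplying one vector by u, the two cross terms in [dom]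
    become minus twice the modulus. *)
Lemma phase (a : C) : exists2 u : C, `|u| = 1 & u * a = - `|a|.
Proof.
have [->|a0] := eqVneq a 0; first by exists 1; rewrite ?normr1// normr0 mulr0 oppr0.
exists (- (a^* / `|a|)).
  by rewrite normrN normf_div norm_conjC normr_id divff// normr_eq0.
by rewrite mulNr mulrAC [a^* * a]mulrC -normCK expr2 mulfK// normr_eq0.
Qed.

(** With its converse [norm_dom], this links the two faces of domination: positive maps preserve
    [dom], while estimates are carried out on moduli. *)
Lemma dom_norm n (Y1 Y2 D : 'M[C]_n) : dom Y1 Y2 D ->
  forall x y, `|form x D y| *+ 2 <= form x Y1 x + form y Y2 y.
Proof.
move=> hD x y; have [u nu ua] := phase (form x D y).
have := hD x (u *: y).
rewrite !formZl !formZr mulrA (mulrC u^* ) -normCK nu expr1n mul1r.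
rewrite -conj_form -rmorphM /= ua rmorphN /= (CrealP _) ?normr_real//.
by rewrite -addrA -opprD subr_ge0 mulr2n.
Qed.

Lemma normC_ge_re (z : C) : 0 <= `|z| *+ 2 + z + z^*.
Proof.
have -> : `|z| *+ 2 + z + z^* = (`|z| + 'Re z) *+ 2.
  rewrite mulrnDl -addrA; congr (_ + _).
  by rewrite ReE -[RHS]mulr_natr divfK// pnatr_eq0.
rewrite pmulrn_lge0// -lerBlDr sub0r -normrN.
by apply: le_trans (leif_Re_Creal (- z)); rewrite raddfN.
Qed.

Lemma norm_dom n (Y1 Y2 D : 'M[C]_n) :
  (forall x y, `|form x D y| *+ 2 <= form x Y1 x + form y Y2 y) -> dom Y1 Y2 D.
Proof.
move=> hD x y; rewrite -conj_form -addrA.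
apply: le_trans (normC_ge_re (form x D y)) _; rewrite -addrA lerD2r.
exact: hD.
Qed.

Lemma domZ n a (Y1 Y2 D : 'M[C]_n) : 0 <= a ->
  dom Y1 Y2 D -> dom (a *: Y1) (a *: Y2) (a *: D).
Proof.
move=> a0 h x y; rewrite trmxCZ !formZ (CrealP _) ?ger0_real// -!mulrDr.
by rewrite mulr_ge0.
Qed.

Lemma psd_dom n (A : 'M[C]_n) : psd A -> dom A A 0.
Proof.
by move=> hA x y; rewrite -conj_form form0 rmorph0 !addr0 addr_ge0.
Qed.

Lemma dom_psdl n (Y1 Y2 D : 'M[C]_n) : dom Y1 Y2 D -> psd Y1.
Proof. by move=> h x; have := h x 0; rewrite !form0r !form0l !addr0. Qed.

(* 2-positivity is all that is needed of the complete positivity of Psi. *)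
Record cpmap m n (Phi : 'M[C]_m -> 'M[C]_n) (h : C) : Prop := CPMap {
  cpmap_lin : forall a A B, Phi (a *: A + B) = a *: Phi A + Phi B;
  cpmap_adj : forall A, Phi (A^t* ) = (Phi A)^t*;
  cpmap_dom : forall Y1 Y2 D, dom Y1 Y2 D -> dom (Phi Y1) (Phi Y2) (Phi D);
  cpmap_unit : psd (h%:M - Phi 1%:M) }.

Section CPMap.
Variables (m n : nat) (Phi : 'M[C]_m -> 'M[C]_n) (h : C).
Hypothesis cp : cpmap Phi h.

Lemma cpmap0 : Phi 0 = 0.
Proof.
by have := cpmap_lin cp (-1) 0 0; rewrite scaler0 addr0 scaleN1r addNr.
Qed.

Lemma cpmapD A B : Phi (A + B) = Phi A + Phi B.
Proof. by have := cpmap_lin cp 1 A B; rewrite !scale1r. Qed.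

Lemma cpmapZ a A : Phi (a *: A) = a *: Phi A.
Proof. by have := cpmap_lin cp a A 0; rewrite cpmap0 !addr0. Qed.

Lemma cpmapB A B : Phi (A - B) = Phi A - Phi B.
Proof. by rewrite cpmapD -scaleN1r cpmapZ scaleN1r. Qed.

Lemma cpmap_sum I (r : seq I) (P : pred I) (F : I -> 'M[C]_m) :
  Phi (\sum_(i <- r | P i) F i) = \sum_(i <- r | P i) Phi (F i).
Proof. by apply: (big_morph Phi); [exact: cpmapD|exact: cpmap0]. Qed.

Lemma cpmap_psd A : psd A -> psd (Phi A).
Proof. by move=> /psd_dom/(cpmap_dom cp)/dom_psdl. Qed.

Lemma cpmap_form1 x : form x (Phi 1%:M) x <= h * sqn x.
Proof.
by have := cpmap_unit cp x; rewrite formB form_scalar subr_ge0.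
Qed.

Lemma cpmap_le b Y : (forall x, form x Y x <= b * sqn x) -> 
  forall x, 0 <= b -> form x (Phi Y) x <= h * b * sqn x.
Proof.
move=> Yb x b0.
have : psd (b%:M - Y) by move=> y; rewrite formB form_scalar subr_ge0.
move=> /cpmap_psd/(_ x); rewrite -scalemx1 cpmapB cpmapZ formB formZ subr_ge0.
move=> /le_trans; apply; rewrite [h * b]mulrC -mulrA.
by rewrite ler_wpM2l// cpmap_form1.
Qed.

(** A norm bound b on D is a domination by b times the identity, which a 2-positive map preserves;
    hence the norm of such a map is controlled by its value at 1. *)
Lemma cpmap_norm b D : 0 <= b ->
  (forall x y, `|form x D y| *+ 2 <= b * (sqn x + sqn y)) ->
  forall x y, `|form x (Phi D) y| *+ 2 <= h * b * (sqn x + sqn y).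
Proof.
move=> b0 hD x y.
have : dom (b *: 1%:M) (b *: 1%:M) D.
  by apply: norm_dom => u v; rewrite !formZ -mulrDr.
move=> /(cpmap_dom cp)/dom_norm/(_ x y)/le_trans; apply.
rewrite !cpmapZ !formZ -mulrDr [h * b]mulrC -mulrA ler_wpM2l// mulrDr.
by rewrite lerD// cpmap_form1.
Qed.

End CPMap.

Definition immx n (Q : 'M[C]_n) : 'M[C]_n := (2 * 'i)^-1 *: (Q - Q^t* ).

(* The first condition says that the operator norm of Q is at most b. *)
Definition halfplane n (b : C) (Q : 'M[C]_n) : Prop :=
  (forall x y, `|form x Q y| *+ 2 <= b * (sqn x + sqn y)) /\ psd (immx Q).

(* For w ^ 2 = z, Q = w Tt and P = w T, this is T = - z^-1 (1 + Phi Tt)^-1. *)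
Definition step m n (Phi : 'M[C]_m -> 'M[C]_n) (w : C) (Q : 'M[C]_m) P : Prop :=
  P *m (w%:M + Phi Q) = - 1%:M.

Lemma norm_sqn_le n (b : C) (A : 'M[C]_n) : 0 <= b ->
  (forall x y, `|form x A y| *+ 2 <= b * (sqn x + sqn y)) ->
  forall x, sqn (A *m x) <= b ^+ 2 * sqn x.
Proof.
move=> b0 hA x; set y := A *m x.
have hy : form y A x = sqn y by rewrite /sqn -{2}[y]/(A *m x) /form mulmx1 mulmxA.
have [b1|b1] := eqVneq b 0.
  have := hA y x; rewrite hy ger0_norm ?sqn_ge0// b1 mul0r => h.
  by rewrite expr0n mul0r -(pmulrn_lle0 _ (ltn0Sn 1)).
have bp : 0 < b by rewrite lt_def b1.
(* The hypothesis bounds a product by a mean of squares; the relative scale b^-1 balances the two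
   squares and recovers the sharp bound. *)
have := hA (b^-1 *: y) x; rewrite formZl hy normrM norm_conjC normfV.
rewrite sqnZ normfV (ger0_norm b0) (ger0_norm (sqn_ge0 y)) exprVn mulrDr.
have -> : b * (b ^- 2 * sqn y) = b^-1 * sqn y by rewrite mulrA expr2; field.
by rewrite mulr2n lerD2l ler_pdivrMl// mulrA -expr2.
Qed.

Lemma cauchy_schwarz1 n (x y : 'cV[C]_n) :
  `|form x 1%:M y| *+ 2 <= sqn x + sqn y.
Proof.
apply: dom_norm => {}x {}y; have := sqn_ge0 (x + y).
rewrite trmxC1 /sqn formDl !formDr => h; apply: le_trans h _.
by rewrite le_eqVlt; apply/orP; left; apply/eqP; ring.
Qed.

(** * One step of the fixed point iteration *)

Section Step.
Variables (m n : nat) (Phi : 'M[C]_m -> 'M[C]_n) (h : C) (w : C).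
Hypotheses (h_ge0 : 0 <= h) (cp : cpmap Phi h).
Implicit Types (Q : 'M[C]_m) (P : 'M[C]_n).

Lemma step_mulC Q P : step Phi w Q P -> (w%:M + Phi Q) *m P = - 1%:M.
Proof.
rewrite /step => h1.
have : (- P) *m (w%:M + Phi Q) = 1%:M by rewrite mulNmx h1 opprK.
by move=> /mulmx1C; rewrite mulmxN => /eqP; rewrite eqr_oppLR => /eqP.
Qed.

(** This is Im w, written algebraically because the field is abstract here; [half_im] identifies it
    for complex numbers. *)
Let v := (2 * 'i)^-1 * (w - w^* ).

Let immxW Q : (2 * 'i)^-1 *: ((w%:M + Phi Q) - (w%:M + Phi Q)^t* ) =
  v%:M + Phi (immx Q).
Proof.
rewrite trmxCD trmxC_scalar -(cpmap_adj cp) opprD addrACA -raddfB/= -(cpmapB cp).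
by rewrite scalerDr scale_scalar_mx (cpmapZ cp).
Qed.

Lemma immx_step Q P : step Phi w Q P ->
  immx P = P *m (v%:M + Phi (immx Q)) *m P^t*.
Proof.
move=> PW; rewrite -immxW -scalemxAr -scalemxAl mulmxBr mulmxBl.
by rewrite PW -[_ *m _ *m P^t*]mulmxA -trmxCM PW trmxCN trmxC1 mulmxN mulNmx
  mul1mx mulmx1 opprK addrC.
Qed.

(** Both orders of the factors are needed: in P - P' = P (Phi (Q - Q')) P' the left vector meets P
    and the right vector meets P', so one side uses [immx_step] and the other this identity. *)
Lemma immx_step' Q P : step Phi w Q P ->
  immx P = P^t* *m (v%:M + Phi (immx Q)) *m P.
Proof.
move=> /step_mulC PW; rewrite -immxW -scalemxAr -scalemxAl mulmxBr mulmxBl.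
by rewrite -trmxCM PW -[P^t* *m _ *m P]mulmxA PW trmxCN trmxC1 mulmxN mulNmx
  mul1mx mulmx1 opprK addrC.
Qed.

Lemma step_norm b Q : 0 <= b ->
  (forall x y, `|form x Q y| *+ 2 <= b * (sqn x + sqn y)) ->
  forall x y, `|form x (w%:M + Phi Q) y| *+ 2 <= (`|w| + h * b) * (sqn x + sqn y).
Proof.
move=> b0 hQ x y; rewrite formD form_scalar mulrDl.
apply: le_trans (_ : (`|w * form x 1%:M y| + `|form x (Phi Q) y|) *+ 2 <= _).
  by rewrite lerMn2r ler_normD orbT.
rewrite mulrnDl lerD ?(cpmap_norm cp)//.
by rewrite normrM -mulrnAr ler_wpM2l// cauchy_schwarz1.
Qed.

(** Taking adjoints in the step equation gives x = - W^H (P^H x) with W = w + Phi Q, so a lower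
    bound for P^H is an upper bound for the norm of W. This serves both to start the contraction and
    to prove the lower bound of the theorem. *)
Lemma step_lower' b Q P : 0 <= b ->
  (forall x y, `|form x Q y| *+ 2 <= b * (sqn x + sqn y)) -> step Phi w Q P ->
  forall x, sqn x <= (`|w| + h * b) ^+ 2 * sqn (P^t* *m x).
Proof.
move=> b0 hQ PW x; set W := w%:M + Phi Q.
have -> : sqn x = sqn (W^t* *m (P^t* *m x)).
  by rewrite mulmxA -trmxCM PW trmxCN trmxC1 mulNmx mul1mx -scaleN1r sqnZ
     normrN1 expr1n mul1r.
apply: norm_sqn_le; first by rewrite addr_ge0// mulr_ge0.
move=> {}x y; rewrite -conj_form norm_conjC [sqn x + _]addrC; exact: step_norm.
Qed.

Lemma immx_le b Q : halfplane b Q -> forall x, form x (immx Q) x <= b * sqn x.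
Proof.
move=> [h1 h2] x; rewrite -[X in X <= _]ger0_norm//.
rewrite formZ formB -conj_form normrM normfV normrM normCi mulr1.
rewrite (ger0_norm (ler0n _ 2)) ler_pdivrMl ?ltr0n//.
apply: le_trans (ler_normB _ _) _; rewrite norm_conjC -mulr2n.
by apply: le_trans (h1 x x) _; rewrite -mulr2n mulrnAr mulr_natl.
Qed.

(* The factor is [h b / (v + h b)], because [Phi (immx Q) <= h b] gives
   [Phi (immx Q) <= h b / (v + h b) * (v + Phi (immx Q))].               *)
Lemma step_contract b d Q Q' P P' : 0 <= b -> 0 < v -> 0 <= d ->
  halfplane b Q -> halfplane b Q' -> step Phi w Q P -> step Phi w Q' P' ->
  dom (d *: immx Q) (d *: immx Q') (Q - Q') ->
  let k := h * b / (v + h * b) in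
  dom ((k * d) *: immx P) ((k * d) *: immx P') (P - P').
Proof.
move=> b0 v0 d0 hQ hQ' sP sP' hdom k.
have hb : 0 <= h * b by rewrite mulr_ge0.
have k0 : 0 <= k by rewrite divr_ge0// addr_ge0// ltW.
have key X x : halfplane b X ->
    form x (Phi (immx X)) x <= k * form x (v%:M + Phi (immx X)) x.
  move=> hX; have vhb : 0 < v + h * b by rewrite ltr_wpDr.
  rewrite /k mulrAC ler_pdivlMr// formD form_scalar mulrDr mulrDr [_ * v]mulrC.
  rewrite [_ * (h * b)]mulrC lerD2r mulrCA.
  by rewrite ler_pM2l//; exact: (cpmap_le cp (immx_le hX)).
have eP : P - P' = P *m Phi (Q - Q') *m P'.
  have -> : Phi (Q - Q') = (w%:M + Phi Q) - (w%:M + Phi Q').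
    by rewrite (cpmapB cp) opprD addrACA subrr add0r.
  rewrite mulmxBr mulmxBl sP -mulmxA (step_mulC sP') mulmxN mulmx1 mulNmx mul1mx.
  by rewrite opprK addrC.
apply: norm_dom => x y; rewrite eP form_mulmx.
have := cpmap_dom cp hdom => /dom_norm/(_ (P^t* *m x) (P' *m y))/le_trans; apply.
rewrite !(cpmapZ cp d) !(formZ d) !(formZ (k * d)) (immx_step sP) (immx_step' sP') !form_mulmx trmxCK.
rewrite [k * d]mulrC -2!(mulrA d k).
by apply: lerD; rewrite ler_wpM2l//; apply: key.
Qed.

End Step.

(** Stieltjes transform of the discrete matrix measure whose mass at l k is the Gram matrix of the
    k-th row of V. *)
Definition res p n (V : 'M[C]_(p, n)) (l : 'rV[C]_p) (z : C) : 'M[C]_n :=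
  V^t* *m diag_mx (\row_i (l 0 i - z)^-1) *m V.

Lemma gram_sum p n (V : 'M[C]_(p, n)) (d : 'rV[C]_p) :
  V^t* *m diag_mx d *m V = \sum_k d 0 k *: ((row k V)^t* *m row k V).
Proof.
apply/matrixP => i j; rewrite mul_mx_diag summxE mxE; apply: eq_bigr => k _.
by rewrite !mxE big_ord1 !mxE mulrAC mulrC.
Qed.

(** Each B k splits into rank one terms, and f repeats the index k once for each of them. The matrix
    E does not depend on d, so one factorization serves for the weights 1 / (l - z) at every z and
    for the constant weight 1. *)
Lemma factor_sum p n (B : 'I_p -> 'M[C]_n) : (forall k, psd (B k)) ->
  exists (q : nat) (f : 'I_q -> 'I_p) (E : 'M[C]_(q, n)),
    forall d : 'I_p -> C,
    \sum_k d k *: B k = E^t* *m diag_mx (\row_t d (f t)) *m E.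
Proof.
move=> /(_ _)/psd_factor hB; have [F FE] := fin_all_exists hB.
pose I := ('I_p * 'I_n)%type; pose e (t : 'I_#|{: I}|) : I := enum_val t.
exists #|{: I}|, (fun t => (e t).1), (\matrix_(t, j) F (e t).1 (e t).2 j) => d.
rewrite gram_sum (reindex enum_rank) /=; last first.
  by exists enum_val => ? _; rewrite ?enum_rankK ?enum_valK.
transitivity (\sum_(x : I) d x.1 *: ((row x.2 (F x.1))^t* *m row x.2 (F x.1))).
  rewrite -(pair_bigA _ (fun k l => d k *: ((row l (F k))^t* *m row l (F k)))).
  apply: eq_bigr => k _ /=; rewrite -scaler_sumr FE; congr (_ *: _).
  rewrite -[in LHS](mulmx1 ((F k)^t* )) -diag_const_mx gram_sum.
  by apply: eq_bigr => l _; rewrite mxE scale1r.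
apply: eq_bigr => x _; rewrite mxE /e enum_rankK.
suff -> : row (enum_rank x) (\matrix_(t, j) F (enum_val t).1 (enum_val t).2 j)
  = row x.2 (F x.1) by [].
by apply/rowP => j; rewrite !mxE enum_rankK.
Qed.

(* With Phi (res V l z) = E^* diag(1 / (l - z)) E, the Schur complement of the
   lower right block of H - z, for the Gram matrix H of (E, sqrt(diag l)), is
   - z (1 + Phi (res V l z)); the first moment of V' is the upper left block
   E^* E of H.                                                               *)
Lemma res_step m n (Phi : 'M[C]_m -> 'M[C]_n) h p (V : 'M[C]_(p, m)) (l : 'rV[C]_p) :
  cpmap Phi h -> (forall i, 0 <= l 0 i) -> psd (1%:M - V^t* *m V) ->
  exists (q : nat) (V' : 'M[C]_(q, n)) (l' : 'rV[C]_q),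
    [/\ forall i, 0 <= l' 0 i, V'^t* *m V' = 1%:M,
        psd (h%:M - V'^t* *m diag_mx l' *m V')
      & forall z, ~~ (0 <= z) -> (1%:M + Phi (res V l z)) \in unitmx /\
         - z^-1 *: invmx (1%:M + Phi (res V l z)) = res V' l' z].
Proof.
move=> cp l0 V1.
have : forall k, psd (Phi ((row k V)^t* *m row k V)).
  by move=> k; apply: (cpmap_psd cp); exact: psd_gram.
move=> /factor_sum[q [f [E EE]]].
have PhiV d : Phi (V^t* *m diag_mx d *m V) =
    E^t* *m diag_mx (\row_t d 0 (f t)) *m E.
  rewrite gram_sum (cpmap_sum cp) -(EE (fun k => d 0 k)).
  by apply: eq_bigr => k _; rewrite (cpmapZ cp).
pose s : 'rV[C]_q := \row_t sqrtC (l 0 (f t)).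
have s2 t : s 0 t * s 0 t = l 0 (f t) by rewrite mxE -expr2 sqrtCK.
have sC : map_mx Num.conj s = s.
  apply/rowP => t; rewrite !mxE; apply/CrealP.
  by rewrite ger0_real// sqrtC_ge0.
pose W := row_mx E (diag_mx s); pose H := W^t* *m W.
have HE : H = block_mx (E^t* *m E) (E^t* *m diag_mx s)
                       (diag_mx s *m E) (diag_mx s *m diag_mx s).
  rewrite /H /W tr_row_mx map_col_mx mul_col_row.
  by rewrite tr_diag_mx map_diag_mx sC.
have /psd_spectral[U [d [UU UU' d0 HU]]] : psd H by exact: psd_gram.
(* The upper left block of U^H diag (1 / (d - z)) U, the inverse of H - z, involves only the first n
   columns of U, so it is [res V' d z]. *)
pose V' := lsubmx U; pose V'' := rsubmx U.
have blockU (g : 'rV_(n + q)) : U^t* *m diag_mx g *m U =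
    block_mx (V'^t* *m diag_mx g *m V') (V'^t* *m diag_mx g *m V'')
             (V''^t* *m diag_mx g *m V') (V''^t* *m diag_mx g *m V'').
  rewrite -[U]hsubmxK tr_row_mx map_col_mx mul_col_mx mul_col_row.
  by [].
have V'1 : V'^t* *m V' = 1%:M.
  have := blockU (const_mx 1); rewrite diag_const_mx !mulmx1 UU.
  by rewrite (scalar_mx_block n q 1) => /eq_block_mx[].
have V'd : V'^t* *m diag_mx d *m V' = E^t* *m E.
  by have := blockU d; rewrite -HU HE => /eq_block_mx[].
exists (n + q)%N, V', d; split=> //.
  rewrite V'd.
  have -> : E^t* *m E = Phi (V^t* *m V).
    rewrite -[in RHS](mulmx1 (V^t* )) -diag_const_mx PhiV.
    have -> : \row_t (const_mx 1 : 'rV[C]_p) 0 (f t) = const_mx 1.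
      by apply/rowP => t; rewrite !mxE.
    by rewrite diag_const_mx mulmx1.
  have -> : h%:M - Phi (V^t* *m V) =
      (h%:M - Phi 1%:M) + Phi (1%:M - V^t* *m V).
    by rewrite (cpmapB cp) addrA subrK.
  by apply: psdD; [exact: (cpmap_unit cp)|exact: (cpmap_psd cp)].
move=> z z0.
have zn0 : z != 0 by apply: contraNneq z0 => ->.
have neq (x : C) : 0 <= x -> x - z != 0.
  by move=> x0; rewrite subr_eq0; apply: contraNneq z0 => <-.
pose g : 'rV[C]_q := \row_t (l 0 (f t) - z)^-1.
have PhiQ : Phi (res V l z) = E^t* *m diag_mx g *m E.
  rewrite /res PhiV; congr (_ *m diag_mx _ *m _).
  by apply/rowP => t; rewrite !mxE.
pose G : 'rV[C]_(n + q) := \row_i (d 0 i - z)^-1.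
have HG : (U^t* *m diag_mx G *m U) *m (H - z%:M) = 1%:M.
  have -> : H - z%:M = U^t* *m diag_mx (\row_i (d 0 i - z)) *m U.
    have -> : diag_mx (\row_i (d 0 i - z)) = diag_mx d - z%:M.
      rewrite -diag_const_mx -raddfB /=; congr diag_mx.
      by apply/rowP => i; rewrite !mxE.
    by rewrite mulmxBr mulmxBl -HU mul_mx_scalar -scalemxAl UU scalemx1.
  rewrite !mulmxA -[_ *m U *m U^t*]mulmxA UU' mulmx1 -[_ *m _ *m diag_mx _]mulmxA.
  rewrite mulmx_diag (_ : \row_i _ = const_mx 1) ?diag_const_mx ?mulmx1//.
  by apply/rowP => i; rewrite !mxE mulVf// neq.
rewrite -/(res V' d z) in HG *.
set R := res V' d z.
move: HG; rewrite blockU -/R HE (scalar_mx_block n q z) (scalar_mx_block n q 1).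
rewrite opp_block_mx add_block_mx !oppr0 !addr0 mulmx_block.
set X := V'^t* *m _ *m V'' => /eq_block_mx[].
rewrite -[V'^t* *m diag_mx G *m V']/R => h11 h12 _ _.
have gE t : (l 0 (f t) - z) * g 0 t = 1 by rewrite mxE mulfV// neq.
have SG : (diag_mx s *m diag_mx s - z%:M) *m diag_mx g = 1%:M.
  rewrite mulmx_diag -!diag_const_mx -raddfB /= mulmx_diag; congr diag_mx.
  by apply/rowP => t; rewrite mxE [X in X * _]mxE [X in X + _]mxE s2 !mxE
    mulfV// neq.
(* The second block equation expresses the off-diagonal block X through R; substituted in the first
   one, it leaves R times the Schur complement. *)
have XE : X = - (R *m E^t* *m diag_mx (\row_t (s 0 t * g 0 t))).
  rewrite -mulmx_diag -[LHS]mulmx1 -SG !mulmxA -mulNmx; congr (_ *m _).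
  by apply/eqP; rewrite -addr_eq0 addrC -[R *m _ *m _]mulmxA h12.
(* Entrywise this is 1 - l / (l - z) = - z / (l - z). *)
have key : E^t* *m E - E^t* *m diag_mx (\row_t (s 0 t * g 0 t)) *m
    (diag_mx s *m E) = - z *: (E^t* *m diag_mx g *m E).
  rewrite !mulmxA -[E^t* *m _ *m diag_mx s]mulmxA mulmx_diag.
  rewrite -[X in X *m E - _]mulmx1 -diag_const_mx -mulmxBl -mulmxBr -raddfB /=.
  rewrite scalemxAl scalemxAr -linearZ /=; congr (_ *m diag_mx _ *m _).
  apply/rowP => t; rewrite !mxE; move: (gE t) (s2 t); rewrite !mxE => h1 h2.
  rewrite mulrAC h2 -[X in X - _]h1; ring.
have RA : (- z *: R) *m (1%:M + Phi (res V l z)) = 1%:M.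
  apply: etrans h11; rewrite XE PhiQ [LHS]mulmxDr mulmx1 mulNmx -[R *m E^t* *m _]mulmxA -[R *m _ *m _]mulmxA.
  rewrite [X in _ = X + _]mulmxBr mul_mx_scalar -addrA [X in _ = _ + X]addrC.
  by rewrite addrA -mulmxBr key -scalemxAr -scalemxAl addrC scaleNr.
have /mulmx1_unit[_ AU] := RA; split => //.
move: RA; rewrite -scalemxAl => RA.
have -> : invmx (1%:M + Phi (res V l z)) = - z *: R.
  rewrite -[RHS]mulmx1 -[in RHS](mulmxV AU) mulmxA -[(_ *: R) *m _]scalemxAl RA.
  by rewrite mul1mx.
by rewrite scalerA mulrNN mulVf// scale1r.
Qed.

Lemma cpmap_le_const m n (Phi : 'M[C]_m -> 'M[C]_n) h h' : h <= h' ->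
  cpmap Phi h -> cpmap Phi h'.
Proof.
move=> hh [p1 p2 p3 p4]; split=> // x; have := p4 x.
rewrite !formB (form_scalar h) (form_scalar h') !subr_ge0 => /le_trans; apply.
by rewrite ler_wpM2r// sqn_ge0.
Qed.

(** * Geometric decay along coupled sequences *)

Section Iteration.
Variables (m n : nat) (Phi1 : 'M[C]_n -> 'M[C]_m) (Phi2 : 'M[C]_m -> 'M[C]_n).
Variables (h w b : C).
Hypotheses (h_ge0 : 0 <= h) (b_ge0 : 0 <= b).
Hypotheses (cp1 : cpmap Phi1 h) (cp2 : cpmap Phi2 h).
Let v := (2 * 'i)^-1 * (w - w^* ).
Hypothesis v_gt0 : 0 < v.

Let k : C := h * b / (v + h * b).
Let g : C := `|w| + h * b.
(** The constant solves d * (v / g ^+ 2) = 2 b: after one step the imaginary parts are at least v /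
    g ^+ 2, while two matrices of norm at most b differ by at most 2 b. *)
Let d : C := b * g ^+ 2 / v *+ 2.

Let w_neq0 : w != 0.
Proof.
apply: contraTneq v_gt0 => w0.
by rewrite /v w0 rmorph0 subrr mulr0 ltxx.
Qed.

Let g_gt0 : 0 < g.
Proof. by rewrite ltr_wpDr ?mulr_ge0// normr_gt0. Qed.

Let d_ge0 : 0 <= d.
Proof.
apply/mulrn_wge0/divr_ge0; last exact: ltW.
by rewrite mulr_ge0// exprn_ge0// ltW.
Qed.

Lemma step_immx_lower p q (Phi : 'M[C]_p -> 'M[C]_q) Q P : cpmap Phi h ->
  halfplane b Q -> step Phi w Q P ->
  forall x, v / g ^+ 2 * sqn x <= form x (immx P) x.
Proof.
move=> cp [hQ hQ'] sP x; rewrite (immx_step cp sP) form_mulmx formD form_scalar.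
rewrite ler_wpDr ?(cpmap_psd cp)// -/v -mulrA ler_wpM2l ?(ltW v_gt0)//.
rewrite ler_pdivrMl ?exprn_gt0//.
exact: (step_lower' h_ge0 cp b_ge0 hQ sP).
Qed.

Lemma first_dom p q (Phi : 'M[C]_p -> 'M[C]_q) Q P Q' P' : cpmap Phi h ->
  halfplane b Q -> halfplane b P -> step Phi w Q P ->
  halfplane b Q' -> halfplane b P' -> step Phi w Q' P' ->
  dom (d *: immx P) (d *: immx P') (P - P').
Proof.
move=> cp hQ [hP _] sP hQ' [hP' _] sP'; apply: norm_dom => x y.
rewrite formB !(formZ d).
apply: le_trans (_ : `|form x P y| *+ 2 + `|form x P' y| *+ 2 <= _).
  by rewrite -mulrnDl lerMn2r ler_normB orbT.
apply: le_trans (lerD (hP x y) (hP' x y)) _.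
have dv : d * (v / g ^+ 2) = b *+ 2.
  rewrite /d mulrnAl; congr (_ *+ 2); field.
  by rewrite !gt_eqF.
apply: le_trans (_ : d * (v / g ^+ 2 * sqn x) + d * (v / g ^+ 2 * sqn y) <= _).
  rewrite (mulrA d _ (sqn x)) (mulrA d _ (sqn y)) dv le_eqVlt;
    apply/orP; left; apply/eqP; ring.
by apply: lerD; rewrite ler_wpM2l//; [apply: (step_immx_lower cp hQ)|
  apply: (step_immx_lower cp hQ')].
Qed.

(** Two uses are intended: constant sequences give uniqueness, and an iteration compared with its
    own shift gives vanishing increments. Domination starts at index 1, since only a matrix produced
    by a step has its imaginary part bounded below; the starting value may thus be 0. The statement
    for Q follows by exchanging the roles of the two sequences. *)
Lemma iter_contract (P P' : nat -> 'M[C]_m) (Q Q' : nat -> 'M[C]_n) :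
  (forall j, [/\ halfplane b (P j), halfplane b (Q j),
     step Phi1 w (Q j) (P j.+1) & step Phi2 w (P j) (Q j.+1)]) ->
  (forall j, [/\ halfplane b (P' j), halfplane b (Q' j),
     step Phi1 w (Q' j) (P' j.+1) & step Phi2 w (P' j) (Q' j.+1)]) ->
  forall j x y,
    `|form x (P j.+1 - P' j.+1) y| *+ 2 <= k ^+ j * d * b * (sqn x + sqn y).
Proof.
move=> H H' j x y.
have hb : 0 <= h * b by rewrite mulr_ge0.
have k0 : 0 <= k by apply: divr_ge0 => //; rewrite addr_ge0// ltW.
have kd0 i : 0 <= k ^+ i * d by rewrite mulr_ge0// exprn_ge0.
have [H1 _] : dom ((k ^+ j * d) *: immx (P j.+1)) ((k ^+ j * d) *: immx (P' j.+1))
           (P j.+1 - P' j.+1) /\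
     dom ((k ^+ j * d) *: immx (Q j.+1)) ((k ^+ j * d) *: immx (Q' j.+1))
           (Q j.+1 - Q' j.+1).
  elim: j => [|j [IHP IHQ]].
    have [a1 a2 a3 a4] := H 0%N; have [a1' a2' a3' a4'] := H' 0%N.
    have [c1 c2 _ _] := H 1%N; have [c1' c2' _ _] := H' 1%N.
    rewrite expr0 mul1r; split.
      by apply: (first_dom cp1 a2 c1 a3 a2' c1' a3').
    by apply: (first_dom cp2 a1 c2 a4 a1' c2' a4').
  have [a1 a2 a3 a4] := H j.+1; have [a1' a2' a3' a4'] := H' j.+1.
  rewrite exprS -mulrA; split.
    by apply: (step_contract h_ge0 cp1 b_ge0 v_gt0 (kd0 j) a2 a2' a3 a3').
  by apply: (step_contract h_ge0 cp2 b_ge0 v_gt0 (kd0 j) a1 a1' a4 a4').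
have [a1 _ _ _] := H j.+1; have [a1' _ _ _] := H' j.+1.
apply: le_trans (dom_norm H1 x y) _.
rewrite !(formZ (k ^+ j * d)) -mulrDr -(mulrA _ b) ler_wpM2l// mulrDr.
by apply: lerD; apply: immx_le.
Qed.

End Iteration.

End Forms.

(** * Complex numbers and the cut plane *)

Section ComplexFacts.
Variable R : realType.
Notation C := R[i].
Notation Re := complex.Re.
Notation Im := complex.Im.

Lemma ReD (x y : C) : Re (x + y) = Re x + Re y.
Proof. by case: x y => [a b] [c d]. Qed.

Lemma ImD (x y : C) : Im (x + y) = Im x + Im y.
Proof. by case: x y => [a b] [c d]. Qed.

Lemma ReN (x : C) : Re (- x) = - Re x. Proof. by case: x. Qed.

Lemma ImN (x : C) : Im (- x) = - Im x. Proof. by case: x. Qed.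

Lemma ReM (x y : C) : Re (x * y) = Re x * Re y - Im x * Im y.
Proof. by case: x y => [a b] [c d]. Qed.

Lemma ImM (x y : C) : Im (x * y) = Re x * Im y + Im x * Re y.
Proof. by case: x y => [a b] [c d]. Qed.

Lemma Re_sum I (r : seq I) (P : pred I) (F : I -> C) :
  Re (\sum_(i <- r | P i) F i) = \sum_(i <- r | P i) Re (F i).
Proof. exact: (big_morph _ ReD). Qed.

Lemma Im_sum I (r : seq I) (P : pred I) (F : I -> C) :
  Im (\sum_(i <- r | P i) F i) = \sum_(i <- r | P i) Im (F i).
Proof. exact: (big_morph _ ImD). Qed.

Lemma ReMl (a : R) (x : C) : Re (a%:C * x) = a * Re x.
Proof. by rewrite ReM /= mul0r subr0. Qed.

Lemma ImMl (a : R) (x : C) : Im (a%:C * x) = a * Im x.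
Proof. by rewrite ImM /= mul0r addr0. Qed.

Lemma Re_conj (x : C) : Re (x^* )%R = Re x. Proof. by case: x. Qed.

Lemma Im_conj (x : C) : Im (x^* )%R = - Im x. Proof. by case: x. Qed.

Lemma conj_real_complex (a : R) : (a%:C)^*%R = a%:C.
Proof. exact: conjc_real. Qed.

Lemma imaginaryE : 'i%R = 'i%C :> C.
Proof. by []. Qed.

Lemma normcE_cmod (x : C) : `|x| = (cmod x)%:C.
Proof. by []. Qed.

Lemma cmod_ge0 (x : C) : 0 <= cmod x.
Proof. by case: x => a b; rewrite sqrtr_ge0. Qed.

Lemma cmodD (x y : C) : cmod (x + y) <= cmod x + cmod y.
Proof. by rewrite -lecR rmorphD -!normcE_cmod ler_normD. Qed.

Lemma cmodM (x y : C) : cmod (x * y) = cmod x * cmod y.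
Proof. exact: Normc.normcM. Qed.

Lemma cmodV (x : C) : cmod x^-1 = (cmod x)^-1.
Proof. exact: Normc.normcV. Qed.

Lemma cmodN (x : C) : cmod (- x) = cmod x.
Proof. exact: normcN. Qed.

Lemma cmodR (x : R) : cmod x%:C = `|x|.
Proof. by rewrite /cmod /= expr0n addr0 sqrtr_sqr. Qed.

Lemma cmod_eq0 (x : C) : cmod x = 0 -> x = 0.
Proof. exact: Normc.eq0_normc. Qed.

Lemma Re_le_cmod (x : C) : `|Re x| <= cmod x.
Proof.
case: x => a b; rewrite /cmod /= -sqrtr_sqr ler_wsqrtr// lerDl sqr_ge0.
by [].
Qed.

Lemma Im_le_cmod (x : C) : `|Im x| <= cmod x.
Proof.
by case: x => a b; rewrite /cmod /= -sqrtr_sqr ler_wsqrtr// lerDr sqr_ge0.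
Qed.

Lemma cmod_le_ReIm (x : C) : cmod x <= `|Re x| + `|Im x|.
Proof.
rewrite {1}(complexE x) (le_trans (cmodD _ _))// cmodM !cmodR.
by rewrite [cmod _](_ : _ = 1) ?mul1r// /cmod /= expr0n expr1n add0r sqrtr1.
Qed.

Lemma ge0_complex (x : C) : (0 <= x) = (Im x == 0) && (0 <= Re x).
Proof. by rewrite lecE. Qed.

Lemma complex_ext (x y : C) : Re x = Re y -> Im x = Im y -> x = y.
Proof. by case: x y => [a b] [c d] /= -> ->. Qed.

Lemma sqrt_upper (z : C) : ~~ (0 <= z) -> exists2 w : C, w * w = z & 0 < Im w.
Proof.
move=> z0; have [w wz] : exists w : C, w * w = z.
  by exists (sqrtC z); rewrite -expr2 sqrtCK.
have [w0|w0|w0] := ltgtP 0 (Im w); first by exists w.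
  by exists (- w); rewrite ?mulrNN// ImN oppr_gt0.
case/negP: z0; rewrite -wz ge0_complex ReM ImM -w0 mulr0 mul0r addr0 eqxx/=.
by rewrite mulr0 subr0 -expr2 sqr_ge0.
Qed.

Lemma half_im (w : C) : (2 * 'i%R)^-1 * (w - (w^* )%R) = (Im w)%:C.
Proof.
have -> : w - (w^* )%R = (2 * 'i%R) * (Im w)%:C.
  apply: complex_ext.
    rewrite ReD ReN Re_conj subrr imaginaryE mulrC ReMl ReM /=; ring.
  rewrite ImD ImN Im_conj opprK imaginaryE mulrC ImMl ImM /=; ring.
by rewrite mulKf// mulf_neq0 ?pnatr_eq0// neq0Ci.
Qed.

Lemma form_immx n (Q : 'M[C]_n) x : form x (immx Q) x = (Im (form x Q x))%:C.
Proof. by rewrite formZ formB -conj_form half_im. Qed.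

Lemma psd_immx n (Q : 'M[C]_n) :
  psd (immx Q) <-> forall x, 0 <= Im (form x Q x).
Proof. by split=> h x; have := h x; rewrite form_immx ler0c. Qed.

Lemma delta_le (z : C) (x : R) : 0 <= x -> delta z <= cmod (x%:C - z).
Proof.
move=> x0; rewrite -cmodN opprB; apply: ge_inf; last by exists x.
by exists 0 => _ [y _ <-]; exact: cmod_ge0.
Qed.

Lemma delta_le_cmod (z : C) : delta z <= cmod z.
Proof. by have := delta_le z (lexx 0); rewrite sub0r cmodN. Qed.

Lemma delta_gt0 (z : C) : ~~ (0 <= z) -> 0 < delta z.
Proof.
rewrite ge0_complex negb_and -ltNge => hz.
have [e e0 he] : exists2 e, 0 < e & forall x : R, 0 <= x -> e <= cmod (z - x%:C).
  case/orP: hz => hz.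
    exists `|Im z|; first by rewrite normr_gt0.
    move=> x _; apply: le_trans (Im_le_cmod _).
    by rewrite ImD ImN /= oppr0 addr0.
  exists (- Re z); first by rewrite oppr_gt0.
  move=> x x0; apply: le_trans (Re_le_cmod _).
  rewrite ReD ReN /= -normrN opprB ger0_norm; first by rewrite lerDr.
  by rewrite addr_ge0// oppr_ge0 ltW.
apply: lt_le_trans e0 _; apply: lb_le_inf; first by exists (cmod (z - 0%:C)), 0 => //=.
by move=> _ [x /= x0 <-]; exact: he.
Qed.

Lemma cut_neq (z : C) (x : R) : ~~ (0 <= z) -> 0 <= x -> x%:C - z != 0.
Proof.
move=> z0 x0; rewrite subr_eq0; apply: contraNneq z0 => <-.
by rewrite ler0c.
Qed.

Lemma cmod_kernel (z : C) (x : R) : ~~ (0 <= z) -> 0 <= x ->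
  cmod (x%:C - z)^-1 <= (delta z)^-1.
Proof.
move=> z0 x0; rewrite cmodV lef_pV2 ?posrE ?delta_gt0 ?delta_le//.
exact: lt_le_trans (delta_gt0 z0) (delta_le _ x0).
Qed.

(** Multiplying by the conjugate of x - w^2 leaves Im w (x + |w|^2) in the numerator. The kernel 1 /
    (x - z) alone has an imaginary part with the sign of Im z. *)
Lemma Im_kernel (w : C) (x : R) : 0 < Im w -> ~~ (0 <= w * w) -> 0 <= x ->
  0 <= Im (w * (x%:C - w * w)^-1).
Proof.
move=> w0 ww x0; set u := x%:C - w * w.
have u0 : u != 0 by exact: cut_neq.
have -> : w * u^-1 = (cmod u ^- 2)%:C * (w * (u^* )%R).
  have uu : u * (u^* )%R = (cmod u ^+ 2)%:C by rewrite -normCK normcE_cmod rmorphXn.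
  have c0 : (cmod u ^+ 2)%:C != 0 :> C by rewrite -uu mulf_neq0// conjC_eq0.
  apply: (mulIf u0); rewrite -!mulrA mulVf// mulr1 [(u^* )%R * _]mulrC uu.
  by rewrite [w * _]mulrC mulrA fmorphV mulVf// mul1r.
rewrite ImMl mulr_ge0 ?invr_ge0 ?exprn_ge0 ?cmod_ge0//.
rewrite ImM Re_conj Im_conj /u !(ReD, ImD, ReN, ImN, ReM, ImM) /=.
have -> : Re w * - (0 - (Re w * Im w + Im w * Re w)) + Im w * (x - (Re w * Re w - Im w * Im w)) =
  Im w * (x + Re w ^+ 2 + Im w ^+ 2) by ring.
by rewrite mulr_ge0 ?(ltW w0)// !addr_ge0// sqr_ge0.
Qed.

(** Applied both to finite resolvents and to Riemann sums of a matrix measure. The norm bound is the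
    Cauchy-Schwarz inequality for each N k, summed against a total mass of at most 1. *)
Lemma halfplane_sum n (I : finType) (b w : C) (f : I -> C) (N : I -> 'M[C]_n) :
  0 <= b -> (forall k, psd (N k)) -> psd (1%:M - \sum_k N k) ->
  (forall k, `|w * f k| <= b) -> (forall k, 0 <= Im (w * f k)) ->
  halfplane b (w *: \sum_k f k *: N k).
Proof.
move=> b0 hN hN1 hb hI; split.
  move=> x y; rewrite formZ form_sum mulr_sumr.
  apply: le_trans (_ : (\sum_k b * `|form x (N k) y|) *+ 2 <= _).
    rewrite lerMn2r/=; apply: le_trans (ler_norm_sum _ _ _) _.
    by apply: ler_sum => k _; rewrite formZ mulrA normrM ler_wpM2r.
  rewrite -mulr_sumr -mulrnAr ler_wpM2l// -sumrMnl.
  apply: le_trans (_ : \sum_k (form x (N k) x + form y (N k) y) <= _).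
    apply: ler_sum => k _; apply: dom_norm => {}x {}y.
    rewrite (psd_herm (hN k)); have := hN k (x + y).
    rewrite formDl !formDr => h; apply: le_trans h _.
    by rewrite le_eqVlt; apply/orP; left; apply/eqP; ring.
  rewrite big_split /= -!form_sum; apply: lerD.
    by have := hN1 x; rewrite formB subr_ge0.
  by have := hN1 y; rewrite formB subr_ge0.
apply/psd_immx => x; rewrite formZ form_sum mulr_sumr Im_sum.
apply: sumr_ge0 => k _; rewrite formZ mulrA ImM.
have /andP[/eqP -> h] : (Im (form x (N k) x) == 0) && (0 <= Re (form x (N k) x)).
  by rewrite -ge0_complex; exact: hN.
by rewrite mulr0 add0r mulr_ge0.
Qed.

Lemma form_entries m n x (A : 'M[C]_(m, n)) y :
  form x A y = \sum_i \sum_j (x i 0)^*%R * A i j * y j 0.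
Proof.
rewrite /form mxE exchange_big; apply: eq_bigr => j _ /=.
by rewrite mxE mulr_suml; apply: eq_bigr => i _; rewrite !mxE.
Qed.

Lemma form_small m n x y : exists2 B : C, 0 <= B & forall (A : 'M[C]_(m, n)) e,
  (forall i j, `|A i j| <= e) -> `|form x A y| <= B * e.
Proof.
exists (\sum_i \sum_j `|x i 0| * `|y j 0|).
  by do 2! apply: sumr_ge0 => ? _; rewrite mulr_ge0.
move=> A e he; rewrite form_entries mulr_suml.
apply: le_trans (ler_norm_sum _ _ _) _; apply: ler_sum => i _.
rewrite mulr_suml; apply: le_trans (ler_norm_sum _ _ _) _; apply: ler_sum => j _.
by rewrite !normrM norm_conjC mulrAC ler_wpM2l// mulr_ge0.
Qed.

(** Entrywise approximation suffices in finite dimension; this carries the half-plane property from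
    Riemann sums to the integral. *)
Lemma halfplane_closed n (b : C) (Q : 'M[C]_n) : 0 <= b ->
  (forall e : R, 0 < e -> exists2 S, halfplane b S &
     forall i j, cmod (Q i j - S i j) <= e) -> halfplane b Q.
Proof.
move=> b0 H.
have close x y (e : R) : 0 < e -> exists2 S, halfplane b S &
    cmod (form x Q y - form x S y) <= e.
  move=> e0; have [B B0 hB] := form_small x y.
  have BR : (Re B)%:C = B by rewrite RRe_real// ger0_real.
  have B1 : 0 < Re B + 1 by rewrite ltr_wpDl// -ler0c BR.
  have [S hS QS] := H (e / (Re B + 1)) (divr_gt0 e0 B1); exists S => //.
  rewrite -lecR -normcE_cmod -formB.
  apply: le_trans (hB _ (e / (Re B + 1))%:C _) _.
    by move=> i j; rewrite !mxE normcE_cmod lecR.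
  rewrite -BR -rmorphM lecR mulrCA ger_pMr// ler_pdivrMr// mul1r lerDl//.
have bR : (Re b)%:C = b by rewrite RRe_real// ger0_real.
split.
  move=> x y.
  have sR : (Re (sqn x + sqn y))%:C = sqn x + sqn y.
    by rewrite RRe_real// ger0_real// addr_ge0 ?sqn_ge0.
  rewrite normcE_cmod -bR -sR -rmorphM -rmorphMn lecR.
  apply/ler_addgt0Pr => e e0.
  have [S [hS _] QS] := close x y _ (divr_gt0 e0 (ltr0n _ 2)).
  have := hS x y; rewrite normcE_cmod -bR -sR -rmorphM -rmorphMn lecR => h.
  have := cmodD (form x S y) (form x Q y - form x S y); rewrite addrC subrK => h2.
  by rewrite !mulr2n in h *; lra.
apply/psd_immx => x; apply/ler_addgt0Pr => e e0.
have [S [_ /psd_immx hS] QS] := close x x _ e0.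
have := Im_le_cmod (form x Q x - form x S x); rewrite ImD ImN => h.
have := hS x => h3; move: (le_trans h QS); rewrite ler_norml => /andP[]; lra.
Qed.

End ComplexFacts.

(** * Integrals as limits of sums *)

Section Grid.
Variable R : realType.
Implicit Types (g : R -> R) (e eta : R).

(* The cell of index 0 is ]-eta, 0], so that an atom at 0 is counted. *)
Definition cell eta (k : nat) : set R := `]k%:R * eta - eta, k%:R * eta]%classic.

Definition gsum g eta K (x : R) : R :=
  \sum_(k < K.+1) g (k%:R * eta) * \1_(cell eta k) x.

Definition grid g e eta K : Prop :=
  [/\ 0 < eta,
      forall x y, 0 <= x -> 0 <= y -> `|x - y| <= eta -> `|g x - g y| <= e
    & forall x, K%:R * eta <= x -> `|g x| <= e].

Lemma cell_lt eta k l x : 0 < eta -> cell eta k x -> cell eta l x -> (k <= l)%N.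
Proof.
rewrite /cell /= !in_itv /= => e0 /andP[h1 _] /andP[_ h2].
rewrite -ltnS -(ltr_nat R) -(ltr_pM2r e0) -natr1 mulrDl mul1r.
by rewrite -ltrBlDr; apply: lt_le_trans h1 h2.
Qed.

Lemma cell_ex eta x : 0 < eta -> 0 <= x -> exists k, cell eta k x.
Proof.
move=> e0 x0; have ex : exists k : nat, x <= k%:R * eta.
  exists (Num.bound (x / eta)); rewrite -ler_pdivrMr//.
  by apply/ltW/archi_boundP; rewrite divr_ge0// ltW.
exists (ex_minn ex); case: ex_minnP => k hk kmin.
rewrite /cell /= in_itv /= hk andbT.
case: k hk kmin => [|k] hk kmin; first by rewrite mul0r sub0r (lt_le_trans _ x0)// oppr_lt0.
rewrite -natr1 mulrDl mul1r addrK ltNge; apply/negP => /kmin.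
by rewrite ltnn.
Qed.

Lemma gsum_approx g e eta K x : 0 <= e -> grid g e eta K -> 0 <= x ->
  `|g x - gsum g eta K x| <= e.
Proof.
move=> ee [e0 gc gy] x0; have [k xk] := cell_ex e0 x0.
have cellE l : \1_(cell eta l) x = (l == k)%:R :> R.
  rewrite indicE; congr (nat_of_bool _)%:R; apply/idP/eqP => [|->]; last exact/mem_set.
  by move=> /set_mem xl; apply/eqP; rewrite eqn_leq !(cell_lt e0 _ xl, cell_lt e0 xl)//= (cell_lt e0 xk xl).
rewrite /gsum; under eq_bigr do rewrite cellE.
have [kK|Kk] := ltnP k K.+1.
  rewrite (bigD1 (Ordinal kK))//= eqxx mulr1 big1 ?addr0; last first.
    by move=> i /negbTE; rewrite -val_eqE /= => ->; rewrite mulr0.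
  apply: gc => //; first by rewrite mulr_ge0// ltW.
  move: xk; rewrite /cell /= in_itv /= => /andP[h1 h2].
  rewrite ler0_norm ?subr_le0// opprB lerBlDr -lerBlDl ltW//.
rewrite big1 ?subr0; last first.
  by move=> i _; case: eqP => [ik|]; rewrite ?mulr0//; have := ltn_ord i; rewrite ik ltnNge Kk.
(* Here k > K, and a point of cell k lies above (k - 1) eta >= K eta, so the tail bound applies. *)
apply: gy; move: xk; rewrite /cell /= in_itv /= => /andP[h1 _].
apply: le_trans (ltW h1); rewrite lerBrDr -[X in _ + X]mul1r -mulrDl natr1.
by rewrite ler_pM2r// ler_nat.
Qed.

(* Uniform continuity on [0, +oo[ and limit 0 at +oo. *)
Definition vanishing g : Prop := forall e, 0 < e -> exists eta K, grid g e eta K.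

Local Notation D := (`[0, +oo[%classic : set R).

Lemma measurable_gsum g eta K (A : set R) : measurable_fun A (gsum g eta K).
Proof.
apply: measurable_sum => k; apply: measurable_funM; first exact: measurable_cst.
by apply: measurable_indic; exact: measurable_itv.
Qed.

Lemma vanishing_measurable g : vanishing g -> measurable_fun D g.
Proof.
move=> vg; have H n : exists h : R -> R, measurable_fun D h /\
    forall x, 0 <= x -> `|g x - h x| <= n.+1%:R^-1.
  have n0 : 0 < n.+1%:R^-1 :> R by rewrite invr_gt0.
  have [eta [K gr]] := vg _ n0; exists (gsum g eta K); split.
    exact: measurable_gsum.
  by move=> x x0; apply: gsum_approx gr x0; exact: ltW.
have [h hP] := choice H.
apply: (@measurable_fun_cvg _ _ _ D h) => //; first by move=> n; have [] := hP n.
move=> x; rewrite /= in_itv /= andbT => x0.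
apply/cvgrPdist_le => e e0; near=> n.
have [_ /(_ x x0)/le_trans] := hP n; apply; apply/ltW.
by near: n; exact: (near_infty_natSinv_lt (PosNum e0)).
Unshelve. all: by end_near. Qed.

Lemma vanishing_bounded g : vanishing g -> exists2 B, 0 <= B &
  forall x, 0 <= x -> `|g x| <= B.
Proof.
move=> /(_ 1 ltr01)[eta [K gr]].
exists (1 + \sum_(k < K.+1) `|g (k%:R * eta)|).
  by rewrite addr_ge0// sumr_ge0.
move=> x x0; have h := gsum_approx ler01 gr x0.
rewrite -(subrK (gsum g eta K x) (g x)) (le_trans (ler_normD _ _))// lerD//.
apply: le_trans (ler_norm_sum _ _ _) _; apply: ler_sum => k _.
by rewrite normrM ler_piMr// indicE; case: (_ \in _); rewrite ?normr1 ?normr0.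
Qed.

Section FiniteMeasure.
Variable m : {finite_measure set R -> \bar R}.

Lemma vanishing_integrable g : vanishing g -> m.-integrable D (EFin \o g).
Proof.
move=> vg; apply: measurable_bounded_integrable => //.
- by rewrite ltey_eq fin_num_measure.
- exact: vanishing_measurable.
- have [B B0 gB] := vanishing_bounded vg.
  exists B; split; first exact: num_real.
  move=> M BM x; rewrite /= in_itv /= andbT => x0.
  by apply: le_trans (gB x x0) _; exact: ltW.
Qed.

Lemma integrable_cell eta k (a : R) :
  m.-integrable D (fun x => (a * \1_(cell eta k) x)%:E).
Proof.
have -> : (fun x => (a * \1_(cell eta k) x)%:E) =
    (fun x => a%:E * (\1_(cell eta k) x)%:E)%E by apply/funext => x; rewrite EFinM.
apply: integrableZl => //; apply: (@integrableS _ _ _ _ setT) => //.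
by apply: integrable_indic; exact: measurable_itv.
Qed.

Lemma Rintegral_gsum g eta K : \int[m]_(x in D) gsum g eta K x =
  \sum_(k < K.+1) g (k%:R * eta) * fine (m (cell eta k `&` D)).
Proof.
rewrite /Rintegral; under eq_integral do rewrite /gsum -sumEFin.
rewrite integral_sum//; last by move=> k; exact: integrable_cell.
rewrite (eq_bigr (fun k : 'I_K.+1 =>
  (g (k%:R * eta) * fine (m (cell eta k `&` D)))%:E)) ?sumEFin// => k _.
under eq_integral do rewrite EFinM; rewrite integralZl//; last first.
  by have := integrable_cell eta k 1; apply: eq_integrable => // x _; rewrite mul1r.
have mc : measurable (cell eta k) by exact: measurable_itv.
by rewrite integral_indic// EFinM fineK// fin_num_measure//; exact: measurableI.
Qed.

Lemma Rintegral_grid g e eta K : 0 <= e -> vanishing g -> grid g e eta K ->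
  `|\int[m]_(x in D) g x -
    \sum_(k < K.+1) g (k%:R * eta) * fine (m (cell eta k `&` D))| <=
  e * fine (m D).
Proof.
move=> e0 vg gr; have ig := vanishing_integrable vg.
have igs : m.-integrable D (EFin \o gsum g eta K).
  have -> : EFin \o gsum g eta K = fun x =>
     (\sum_(k < K.+1) (g (k%:R * eta) * \1_(cell eta k) x)%:E)%E.
    by apply/funext => x /=; rewrite sumEFin.
  by apply: integrable_sum => // k _; exact: integrable_cell.
have idf : m.-integrable D (EFin \o (fun x => g x - gsum g eta K x)).
  have mD : measurable D by exact: measurable_itv.
  by have := integrableB mD ig igs; apply: eq_integrable => // x _.
rewrite -Rintegral_gsum -RintegralB//.
apply: le_trans (le_normr_Rintegral _ _) _ => //.
rewrite -Rintegral_cst//; apply: le_Rintegral => //.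
- by have := integrable_norm idf; apply: eq_integrable.
- apply: (@integrableS _ _ _ _ setT) => //; exact: finite_measure_integrable_cst.
- by move=> x; rewrite /= in_itv /= andbT => x0; exact: gsum_approx.
Qed.

End FiniteMeasure.

End Grid.

(** * Limits of discrete measures *)

Section RightLimit.
Variables (R : realType) (G : R -> R) (B : R).
Hypothesis ndG : nondecreasing G.
Hypothesis GB : forall x, 0 <= G x <= B.

(** The pointwise limit of distribution functions is nondecreasing but may fail to be
    right-continuous, which a Lebesgue-Stieltjes measure requires; this is its right limit. *)
Definition rreg (F : R -> R) x : R := inf [set F y | y in `]x, +oo[%classic].

Let has_inf_rreg x : has_inf [set G y | y in `]x, +oo[%classic].
Proof.
split; first by exists (G (x + 1)), (x + 1) => //=; rewrite in_itv /= ltrDl ltr01.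
by exists 0 => _ [y _ <-]; case/andP: (GB y).
Qed.

Lemma rreg_ge x : G x <= rreg G x.
Proof.
apply: lb_le_inf; first by have [] := has_inf_rreg x.
by move=> _ [y /= + <-]; rewrite in_itv /= andbT => /ltW; exact: ndG.
Qed.

Lemma rreg_le x y : x < y -> rreg G x <= G y.
Proof.
move=> xy; apply: ge_inf; first by have [] := has_inf_rreg x.
by exists y => //=; rewrite in_itv /= xy.
Qed.

Lemma rreg_bound x : 0 <= rreg G x <= B.
Proof.
have /andP[h1 _] := GB x; have /andP[_ h2] := GB (x + 1).
rewrite (le_trans h1 (rreg_ge x)) /= (le_trans _ h2)//.
by apply: rreg_le; rewrite ltrDl.
Qed.

Lemma rreg_nd : nondecreasing (rreg G).
Proof.
move=> x y xy; apply: lb_le_inf; first by have [] := has_inf_rreg y.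
move=> _ [t /= + <-]; rewrite in_itv /= andbT => yt.
by apply: rreg_le; exact: le_lt_trans xy yt.
Qed.

Lemma rreg_right_continuous : right_continuous (rreg G).
Proof.
move=> x; apply/cvgrPdist_le => e e0.
have [_ [y /= + <-] Gy] := inf_adherent e0 (has_inf_rreg x).
rewrite in_itv /= andbT => xy; near=> t.
have xt : x < t by near: t; exact: nbhs_right_gt.
have ty : t < y by near: t; exact: nbhs_right_lt.
rewrite distrC ger0_norm ?subr_ge0 ?rreg_nd ?(ltW xt)//.
by rewrite lerBlDl (le_trans (rreg_le ty))// ltW.
Unshelve. all: by end_near. Qed.

(** An infimum is not linear in the function, but a limit is: this is how quadratic dependence on a
    vector passes from G to its regularization. *)
Lemma rreg_cvg x : G y @[y --> x^'+] --> rreg G x.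
Proof.
apply/cvgrPdist_le => e e0.
have [_ [y /= + <-] Gy] := inf_adherent e0 (has_inf_rreg x).
rewrite in_itv /= andbT => xy; near=> t.
have xt : x < t by near: t; exact: nbhs_right_gt.
have ty : t <= y by near: t; exact: nbhs_right_le.
rewrite distrC ger0_norm ?subr_ge0 ?rreg_le//.
by rewrite lerBlDl (le_trans (ndG ty))// ltW.
Unshelve. all: by end_near. Qed.

Hypothesis G0 : forall x, x < 0 -> G x = 0.

Lemma rreg0 x : x < 0 -> rreg G x = 0.
Proof.
move=> x0; apply/eqP; rewrite eq_le; have /andP[-> _] := rreg_bound x.
rewrite andbT -[leRHS](G0 (x := x / 2)) ?rreg_le//; first by lra.
by lra.
Qed.

End RightLimit.

(** * Finite measures with a given distribution function *)

Section LebesgueStieltjes.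
Variable R : realType.

(* The library states this measure on the display generated by the intervals
   ]a, b]; here it is moved to the Borel structure used in [mx_measure].     *)
Definition lsm (f : cumulative R R) : set R -> \bar R :=
  lebesgue_stieltjes_measure f.

HB.instance Definition _ (f : cumulative R R) :=
  isMeasure.Build _ R R (lsm f) (measure0 (lebesgue_stieltjes_measure f))
    (measure_ge0 (lebesgue_stieltjes_measure f))
    (@measure_semi_sigma_additive _ _ _ (lebesgue_stieltjes_measure f)).

Lemma lsm_itv (f : cumulative R R) (a b : R) : a <= b ->
  lsm f `]a, b] = (f b - f a)%:E.
Proof.
move=> ab; rewrite /lsm /lebesgue_stieltjes_measure /measure_extension.
rewrite measurable_mu_extE/=; last exact: is_ocitv.
by rewrite wlength_itv_bnd.
Qed.

Lemma lsm_cvg (f : cumulative R R) (I : nat -> set R) a b :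
  (forall n, I n = `]a n, b n]%classic) -> (forall n, a n <= b n) ->
  nonincreasing_seq a -> nondecreasing_seq b ->
  (f (b n) - f (a n))%:E @[n --> \oo] --> lsm f (\bigcup_n I n).
Proof.
move=> IE ab da db.
have -> : (fun n => (f (b n) - f (a n))%:E) = lsm f \o I.
  by apply/funext => n /=; rewrite IE lsm_itv.
apply: nondecreasing_cvg_mu.
- by move=> n; rewrite IE; exact: measurable_itv.
- by apply: bigcup_measurable => n _; rewrite IE; exact: measurable_itv.
- move=> i j ij; apply/subsetPset; rewrite !IE; apply: subset_itv.
    by rewrite bnd_simp; exact: da.
  by rewrite bnd_simp; exact: db.
Qed.

(** The bound B - H / x comes from a first moment at most H and prevents mass from escaping to
    infinity, so the total mass is exactly B. As F vanishes only on negative points, a jump at 0 is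
    allowed and gives an atom there. *)
Lemma limit_measure (F : R -> R) (B H : R) :
  nondecreasing F -> right_continuous F -> (forall x, 0 <= F x <= B) ->
  (forall x, x < 0 -> F x = 0) -> (forall x, 0 < x -> B - H / x <= F x) ->
  exists m : {finite_measure set R -> \bar R},
    [/\ forall a b, a <= b -> m `]a, b]%classic = (F b - F a)%:E,
        m `]-oo, 0[%classic = 0%E & m `[0, +oo[%classic = B%:E].
Proof.
move=> ndF rcF FB F0 tight.
pose f : cumulative R R :=
  HB.pack_for (cumulative R R) F (isCumulative.Build R _ R F ndF rcF).
have fF x : f x = F x by [].
have neg : lsm f `]-oo, 0[%classic = 0%E.
  (* The values of the measure are known on half-open intervals only, so the open ray is exhausted
     by intervals whose right ends increase to 0. *)
  pose I n : set R := `](- n.+1%:R), (- n.+1%:R^-1)]%classic.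
  have -> : `]-oo, 0[%classic = \bigcup_n I n.
    apply/seteqP; split=> [x|x [n _]] /=; rewrite /I /= !in_itv /=.
      move=> x0; have x1 : 0 < - x by rewrite oppr_gt0.
      exists (Num.bound (- x) + Num.bound (- x)^-1)%N => //=.
      rewrite in_itv /= ltrNl; apply/andP; split.
        apply: lt_le_trans (archi_boundP (ltW x1)) _.
        by rewrite ler_nat leqW// leq_addr.
      rewrite lerNr -[leRHS]invrK lef_pV2 ?posrE ?invr_gt0//.
      apply/ltW/(lt_le_trans (archi_boundP _)); first by rewrite invr_ge0 ltW.
      by rewrite ler_nat leqW// leq_addl.
    move=> /andP[_ /le_lt_trans]; apply.
    by rewrite oppr_lt0 invr_gt0.
  have h := @lsm_cvg f I (fun n => - n.+1%:R) (fun n => - n.+1%:R^-1) (fun n => erefl).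
  apply/esym/(cvg_unique _ _ (h _ _ _)) => //.
  - have E : (fun n : nat => (f (- n.+1%:R^-1) - f (- n.+1%:R))%:E) = cst 0%E.
      by apply/funext => n; rewrite !fF !F0 ?subrr// oppr_lt0// invr_gt0.
    by rewrite /= E; exact: cvg_cst.
  - move=> n; rewrite lerN2 (le_trans (_ : _ <= 1))// ?invf_le1// ?ler1n//.
  - by move=> i j ij; rewrite lerN2 ler_nat.
  - by move=> i j ij; rewrite lerN2 lef_pV2 ?posrE// ler_nat.
have setT' : lsm f setT = B%:E.
  pose I n : set R := `](- n.+1%:R), n.+1%:R]%classic.
  have -> : [set: R] = \bigcup_n I n.
    apply/seteqP; split=> // x _; exists (Num.bound `|x|) => //=.
    rewrite /I /= in_itv /= ltrNl.
    have xb : `|x| < (Num.bound `|x|).+1%:R.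
      by apply: lt_le_trans (archi_boundP (normr_ge0 x)) _; rewrite ler_nat.
    by move: xb; rewrite ltr_norml => /andP[h1 h2]; rewrite ltrNl h1 ltW.
  have h := @lsm_cvg f I (fun n => - n.+1%:R) (fun n => n.+1%:R) (fun n => erefl).
  apply/esym/(cvg_unique _ _ (h _ _ _)) => //.
  - apply/cvg_EFin; first by near=> n.
    apply/cvgrPdist_le => e e0; have H1 : 0 < `|H| + 1 by rewrite ltr_wpDl.
    near=> n; have n0 : 0 < n.+1%:R :> R by [].
    rewrite -[X in `|_ - X|]/(F n.+1%:R - F (- n.+1%:R)).
    rewrite [F (- _)]F0 ?oppr_lt0// subr0.
    have /andP[_ h2] := FB n.+1%:R.
    rewrite ger0_norm ?subr_ge0// lerBlDr -lerBlDl.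
    apply: le_trans (tight _ n0); rewrite lerD2l lerN2.
    apply: le_trans (_ : (`|H| + 1) / n.+1%:R <= _).
      by rewrite ler_pM2r ?invr_gt0// (le_trans (ler_norm H))// lerDl.
    rewrite mulrC -ler_pdivlMr//; apply/ltW; near: n.
    exact: (near_infty_natSinv_lt (PosNum (divr_gt0 e0 H1))).
  - by move=> n; rewrite (le_trans (_ : _ <= 0))// oppr_le0.
  - by move=> i j ij; rewrite lerN2 ler_nat.
  - by move=> i j ij; rewrite ler_nat.
have fin : fin_num_fun (lsm f).
  apply: lty_fin_num_fun; apply: (@le_lt_trans _ _ B%:E); last exact: ltry.
  by rewrite -setT'.
pose fm := @Measure_isFinite.Build _ R R (lsm f) fin.
pose m : {finite_measure set R -> \bar R} := HB.pack (lsm f) fm.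
exists m; split; [by move=> a b ab; exact: (lsm_itv f ab)|exact: neg|].
pose N : set R := `]-oo, 0[%classic; pose D : set R := `[0, +oo[%classic.
have NDC : D = ~` N by rewrite /D /N setCitvl.
have : lsm f setT = (lsm f N + lsm f D)%E.
  rewrite -measureU//; [|exact: measurable_itv|exact: measurable_itv|].
    by rewrite NDC setUv.
  by rewrite NDC setICr.
by rewrite neg add0e setT' => ->.
Unshelve. all: by end_near. Qed.

End LebesgueStieltjes.

(** * Discrete measures and their distribution functions *)

Section Atoms.
Variable R : realType.

Lemma cvg_ge_const (U : set_system nat) (u : nat -> R) (a x : R) : ProperFilter U ->
  u n @[n --> U] --> x -> (forall n, a <= u n) -> a <= x.
Proof.
move=> UF ux au; have <- := cvg_lim (@Rhausdorff R) ux.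
by apply: limr_ge; [exact: cvgP ux|exact: nearW].
Qed.

Lemma cvg_le_const (U : set_system nat) (u : nat -> R) (a x : R) : ProperFilter U ->
  u n @[n --> U] --> x -> (forall n, u n <= a) -> x <= a.
Proof.
move=> UF ux au; have <- := cvg_lim (@Rhausdorff R) ux.
by apply: limr_le; [exact: cvgP ux|exact: nearW].
Qed.

Local Notation D := (`[0, +oo[%classic : set R).

Definition cdf p (c l : 'I_p -> R) (x : R) : R := \sum_k c k * (l k <= x)%R%:R.

Lemma cdf_nd p (c l : 'I_p -> R) : (forall k, 0 <= c k) -> nondecreasing (cdf c l).
Proof.
move=> c0 x y xy; apply: ler_sum => k _; rewrite ler_wpM2l// ler_nat.
by case: (leP (l k) x) => // /le_trans ->.
Qed.

Lemma cdf_bound p (c l : 'I_p -> R) B : (forall k, 0 <= c k) -> \sum_k c k <= B ->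
  forall x, 0 <= cdf c l x <= B.
Proof.
move=> c0 cB x; rewrite sumr_ge0/=; last by move=> k _; rewrite mulr_ge0.
apply: le_trans cB; apply: ler_sum => k _; rewrite ler_piMr//.
by case: (l k <= x); rewrite ?ler01 ?lexx.
Qed.

Lemma cdf0 p (c l : 'I_p -> R) : (forall k, 0 <= l k) ->
  forall x, x < 0 -> cdf c l x = 0.
Proof.
move=> l0 x x0; apply: big1 => k _.
by rewrite leNgt (lt_le_trans x0 (l0 k)) mulr0.
Qed.

(* Markov's inequality for the discrete measure. *)
Lemma cdf_tight p (c l : 'I_p -> R) H : (forall k, 0 <= c k) -> (forall k, 0 <= l k) ->
  \sum_k c k * l k <= H -> forall x, 0 < x -> \sum_k c k - H / x <= cdf c l x.
Proof.
move=> c0 l0 cH x x0; rewrite lerBlDr -lerBlDl -sumrB.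
apply: le_trans (_ : (\sum_k c k * l k) / x <= _); last first.
  by rewrite ler_pM2r// invr_gt0.
rewrite mulr_suml; apply: ler_sum => k _; rewrite -mulrA -{1}[c k]mulr1 -mulrBr.
rewrite ler_wpM2l//; case: (leP (l k) x) => [_|xl]; rewrite ?subrr ?divr_ge0 ?(ltW x0)//.
by rewrite subr0 ler_pdivlMr// mul1r ltW.
Qed.

Lemma cdf_cell p (c l : 'I_p -> R) (eta : R) j : 0 < eta ->
  cdf c l (j%:R * eta) - cdf c l (j%:R * eta - eta) =
  \sum_k c k * \1_(cell eta j) (l k).
Proof.
move=> e0; rewrite -sumrB; apply: eq_bigr => k _; rewrite -mulrBr; congr (_ * _).
rewrite indicE mem_setE /cell in_itv /=.
case: (leP (l k) (j%:R * eta)) => h1; case: (ltP (j%:R * eta - eta) (l k)) => h2;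
  rewrite ?subrr ?subr0//.
by exfalso; have := lt_le_trans h1 h2; lra.
Qed.

Lemma atoms_grid p (c l : 'I_p -> R) B g e eta K : 0 <= e -> (forall k, 0 <= c k) ->
  (forall k, 0 <= l k) -> \sum_k c k <= B -> grid g e eta K ->
  `|\sum_k c k * g (l k) - \sum_(j < K.+1) g (j%:R * eta) *
     (cdf c l (j%:R * eta) - cdf c l (j%:R * eta - eta))| <= e * B.
Proof.
move=> e0 c0 l0 cB gr; have [eta0 _ _] := gr.
have -> : \sum_(j < K.+1) g (j%:R * eta) *
     (cdf c l (j%:R * eta) - cdf c l (j%:R * eta - eta)) =
     \sum_k c k * gsum g eta K (l k).
  under eq_bigr do rewrite cdf_cell// mulr_sumr.
  rewrite exchange_big; apply: eq_bigr => k _; rewrite /gsum mulr_sumr.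
  by apply: eq_bigr => j _; rewrite mulrCA.
rewrite -sumrB (le_trans (ler_norm_sum _ _ _))//.
apply: le_trans (_ : \sum_k c k * e <= _); last first.
  by rewrite -mulr_suml mulrC ler_wpM2l.
apply: ler_sum => k _; rewrite -mulrBr normrM ger0_norm// ler_wpM2l//.
exact: gsum_approx.
Qed.

(* Summation by parts: passing to right limits shifts mass by at most one cell. *)
Lemma rreg_grid (G g : R -> R) B e eta K : 0 <= e -> nondecreasing G ->
  (forall x, 0 <= G x <= B) -> (forall x, x < 0 -> G x = 0) -> grid g e eta K ->
  `|\sum_(j < K.+1) g (j%:R * eta) * (rreg G (j%:R * eta) - rreg G (j%:R * eta - eta)) -
    \sum_(j < K.+1) g (j%:R * eta) * (G (j%:R * eta) - G (j%:R * eta - eta))| <= e * B.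
Proof.
move=> e0 ndG GB G0 [eta0 gc gy]; rewrite -sumrB.
pose a j := rreg G (j%:R * eta) - G (j%:R * eta).
have a0 j : 0 <= a j by rewrite subr_ge0; exact: (rreg_ge ndG GB).
have jeta (j : nat) : j.+1%:R * eta - eta = j%:R * eta.
  by rewrite -natr1 mulrDl mul1r addrK.
have aG j : a j <= G (j.+1%:R * eta) - G (j%:R * eta).
  rewrite lerB// (rreg_le GB)// ltr_pM2r// ltr_nat//.
have jeta0 (j : nat) : 0 <= j%:R * eta by rewrite mulr_ge0// ltW.
(* Abel summation: with the boundary term set apart, what remains is a sum of (g (j eta) - g ((j +
   1) eta)) * a j, bounded by e times telescoping increments of G. *)
have ind : `|\sum_(j < K.+1) (g (j%:R * eta) *
    (rreg G (j%:R * eta) - rreg G (j%:R * eta - eta)) -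
     g (j%:R * eta) * (G (j%:R * eta) - G (j%:R * eta - eta))) -
     g (K%:R * eta) * a K| <= e * G (K%:R * eta).
  elim: (K) => [|k IH].
    have ne : - eta < 0 by rewrite oppr_lt0.
    rewrite big_ord1 /= ?mulr0n !mul0r !sub0r (rreg0 ndG GB G0 ne) (G0 _ ne).
    rewrite !subr0 /a ?mulr0n mul0r mulrBr subrr normr0 mulr_ge0//.
    by case/andP: (GB 0).
  rewrite big_ord_recr /= jeta.
  set S := \sum_(_ < _) _ in IH *.
  have -> : S + (g (k.+1%:R * eta) * (rreg G (k.+1%:R * eta) - rreg G (k%:R * eta)) -
     g (k.+1%:R * eta) * (G (k.+1%:R * eta) - G (k%:R * eta))) -
     g (k.+1%:R * eta) * a k.+1 =
     (S - g (k%:R * eta) * a k) + (g (k%:R * eta) - g (k.+1%:R * eta)) * a k.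
    by rewrite /a; ring.
  apply: le_trans (ler_normD _ _) _.
  apply: le_trans (lerD IH (_ : _ <= e * (G (k.+1%:R * eta) - G (k%:R * eta)))) _.
    rewrite normrM (ger0_norm (a0 k)) ler_pM// gc// distrC -(jeta k) opprB addrC subrK.
    by rewrite gtr0_norm.
  by rewrite -mulrDr addrC subrK.
set S := \sum_(_ < _) _ in ind *.
rewrite -[S](subrK (g (K%:R * eta) * a K)) (le_trans (ler_normD _ _))//.
have gK : `|g (K%:R * eta) * a K| <= e * a K.
  by rewrite normrM (ger0_norm (a0 K)) ler_wpM2r// gy.
apply: le_trans (lerD ind gK) _; rewrite -mulrDr ler_wpM2l// /a addrC subrK.
by case/andP: (rreg_bound ndG GB (K%:R * eta)).
Qed.

Lemma measure_carried (m : {measure set R -> \bar R}) (A : set R) :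
  m `]-oo, 0[%classic = 0%E -> measurable A -> m (A `&` D) = m A.
Proof.
move=> m0 mA; have mD : measurable D by exact: measurable_itv.
have mN : measurable (`]-oo, 0[%classic : set R) by exact: measurable_itv.
rewrite [RHS](measureDI m mA mD).
rewrite -[LHS]add0e; congr (_ + _)%E; apply/esym.
apply: (subset_measure0 _ _ _ m0) => //; first exact: measurableD.
move=> x [_]; rewrite /= !in_itv /= andbT => /negP.
by rewrite -ltNge.
Qed.

(** Once a grid is fixed, only finitely many values of the distribution functions enter, and these
    converge. Comparing G with [rreg G] on the grid makes it unnecessary to choose continuity
    points. *)
Lemma atoms_cvg (U : set_system nat) (p : nat -> nat) (c l : forall n, 'I_(p n) -> R)
    (B : R) (G g : R -> R) (m : {finite_measure set R -> \bar R}) :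
  ProperFilter U ->
  (forall n k, 0 <= c n k) -> (forall n k, 0 <= l n k) ->
  (forall n, \sum_k c n k <= B) ->
  (forall x, cdf (c n) (l n) x @[n --> U] --> G x) ->
  (forall a b, a <= b -> m `]a, b]%classic = (rreg G b - rreg G a)%:E) ->
  m `]-oo, 0[%classic = 0%E -> m D = B%:E -> vanishing g ->
  \sum_k c n k * g (l n k) @[n --> U] --> \int[m]_(x in D) g x.
Proof.
move=> UF c0 l0 cB cG mG m0 mD vg.
have B0 : 0 <= B by rewrite -lee_fin -mD.
have GB x : 0 <= G x <= B.
  have cb n := cdf_bound (l n) (c0 n) (cB n) x; apply/andP; split.
    by apply: cvg_ge_const (cG x) _ => n; case/andP: (cb n).
  by apply: cvg_le_const (cG x) _ => n; case/andP: (cb n).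
have ndG : nondecreasing G.
  move=> x y xy; rewrite -subr_ge0.
  apply: cvg_ge_const (cvgB (cG y) (cG x)) _ => n.
  by rewrite subr_ge0; exact: cdf_nd.
have G0 x : x < 0 -> G x = 0.
  move=> x0; apply: (cvg_unique (@Rhausdorff R) (cG x)).
  have -> : (fun n => cdf (c n) (l n) x) = cst 0.
    by apply/funext => n; exact: cdf0.
  exact: cvg_cst.
(* Three grid comparisons cost e * B each and the convergence on the grid costs e, hence the divisor
   3 * B + 1. *)
have B4 : 0 < 3 * B + 1 by rewrite ltr_wpDl// mulr_ge0.
apply/cvgrPdist_le => e' e'0; pose e := e' / (3 * B + 1).
have e0 : 0 < e by rewrite divr_gt0.
have [eta [K gr]] := vg e e0; have [eta0 _ _] := gr.
have jeta0 (j : nat) : 0 <= j%:R * eta by rewrite mulr_ge0// ltW.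
pose SG (H : R -> R) := \sum_(j < K.+1) g (j%:R * eta) *
  (H (j%:R * eta) - H (j%:R * eta - eta)).
have h1 : `|\int[m]_(x in D) g x - SG (rreg G)| <= e * B.
  have := Rintegral_grid m (ltW e0) vg gr.
  rewrite mD /=; congr (`|_ - _| <= _); apply: eq_bigr => j _; congr (_ * _).
  have mc : measurable (cell eta j) by exact: measurable_itv.
  have -> : m (cell eta j `&` D) = m (cell eta j).
    exact: measure_carried.
  by rewrite /cell mG//= gerBl ltW.
have h2 : `|SG (rreg G) - SG G| <= e * B by exact: rreg_grid (ltW e0) ndG GB G0 gr.
have h3 : SG (cdf (c n) (l n)) @[n --> U] --> SG G.
  apply: (@cvg_big _ _ +%R 0); [exact: add_continuous|] => j _; apply: cvgM; first exact: cvg_cst.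
  by apply: cvgB; exact: cG.
have : \forall n \near U, `|SG G - SG (cdf (c n) (l n))| <= e.
  by move/cvgrPdist_le : h3; apply.
apply: filterS => n h4.
have h5 := atoms_grid (ltW e0) (c0 n) (l0 n) (cB n) gr.
rewrite -/(SG _) distrC in h5.
have -> : \int[m]_(x in D) g x - \sum_k c n k * g (l n k) =
  (\int[m]_(x in D) g x - SG (rreg G)) + (SG (rreg G) - SG G) +
  (SG G - SG (cdf (c n) (l n))) + (SG (cdf (c n) (l n)) - \sum_k c n k * g (l n k)).
  by ring.
apply: le_trans (_ : e * B + e * B + e + e * B <= _).
  by do 3! (apply: le_trans (ler_normD _ _) _; apply: lerD => //).
rewrite -{3}[e]mulr1 -!mulrDr /e mulrAC ler_pdivrMr// ler_pM2l//.
by lra.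
Qed.

End Atoms.

(** * Ultralimits of resolvents *)

Section ComplexLimits.
Variable R : realType.
Notation C := R[i].
Variables (T : Type) (U : set_system T) (UF : ProperFilter U).

Definition clim (u : T -> C) (l : C) : Prop :=
  (complex.Re (u n) @[n --> U] --> complex.Re l) /\
  (complex.Im (u n) @[n --> U] --> complex.Im l).

Lemma clim_cst (a : C) : clim (fun=> a) a.
Proof. by split; exact: cvg_cst. Qed.

Lemma climD u v a b : clim u a -> clim v b -> clim (fun n => u n + v n) (a + b).
Proof.
move=> [h1 h2] [h3 h4]; split.
  by rewrite ReD; under eq_cvg do rewrite ReD; exact: cvgD.
by rewrite ImD; under eq_cvg do rewrite ImD; exact: cvgD.
Qed.

Lemma climM u v a b : clim u a -> clim v b -> clim (fun n => u n * v n) (a * b).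
Proof.
move=> [h1 h2] [h3 h4]; split.
  rewrite ReM; under eq_cvg do rewrite ReM.
  by apply: cvgB; exact: cvgM.
rewrite ImM; under eq_cvg do rewrite ImM.
by apply: cvgD; exact: cvgM.
Qed.

Lemma climB u v a b : clim u a -> clim v b -> clim (fun n => u n - v n) (a - b).
Proof.
move=> ua vb; apply: climD => //.
rewrite -mulN1r; under eq_fun do rewrite -mulN1r.
by apply: climM => //; exact: clim_cst.
Qed.

Lemma clim_sum I (r : seq I) (f : I -> T -> C) (l : I -> C) :
  (forall i, clim (f i) (l i)) ->
  clim (fun n => \sum_(i <- r) f i n) (\sum_(i <- r) l i).
Proof.
move=> fl; elim: r => [|i r IH].
  by rewrite big_nil; under eq_fun do rewrite big_nil; exact: clim_cst.
by rewrite big_cons; under eq_fun do rewrite big_cons; exact: climD.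
Qed.

Lemma clim_unique u a b : clim u a -> clim u b -> a = b.
Proof.
move=> [h1 h2] [h3 h4]; apply: complex_ext.
  exact: (cvg_unique (@Rhausdorff R) h1 h3).
exact: (cvg_unique (@Rhausdorff R) h2 h4).
Qed.

Lemma clim_form m n x (A : T -> 'M[C]_(m, n)) (A0 : 'M[C]_(m, n)) y :
  (forall i j, clim (fun k => A k i j) (A0 i j)) ->
  clim (fun k => form x (A k) y) (form x A0 y).
Proof.
move=> AA; rewrite form_entries; under eq_fun do rewrite form_entries.
apply: clim_sum => i; apply: clim_sum => j.
by apply: climM; [apply: climM; [exact: clim_cst|exact: AA]|exact: clim_cst].
Qed.

Lemma clim_real (u : T -> R) (a : R) : u n @[n --> U] --> a ->
  clim (fun n => (u n)%:C) a%:C.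
Proof. by move=> ua; split => //=; exact: cvg_cst. Qed.

Lemma clim_ReIm (u v : T -> R) (a b : R) : u n @[n --> U] --> a ->
  v n @[n --> U] --> b -> clim (fun n => u n +i* v n) (a +i* b).
Proof. by []. Qed.

End ComplexLimits.

(** * Hermitian matrices recovered from quadratic functions *)

Section Polarization.
Variables (R : realType) (K : nat).
Notation C := R[i].
Implicit Types (q : 'cV[C]_K -> R).

(** At e i + 'i e j the cross terms of a Hermitian form N are 'i N i j minus 'i times its conjugate,
    that is - 2 Im (N i j); hence the minus sign in the imaginary part. Each part uses only three
    values of q, so that replacing q by finite measures produces charges. *)
Definition polar q : 'M[C]_K :=
  let e (i : 'I_K) : 'cV[C]_K := delta_mx i 0 in
  \matrix_(i, j)
    ((2^-1 * (q (e i + e j) - (q (e i) + q (e j))))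
     +i* (- 2^-1 * (q (e i + 'i%R *: e j) - (q (e i) + q (e j))))).

(* q is the quadratic form of the Hermitian matrix recovered by polarization. *)
Definition quadratic q : Prop := forall x, form x (polar q) x = (q x)%:C.

Lemma polarD q q' : polar (fun x => q x + q' x) = polar q + polar q'.
Proof.
by apply/matrixP => i j; rewrite !mxE; apply: complex_ext; rewrite ?ReD ?ImD /=; ring.
Qed.

Lemma polarN q : polar (fun x => - q x) = - polar q.
Proof.
by apply/matrixP => i j; rewrite !mxE; apply: complex_ext; rewrite ?ReN ?ImN /=; ring.
Qed.

Lemma quadraticD q q' : quadratic q -> quadratic q' ->
  quadratic (fun x => q x + q' x).
Proof. by move=> h h' x; rewrite polarD formD h h' rmorphD. Qed.

Lemma quadraticN q : quadratic q -> quadratic (fun x => - q x).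
Proof. by move=> h x; rewrite polarN formN h rmorphN. Qed.

Lemma quadraticB q q' : quadratic q -> quadratic q' ->
  quadratic (fun x => q x - q' x).
Proof. by move=> h h'; apply: quadraticD => //; exact: quadraticN. Qed.

Lemma quadratic0 : quadratic (fun=> 0).
Proof.
have -> : (fun=> 0) = (fun x : 'cV[C]_K => 0 - 0 : R) by apply/funext => x; rewrite subr0.
move=> x; have -> : polar (fun=> 0 - 0) = 0.
  by apply/matrixP => i j; rewrite !mxE; apply: complex_ext => /=; ring.
by rewrite form0 subrr.
Qed.

Lemma quadratic_sum n (f : nat -> 'cV[C]_K -> R) : (forall k, quadratic (f k)) ->
  quadratic (fun x => \sum_(0 <= k < n) f k x).
Proof.
move=> qf; elim: n => [|n IH].
  by under eq_fun do rewrite big_geq//; exact: quadratic0.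
by under eq_fun do rewrite big_nat_recr//=; exact: quadraticD.
Qed.

Lemma polar_form q (N : 'M[C]_K) : N^t* = N ->
  (forall x, (q x)%:C = form x N x) -> polar q = N.
Proof.
move=> hN qE; have conjN i j : N j i = (N i j)^*%R by rewrite -[in LHS]hN !mxE.
have qR x : q x = complex.Re (form x N x) by rewrite -qE.
apply/matrixP => i j; rewrite !mxE !qR.
rewrite !formDl !formDr !formZl !formZr !form_delta conjCi imaginaryE.
rewrite (conjN i j) !ReD; apply: complex_ext => /=.
  by rewrite Re_conj; lra.
rewrite !ReM !ImM ?ReN ?ImN ?Re_conj ?Im_conj /=; lra.
Qed.

Lemma quadratic_form q (N : 'M[C]_K) : N^t* = N ->
  (forall x, (q x)%:C = form x N x) -> quadratic q.
Proof. by move=> hN qE x; rewrite (polar_form hN qE). Qed.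

(** Both sides of the identity depend on finitely many values of q, so it survives pointwise limits
    along any proper filter: the ultrafilter, right neighbourhoods, and partial sums of a series. *)
Lemma quadratic_cvg (T : Type) (U : set_system T) (f : T -> 'cV[C]_K -> R) q :
  ProperFilter U -> (forall n, quadratic (f n)) ->
  (forall x, f n x @[n --> U] --> q x) -> quadratic q.
Proof.
move=> UF qf fq x.
have h1 : clim U (fun n => form x (polar (f n)) x) (form x (polar q) x).
  apply: clim_form => i j; rewrite mxE; under eq_fun do rewrite mxE.
  apply: clim_ReIm.
    apply: cvgM; first exact: cvg_cst.
    by apply: cvgB; [exact: fq|apply: cvgD; exact: fq].
  apply: cvgM; first exact: cvg_cst.
  by apply: cvgB; [exact: fq|apply: cvgD; exact: fq].
apply: (clim_unique UF h1).
by under eq_fun do rewrite qf; exact: clim_real.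
Qed.

End Polarization.

(** * Integration against charges *)

Section ChargeIntegral.
Variable R : realType.
Local Notation D := (`[0, +oo[%classic : set R).

(** The Jordan decomposition is not additive in the charge, so linearity of the integral in the
    charge is not immediate. Riemann sums are linear in its values, and B, the mass of both Jordan
    parts on the half-line, controls the error uniformly in g. *)
Lemma charge_grid (nu : {charge set R -> \bar R}) : exists2 B : R, 0 <= B &
  forall g e eta K, 0 <= e -> vanishing g -> grid g e eta K ->
  `|charge_integral nu D g -
    \sum_(k < K.+1) g (k%:R * eta) * fine (nu (cell eta k `&` D))| <= e * B.
Proof.
rewrite /charge_integral; set hP := cid _; set hN := cid _.
set jp := jordan_pos _; set jn := jordan_neg _.
exists (fine (jp D) + fine (jn D)).
  by rewrite addr_ge0// fine_ge0.
move=> g e eta K e0 vg gr.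
have h1 := Rintegral_grid jp e0 vg gr; have h2 := Rintegral_grid jn e0 vg gr.
have -> : \sum_(k < K.+1) g (k%:R * eta) * fine (nu (cell eta k `&` D)) =
  \sum_(k < K.+1) g (k%:R * eta) * fine (jp (cell eta k `&` D)) -
  \sum_(k < K.+1) g (k%:R * eta) * fine (jn (cell eta k `&` D)).
  rewrite -sumrB; apply: eq_bigr => k _; rewrite -mulrBr; congr (_ * _).
  have mA : measurable (cell eta k `&` D).
    by apply: measurableI; exact: measurable_itv.
  rewrite (jordan_decomp (projT2 hN) mA) -/jp -/jn /cadd /= cscaleN1.
  by rewrite -fineB ?fin_num_measure.
rewrite opprD opprK addrACA mulrDr (le_trans (ler_normD _ _))// lerD//.
by rewrite -opprB normrN in h2; rewrite addrC.
Qed.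

Lemma eq_of_small (a b B : R) : (forall e, 0 < e -> `|a - b| <= e * B) -> a = b.
Proof.
move=> h; apply/eqP; rewrite -subr_eq0 -normr_le0; apply/ler_addgt0Pr => e e0.
have B1 : 0 < `|B| + 1 by rewrite ltr_wpDl.
rewrite add0r; apply: le_trans (h (e / (`|B| + 1)) (divr_gt0 e0 B1)) _.
rewrite mulrAC ler_pdivrMr// ler_pM2l//.
by apply: le_trans (ler_norm B) _; rewrite lerDl.
Qed.

(** The two sides have the same Riemann sums on every grid. *)
Lemma charge_integral_comb (nu : {charge set R -> \bar R}) (a : R)
    (m1 m2 m3 : {finite_measure set R -> \bar R}) g :
  (forall A, measurable A ->
    fine (nu A) = a * (fine (m1 A) - (fine (m2 A) + fine (m3 A)))) ->
  vanishing g ->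
  charge_integral nu D g = a * (\int[m1]_(x in D) g x -
    (\int[m2]_(x in D) g x + \int[m3]_(x in D) g x)).
Proof.
move=> nuE vg; have [B B0 hB] := charge_grid nu.
pose b i := fine ((i : {finite_measure set R -> \bar R}) D).
apply: (@eq_of_small _ _ (B + `|a| * (b m1 + (b m2 + b m3)))) => e e0.
have [eta [K gr]] := vg e e0.
pose S (f : set R -> R) := \sum_(k < K.+1) g (k%:R * eta) * f (cell eta k `&` D).
have h0 := hB g e eta K (ltW e0) vg gr.
have h i := Rintegral_grid i (ltW e0) vg gr.
have SE : S (fine \o nu) = a * (S (fine \o m1) - (S (fine \o m2) + S (fine \o m3))).
  rewrite /S -big_split -sumrB mulr_sumr; apply: eq_bigr => k _ /=.
  rewrite nuE; first by ring.
  by apply: measurableI; exact: measurable_itv.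
have -> : charge_integral nu D g - a * (\int[m1]_(x in D) g x -
    (\int[m2]_(x in D) g x + \int[m3]_(x in D) g x)) =
  (charge_integral nu D g - S (fine \o nu)) +
  (- a) * ((\int[m1]_(x in D) g x - S (fine \o m1)) -
    ((\int[m2]_(x in D) g x - S (fine \o m2)) +
     (\int[m3]_(x in D) g x - S (fine \o m3)))).
  by rewrite SE; ring.
apply: le_trans (ler_normD _ _) _; rewrite [e * _]mulrDr; apply: lerD => //.
rewrite normrM normrN [e * _]mulrCA ler_wpM2l// !(mulrDr e).
apply: le_trans (ler_normB _ _) _; apply: lerD; first exact: h.
by apply: le_trans (ler_normD _ _) _; apply: lerD; exact: h.
Qed.

End ChargeIntegral.

Section Kernel.
Variable R : realType.
Notation C := R[i].

Definition kernel (z : C) (x : R) : C := (x%:C - z)^-1.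

Lemma kernel_lipschitz (z : C) (x y : R) : ~~ (0 <= z) -> 0 <= x -> 0 <= y ->
  cmod (kernel z x - kernel z y) <= `|x - y| / delta z ^+ 2.
Proof.
move=> z0 x0 y0; have xz := cut_neq z0 x0; have yz := cut_neq z0 y0.
have -> : kernel z x - kernel z y = (y - x)%:C * (kernel z x * kernel z y).
  have -> : (y - x)%:C = (y%:C - z) - (x%:C - z).
    by rewrite opprB addrA subrK rmorphB.
  rewrite /kernel; move: (x%:C - z) (y%:C - z) xz yz => a b a0 b0; field.
  by rewrite a0 b0.
rewrite cmodM cmodR distrC ler_wpM2l// cmodM expr2 invfM.
by rewrite ler_pM ?cmod_ge0// cmod_kernel.
Qed.

Lemma kernel_grid (z : C) e : ~~ (0 <= z) -> 0 < e -> exists eta K,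
  grid (fun x => complex.Re (kernel z x)) e eta K /\
  grid (fun x => complex.Im (kernel z x)) e eta K.
Proof.
move=> z0 e0; have d0 := delta_gt0 z0.
(* The kernel is Lipschitz with constant 1 / (delta z)^2, and x >= |z| + 1 / e gives |x - z| >= 1 /
   e. One grid thus serves the real and the imaginary part. *)
pose eta := e * delta z ^+ 2.
have eta0 : 0 < eta by rewrite mulr_gt0// exprn_gt0.
pose K := Num.bound ((cmod z + e^-1) / eta).
have hK x : K%:R * eta <= x -> cmod (kernel z x) <= e.
  move=> Kx; have Kx' : cmod z + e^-1 <= x.
    apply: le_trans Kx; rewrite -ler_pdivrMr//; apply/ltW/archi_boundP.
    by rewrite divr_ge0 ?addr_ge0 ?cmod_ge0// ?invr_ge0 ltW.
  rewrite /kernel cmodV -[leRHS]invrK.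
  have ee : e^-1 <= cmod (x%:C - z).
    have := cmodD (x%:C - z) z; rewrite subrK cmodR => h1.
    have := ler_norm x; lra.
  by rewrite lef_pV2 ?posrE ?invr_gt0// (lt_le_trans _ ee)// invr_gt0.
have hL x y : 0 <= x -> 0 <= y -> `|x - y| <= eta ->
    cmod (kernel z x - kernel z y) <= e.
  move=> x0 y0 xy; apply: le_trans (kernel_lipschitz z0 x0 y0) _.
  by rewrite ler_pdivrMr// exprn_gt0.
exists eta, K; split; split=> //.
- move=> x y x0 y0 xy; apply: le_trans (hL x y x0 y0 xy).
  by rewrite -ReN -ReD Re_le_cmod.
- by move=> x /hK; apply: le_trans; exact: Re_le_cmod.
- move=> x y x0 y0 xy; apply: le_trans (hL x y x0 y0 xy).
  by rewrite -ImN -ImD Im_le_cmod.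
- by move=> x /hK; apply: le_trans; exact: Im_le_cmod.
Qed.

Lemma vanishing_kernel (z : C) : ~~ (0 <= z) ->
  vanishing (fun x => complex.Re (kernel z x)) /\
  vanishing (fun x => complex.Im (kernel z x)).
Proof.
move=> z0; split=> e /(kernel_grid z0)[eta [K [h1 h2]]].
  by exists eta, K.
by exists eta, K.
Qed.

End Kernel.

(** * Members of the Stieltjes class at a fixed point *)

Section MatrixMeasure.
Variables (R : realType) (K : nat).
Notation C := R[i].
Local Notation D := (`[0, +oo[%classic : set R).

Lemma mxm_valU (mu : mx_measure R K) (A B : set R) :
  measurable A -> measurable B -> A `&` B = set0 ->
  mxm_val mu (A `|` B) = mxm_val mu A + mxm_val mu B.
Proof.
move=> mA mB AB; apply/matrixP => i j; rewrite !mxE.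
rewrite !chargeU// !fineD ?charge_finite ?fin_num_measure//.
Qed.

Lemma mxm_val_cells (mu : mx_measure R K) (eta : R) n : 0 < eta ->
  mxm_val mu D = \sum_(k < n) mxm_val mu (cell eta k `&` D) +
    mxm_val mu (`](n%:R * eta - eta), +oo[%classic `&` D).
Proof.
move=> e0; elim: n => [|n IH].
  rewrite big_ord0 add0r mul0r sub0r; congr (mxm_val mu _).
  apply/seteqP; split=> x /=; rewrite !in_itv /= !andbT; last by case.
  by move=> x0; split => //; rewrite (lt_le_trans _ x0)// oppr_lt0.
rewrite big_ord_recr /= IH -addrA; congr (_ + _).
rewrite -mxm_valU.
- congr (mxm_val mu _); rewrite -setIUl; congr (_ `&` _).
  rewrite -natr1 mulrDl mul1r addrK /cell.
  apply/seteqP; split=> x /=; rewrite !in_itv /= ?andbT.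
    by move=> ->; case: (leP x (n%:R * eta)) => h; [left|right].
  by case=> [/andP[]//|]; apply: le_lt_trans; rewrite gerBl ltW.
- by apply: measurableI; exact: measurable_itv.
- by apply: measurableI; exact: measurable_itv.
- rewrite -natr1 mulrDl mul1r addrK; apply/seteqP; split=> x //=.
  rewrite /cell /= !in_itv /= ?andbT => -[[/andP[_ h1] _] [h2 _]].
  by move: (le_lt_trans h1 h2); rewrite ltxx.
Qed.

(** All that uniqueness and the lower bound need from the class. Cutting the half-line into cells
    replaces F z by a finite sum with positive masses of total at most 1, the remaining mass on the
    tail being positive. *)
Lemma stieltjes_halfplane (F : cut_plane R -> 'M[C]_K) (z : cut_plane R) (w : C) :
  stieltjes_class F -> w * w = val z -> 0 < complex.Im w ->
  halfplane (`|w| / (delta (val z))%:C) (w *: F z).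
Proof.
move=> [mu [mpos _ mass FE]] wz w0.
have z0 := valP z; have d0 := delta_gt0 z0.
have dC : 0 < (delta (val z))%:C :> C by rewrite ltcR.
pose u x := complex.Re (kernel (val z) x); pose v x := complex.Im (kernel (val z) x).
have [vu vv] := vanishing_kernel z0.
have [Br Br0] : exists2 Br : 'I_K * 'I_K -> R, forall p, 0 <= Br p & forall p g e eta n,
    0 <= e -> vanishing g -> grid g e eta n ->
  `|charge_integral (mxm_re mu p.1 p.2) D g -
    \sum_(k < n.+1) g (k%:R * eta) * fine (mxm_re mu p.1 p.2 (cell eta k `&` D))| <= e * Br p.
  have H p := charge_grid (mxm_re mu p.1 p.2).
  exists (fun p => s2val (cid2 (H p))) => p; first exact: (s2valP (cid2 (H p))).
  exact: (s2valP' (cid2 (H p))).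
have [Bi Bi0] : exists2 Bi : 'I_K * 'I_K -> R, forall p, 0 <= Bi p & forall p g e eta n,
    0 <= e -> vanishing g -> grid g e eta n ->
  `|charge_integral (mxm_im mu p.1 p.2) D g -
    \sum_(k < n.+1) g (k%:R * eta) * fine (mxm_im mu p.1 p.2 (cell eta k `&` D))| <= e * Bi p.
  have H p := charge_grid (mxm_im mu p.1 p.2).
  exists (fun p => s2val (cid2 (H p))) => p; first exact: (s2valP (cid2 (H p))).
  exact: (s2valP' (cid2 (H p))).
move=> hBi hBr.
pose B := \sum_p (Br p + Bi p).
have B0 : 0 <= B by apply: sumr_ge0 => p _; rewrite addr_ge0.
have BB p : Br p + Bi p <= B.
  by rewrite /B (bigD1 p)//= lerDl sumr_ge0// => q _; rewrite addr_ge0.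
apply: halfplane_closed; first by rewrite divr_ge0// ltW.
(* Each entry of the Riemann sum errs by at most 2 B times the mesh error, then multiplied by |w|;
   the added 1 keeps the divisor positive. *)
move=> e e0; pose c := cmod w * (B *+ 2) + 1.
have c0 : 0 < c by rewrite ltr_wpDl// mulr_ge0 ?cmod_ge0// mulrn_wge0.
have [eta [n [gu gv]]] := kernel_grid z0 (divr_gt0 e0 c0).
have [eta0 _ _] := gu.
have keta (k : nat) : 0 <= k%:R * eta by rewrite mulr_ge0// ltW.
exists (w *: \sum_(k < n.+1) kernel (val z) (k%:R * eta) *:
   mxm_val mu (cell eta k `&` D)).
  apply: halfplane_sum.
  - by rewrite divr_ge0// ltW.
  - by move=> k; apply: mpos; apply: measurableI; exact: measurable_itv.
  - rewrite -mass (mxm_val_cells mu n.+1 eta0) addrC addKr.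
    by apply: mpos; apply: measurableI; exact: measurable_itv.
  - move=> k; rewrite normrM ler_wpM2l// normcE_cmod -fmorphV lecR.
    exact: cmod_kernel.
  - by move=> k; rewrite /kernel -wz; apply: Im_kernel; rewrite ?wz.
move=> i j; rewrite FE mxE [X in _ - X]mxE -mulrBr cmodM.
apply: le_trans (_ : cmod w * (e / c * (B *+ 2)) <= _); last first.
  rewrite mulrCA -mulrA ger_pMr// -/c mulrC ler_pdivrMr// mul1r /c lerDl//.
apply: ler_wpM2l; first exact: cmod_ge0.
rewrite mxE summxE.
set X := (_ +i* _); set Y := \sum_(_ < _) _.
have -> : Y = (\sum_(k < n.+1) u (k%:R * eta) * fine (mxm_re mu i j (cell eta k `&` D)) -
    \sum_(k < n.+1) v (k%:R * eta) * fine (mxm_im mu i j (cell eta k `&` D))) +i*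
   (\sum_(k < n.+1) v (k%:R * eta) * fine (mxm_re mu i j (cell eta k `&` D)) +
    \sum_(k < n.+1) u (k%:R * eta) * fine (mxm_im mu i j (cell eta k `&` D))).
  rewrite /Y; apply: complex_ext; rewrite ?Re_sum ?Im_sum /= -?sumrB -?big_split /=.
    by apply: eq_bigr => k _; rewrite !mxE ReM.
  by apply: eq_bigr => k _; rewrite !mxE ImM addrC.
have ec : 0 <= e / c by rewrite divr_ge0 ?ltW.
have h1 := hBr (i, j) u _ _ _ ec vu gu; have h2 := hBr (i, j) v _ _ _ ec vv gv.
have h3 := hBi (i, j) u _ _ _ ec vu gu; have h4 := hBi (i, j) v _ _ _ ec vv gv.
apply: le_trans (cmod_le_ReIm _) _; rewrite ReD ImD ReN ImN /= /X /=.
have auxB (a b a' b' : R) : `|(a - b) - (a' - b')| <= `|a - a'| + `|b - b'|.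
  by rewrite (_ : _ - _ = (a - a') - (b - b')) ?ler_normB//; ring.
have auxD (a b a' b' : R) : `|(a + b) - (a' + b')| <= `|a - a'| + `|b - b'|.
  by rewrite (_ : _ - _ = (a - a') + (b - b')) ?ler_normD//; ring.
rewrite mulr2n mulrDr; apply: lerD; apply: le_trans (ler_wpM2l ec (BB (i, j)));
  rewrite mulrDr.
  apply: le_trans (auxB _ _ _ _) _; apply: lerD; [exact: h1|exact: h4].
apply: le_trans (auxD _ _ _ _) _; apply: lerD; [exact: h2|exact: h3].
Qed.

End MatrixMeasure.

Section Construction.
Variables (R : realType) (K : nat).
Notation C := R[i].
Local Notation D := (`[0, +oo[%classic : set R).
Variable m : 'cV[C]_K -> {finite_measure set R -> \bar R}.

Definition comb_charge (a : R) (m1 m2 m3 : {finite_measure set R -> \bar R}) :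
    {charge set R -> \bar R} :=
  cscale a (cadd (charge_of_finite_measure m1)
    (cscale (-1) (cadd (charge_of_finite_measure m2) (charge_of_finite_measure m3)))).

Lemma comb_chargeE a m1 m2 m3 (A : set R) : measurable A ->
  fine (comb_charge a m1 m2 m3 A) =
  a * (fine (m1 A) - (fine (m2 A) + fine (m3 A))).
Proof.
move=> mA.
rewrite -[comb_charge a m1 m2 m3 A]/(a%:E * (m1 A + (-1)%:E * (m2 A + m3 A)))%E.
have h i : (i : {finite_measure set R -> \bar R}) A = (fine (i A))%:E.
  by rewrite fineK// fin_num_measure.
by rewrite (h m1) (h m2) (h m3) /= mulN1r.
Qed.

Definition polar_measure : mx_measure R K :=
  let e (i : 'I_K) : 'cV[C]_K := delta_mx i 0 in
  MxMeasure
    (fun i j => comb_charge 2^-1 (m (e i + e j)) (m (e i)) (m (e j)))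
    (fun i j => comb_charge (- 2^-1) (m (e i + 'i%R *: e j)) (m (e i)) (m (e j))).

Lemma polar_measureE (A : set R) : measurable A ->
  mxm_val polar_measure A = polar (fun v => fine (m v A)).
Proof. by move=> mA; apply/matrixP => i j; rewrite !mxE !comb_chargeE. Qed.

Hypothesis m_neg : forall v, m v `]-oo, 0[%classic = 0%E.
Hypothesis m_mass : forall v, m v D = (complex.Re (sqn v))%:E.
Hypothesis m_quad : forall a b, a <= b ->
  quadratic (fun v => fine (m v `]a, b]%classic)).

Lemma sqnR (v : 'cV[C]_K) : (complex.Re (sqn v))%:C = sqn v.
Proof. by rewrite RRe_real// ger0_real// sqn_ge0. Qed.

Lemma quadratic_sqn : quadratic (fun v : 'cV[C]_K => complex.Re (sqn v)).
Proof. by apply: (quadratic_form (N := 1%:M)); [exact: trmxC1|exact: sqnR]. Qed.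

(** The sets with this property form a Dynkin system containing the half-open intervals, which are
    stable under intersection. Positivity of the polarized matrix measure rests on it: its form at v
    is then m v A. *)
Lemma quadratic_measure (A : set R) : measurable A ->
  quadratic (fun v => fine (m v A)).
Proof.
move=> mA; move: A mA.
pose P (A : set R) := quadratic (fun v => fine (m v A)).
have PT : P setT.
  rewrite /P [fun v => _](_ : _ = fun v => complex.Re (sqn v)).
    exact: quadratic_sqn.
  apply/funext => v; suff -> : m v setT = (complex.Re (sqn v))%:E by [].
  rewrite -m_mass; apply: etrans (esym (measure_carried (m_neg v) measurableT)) _.
  by rewrite setTI.
apply: (dynkin_induction (G := @ocitv R)) => //.
- by move=> A B; exact: ocitvI.
- move=> _ [[a b] _ <-]; have [ab|ba] := leP a b; first exact: m_quad.
  rewrite /P [fun v => _](_ : _ = fun v => 0); first exact: quadratic0.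
  by apply/funext => v; rewrite set_itv_ge ?measure0// -leNgt bnd_simp ltW.
- move=> A mA PA; rewrite /P.
  rewrite [fun v => _](_ : _ = fun v => fine (m v setT) - fine (m v A)).
    exact: quadraticB.
  apply/funext => v; rewrite -fineB ?fin_num_measure//; congr fine.
  rewrite -(setUv A) measureU// ?setICr//; last exact: measurableC.
  rewrite [X in (X - _)%E]addeC addeK// fin_num_measure//.
- move=> F mF tF PF; rewrite /P.
  apply: (@quadratic_cvg _ _ _ \oo (fun n v => \sum_(0 <= k < n) fine (m v (F k)))).
    by move=> n; exact: quadratic_sum.
  move=> v; have mUF : measurable (\bigcup_k F k) by exact: bigcupT_measurable.
  have h : (EFin \o (fun n => \sum_(0 <= k < n) fine (m v (F k)))) @ \oo -->
      (fine (m v (\bigcup_k F k)))%:E.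
    rewrite fineK ?fin_num_measure//.
    have -> : EFin \o (fun n => \sum_(0 <= k < n) fine (m v (F k))) =
        (fun n => \sum_(0 <= i < n) m v (F i))%E.
      apply/funext => n /=; rewrite -sumEFin; apply: eq_bigr => k _.
      by rewrite fineK// fin_num_measure.
    exact: measure_semi_sigma_additive.
  exact: (fine_cvg h).
Qed.

Lemma polar_measure_positive : mxm_positive polar_measure.
Proof.
move=> A mA x; rewrite polar_measureE// -/(form _ _ _) quadratic_measure//.
by rewrite ler0c fine_ge0.
Qed.

Lemma polar0 : polar (fun _ : 'cV[C]_K => 0 : R) = 0.
Proof.
by apply/matrixP => i j; rewrite !mxE; apply: complex_ext => /=; ring.
Qed.

Lemma polar_measure_carried : mxm_carried_by polar_measure D.
Proof.
move=> A mA AD; rewrite polar_measureE//.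
rewrite (_ : (fun v => fine (m v A)) = fun=> 0) ?polar0//.
apply/funext => v; suff -> : m v A = 0%E by [].
by apply: etrans (esym (measure_carried (m_neg v) mA)) _; rewrite AD measure0.
Qed.

Lemma polar_measure_mass : mxm_val polar_measure D = 1%:M.
Proof.
rewrite polar_measureE; last exact: measurable_itv.
rewrite (_ : (fun v => fine (m v D)) = fun v => complex.Re (sqn v)).
  by apply: polar_form; [exact: trmxC1|exact: sqnR].
by apply/funext => v; rewrite m_mass.
Qed.

Lemma polar_measure_stieltjes : stieltjes_class (fun z : cut_plane R =>
  mxm_integral polar_measure D (fun x => (x%:C - val z)^-1)).
Proof.
exists polar_measure; split=> //; [exact: polar_measure_positive|
  exact: polar_measure_carried|exact: polar_measure_mass].
Qed.

(** The combination is the one of [entry_polar], which reduces convergence of the entries to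
    convergence of quadratic forms. *)
Lemma polar_measure_integral (f : R -> C) i j :
  vanishing (fun x => complex.Re (f x)) -> vanishing (fun x => complex.Im (f x)) ->
  let tau v := (\int[m v]_(x in D) complex.Re (f x)) +i*
               (\int[m v]_(x in D) complex.Im (f x)) in
  let e (i : 'I_K) : 'cV[C]_K := delta_mx i 0 in
  mxm_integral polar_measure D f i j =
  (2^-1)%:C * (tau (e i + e j) - (tau (e i) + tau (e j))) +
  'i%C * ((- 2^-1)%:C * (tau (e i + 'i%R *: e j) - (tau (e i) + tau (e j)))).
Proof.
move=> vr vi tau e; rewrite mxE.
have hc a m1 m2 m3 := charge_integral_comb (@comb_chargeE a m1 m2 m3).
rewrite /polar_measure /= !(hc _ _ _ _ _ vr) !(hc _ _ _ _ _ vi) /tau /e.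
by apply: complex_ext; rewrite !(ReD, ImD, ReM, ImM, ReN, ImN) /=; ring.
Qed.

End Construction.

Section Ultra.
Variable R : realType.

(** All bounded sequences converge along the same U, so every vector, every point of the line and
    both unknowns share one limit without extraction of subsequences. *)
Lemma ultra_cvg (U : set_system nat) (u : nat -> R) B : UltraFilter U ->
  (forall n, `|u n| <= B) -> cvg (u n @[n --> U]).
Proof.
move=> UU uB; have UF := @ultra_proper _ _ UU.
have cB := @segment_compact R (- B) B.
have /cB : (u @ U) `[(- B), B]%classic.
  by apply: nearW => n; rewrite /= in_itv /= -ler_norml.
move=> [l [_ cl]].
apply/cvg_ex; exists l => N Nl.
have [//|UN] := in_ultra_setVsetC (u @^-1` N) UU.
have [x [nNx Nx]] : (~` N) `&` N !=set0 by apply: cl => //; exact: UN.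
by [].
Qed.

End Ultra.

(** * Limits of finite resolvents *)

Section ResolventLimit.
Variable R : realType.
Notation C := R[i].
Local Notation D := (`[0, +oo[%classic : set R).

Lemma form_gram p K (V : 'M[C]_(p, K)) (d : 'rV[C]_p) v :
  form v (V^t* *m diag_mx d *m V) v =
  \sum_k d 0 k * (cmod ((V *m v) k 0) ^+ 2)%:C.
Proof.
rewrite form_mulmx trmxCK /form mxE; apply: eq_bigr => k _.
rewrite mul_mx_diag !mxE mulrAC mulrC; congr (_ * _).
by rewrite rmorphXn /= -normcE_cmod normCK mulrC.
Qed.

Lemma entry_polar K (N : 'M[C]_K) i j :
  let phi v := form v N v in
  let e (i : 'I_K) : 'cV[C]_K := delta_mx i 0 in
  N i j = (2^-1)%:C * (phi (e i + e j) - (phi (e i) + phi (e j))) +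
  'i%C * ((- 2^-1)%:C * (phi (e i + 'i%R *: e j) - (phi (e i) + phi (e j)))).
Proof.
move=> phi e; rewrite /phi /e !formDl !formDr !formZl !formZr !form_delta conjCi.
rewrite imaginaryE.
by apply: complex_ext; rewrite !(ReD, ImD, ReM, ImM, ReN, ImN) /=; lra.
Qed.

Variables (U : set_system nat) (UU : UltraFilter U) (K : nat) (p : nat -> nat).
Variables (V : forall n, 'M[C]_(p n, K)) (l : forall n, 'I_(p n) -> R) (h : R).
Arguments l : clear implicits.
Hypothesis V1 : forall n, (V n)^t* *m V n = 1%:M.
Hypothesis l_ge0 : forall n k, 0 <= l n k.
Let lC n : 'rV[C]_(p n) := \row_k (l n k)%:C.
Hypothesis moment : forall n, psd (h%:C%:M - (V n)^t* *m diag_mx (lC n) *m V n).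

Let UF : ProperFilter U := @ultra_proper _ _ UU.
Let c n (v : 'cV[C]_K) k := cmod ((V n *m v) k 0) ^+ 2.
Arguments c : clear implicits.
Let mass (v : 'cV[C]_K) := complex.Re (sqn v).

Let c_ge0 n v k : 0 <= c n v k.
Proof. exact: sqr_ge0. Qed.

Let sum_c n v : \sum_k c n v k = mass v.
Proof.
apply: complexI; rewrite /mass sqnR -[sqn v]/(form v 1%:M v) -(V1 n).
rewrite -[in RHS](mulmx1 ((V n)^t* )) -diag_const_mx form_gram rmorph_sum /=.
by apply: eq_bigr => k _; rewrite mxE mul1r.
Qed.

Let sum_cl n v : \sum_k c n v k * l n k <= h * mass v.
Proof.
have := moment n v; rewrite formB form_scalar -[form v 1%:M v]/(sqn v) -sqnR.
rewrite form_gram subr_ge0 -/(mass v) => H.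
rewrite -lecR rmorphM rmorph_sum /=; apply: le_trans H.
by apply: ler_sum => k _; rewrite mxE rmorphM mulrC.
Qed.

Let F n v x := cdf (c n v) (l n) x.

Let F_bound n v x : 0 <= F n v x <= mass v.
Proof. by apply: cdf_bound; [exact: c_ge0|rewrite sum_c]. Qed.

Let G (v : 'cV[C]_K) (x : R) : R := lim (F n v x @[n --> U]).

Let F_cvg v x : F n v x @[n --> U] --> G v x.
Proof.
apply: (@ultra_cvg _ _ _ (mass v)) => n; have /andP[h1 h2] := F_bound n v x.
by rewrite ger0_norm.
Qed.

Let G_bound v x : 0 <= G v x <= mass v.
Proof.
apply/andP; split.
  by apply: (@cvg_ge_const _ _ (fun n => F n v x) _ _ UF (@F_cvg v x)) => n; case/andP: (F_bound n v x).
by apply: (@cvg_le_const _ _ (fun n => F n v x) _ _ UF (@F_cvg v x)) => n; case/andP: (F_bound n v x).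
Qed.

Let G_nd v : nondecreasing (G v).
Proof.
move=> x y xy; rewrite -subr_ge0.
apply: (@cvg_ge_const _ _ (fun n => F n v y - F n v x) _ _ UF (cvgB (@F_cvg v y) (@F_cvg v x))) => n.
by rewrite subr_ge0; apply: cdf_nd => // k; exact: c_ge0.
Qed.

Let G_0 v x : x < 0 -> G v x = 0.
Proof.
move=> x0; apply: (cvg_unique (@Rhausdorff R) (@F_cvg v x)).
have -> : (fun n => F n v x) = cst 0 by apply/funext => n; exact: cdf0.
exact: cvg_cst.
Qed.

Let G_tight v x : 0 < x -> mass v - h * mass v / x <= G v x.
Proof.
move=> x0; apply: (@cvg_ge_const _ _ (fun n => F n v x) _ _ UF (@F_cvg v x)) => n; rewrite -(sum_c n v).
by apply: cdf_tight => //; rewrite (sum_c n v); exact: sum_cl.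
Qed.

Let G_quad x : quadratic (fun v => G v x).
Proof.
apply: (quadratic_cvg UF (f := fun n v => F n v x)); last by move=> v; exact: F_cvg.
move=> n; pose d : 'rV[C]_(p n) := \row_k ((l n k <= x)%R%:R : R)%:C.
apply: (quadratic_form (N := (V n)^t* *m diag_mx d *m V n)).
  rewrite !trmxCM trmxCK trmxC_diag mulmxA; congr (_ *m diag_mx _ *m _).
  by apply/rowP => k; rewrite !mxE conj_real_complex.
move=> v; rewrite form_gram /F /cdf rmorph_sum /=; apply: eq_bigr => k _.
by rewrite mxE rmorphM mulrC.
Qed.

(** A scalar measure is built for each vector v separately; the quadratic dependence of the limiting
    distribution functions on v is what allows these measures to be assembled into one matrix
    measure. *)
Lemma res_limit : exists F : cut_plane R -> 'M[C]_K, stieltjes_class F /\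
  forall z i j, clim U (fun n => res (V n) (lC n) (val z) i j) (F z i j).
Proof.
have exm v : exists m : {finite_measure set R -> \bar R},
    [/\ forall a b, a <= b -> m `]a, b]%classic = (rreg (G v) b - rreg (G v) a)%:E,
        m `]-oo, 0[%classic = 0%E & m D = (mass v)%:E].
  apply: (@limit_measure _ _ _ (h * mass v)).
  - exact: (rreg_nd (G_bound v)).
  - exact: (rreg_right_continuous (G_bound v)).
  - exact: (rreg_bound (G_nd v) (G_bound v)).
  - by move=> x; exact: (rreg0 (G_nd v) (G_bound v) (@G_0 v)).
  - move=> x x0; apply: le_trans (G_tight v x0) _.
    exact: (rreg_ge (G_nd v) (G_bound v)).
have [m mP] := choice exm.
have m_neg v : m v `]-oo, 0[%classic = 0%E by have [] := mP v.
have m_mass v : m v D = (complex.Re (sqn v))%:E by have [] := mP v.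
have rquad x : quadratic (fun v => rreg (G v) x).
  apply: (@quadratic_cvg _ _ _ (x^'+) (fun y v => G v y)) => // v.
  exact: (rreg_cvg (G_nd v) (G_bound v)).
have m_quad a b : a <= b -> quadratic (fun v => fine (m v `]a, b]%classic)).
  move=> ab; rewrite [fun v => _](_ : _ = fun v => rreg (G v) b - rreg (G v) a).
    exact: quadraticB.
  by apply/funext => v; have [-> //] := mP v.
eexists; split; first exact: (polar_measure_stieltjes m_neg m_mass m_quad).
move=> z i j; have [vr vi] := vanishing_kernel (valP z).
rewrite (polar_measure_integral _ _ _ vr vi).
have cl v : clim U (fun n => form v (res (V n) (lC n) (val z)) v)
   ((\int[m v]_(x in D) complex.Re (kernel (val z) x)) +i*
               (\int[m v]_(x in D) complex.Im (kernel (val z) x))).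
  have -> : (fun n => form v (res (V n) (lC n) (val z)) v) = fun n =>
      (\sum_k c n v k * complex.Re (kernel (val z) (l n k))) +i*
      (\sum_k c n v k * complex.Im (kernel (val z) (l n k))).
    apply/funext => n; rewrite /res form_gram; apply: complex_ext.
      by rewrite Re_sum; apply: eq_bigr => k _; rewrite mxE [lC n _ _]mxE mulrC ReMl.
    by rewrite Im_sum; apply: eq_bigr => k _; rewrite mxE [lC n _ _]mxE mulrC ImMl.
  have [m1 m2 m3] := mP v.
  by apply: clim_ReIm; apply: (atoms_cvg UF _ _ _ (@F_cvg v) m1 m2 m3) => //;
    move=> n *; rewrite ?sum_c//; exact: c_ge0.
under eq_fun do rewrite entry_polar.
apply: climD; last apply: climM; first [exact: clim_cst|apply: climM];
  try exact: clim_cst; by apply: climB => //; apply: climD.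
Qed.

End ResolventLimit.

(** * The operators Psi and Psibar *)

Section Exponential.
Variable R : realType.
Notation C := R[i].

Lemma e2ipiD (s t : R) : e2ipi (s + t) = e2ipi s * e2ipi t.
Proof.
by rewrite /e2ipi mulrDr cosD sinD; apply: complex_ext; rewrite ?ReM ?ImM /=; ring.
Qed.

Lemma e2ipi0 : e2ipi (0 : R) = 1.
Proof. by rewrite /e2ipi mulr0 cos0 sin0. Qed.

Lemma conj_e2ipi (t : R) : (e2ipi t)^*%R = e2ipi (- t).
Proof.
by rewrite /e2ipi mulrN cosN sinN; apply: complex_ext; rewrite ?Re_conj ?Im_conj.
Qed.

Lemma conj_e2ipiM (t : R) : (e2ipi t)^*%R * e2ipi t = 1.
Proof. by rewrite conj_e2ipi -e2ipiD addNr e2ipi0. Qed.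

Lemma cmod_e2ipi (t : R) : cmod (e2ipi t) = 1.
Proof. by rewrite /cmod /= cos2Dsin2 sqrtr1. Qed.

Lemma e2ipi_nat (n : nat) : e2ipi (n%:R : R) = 1.
Proof.
elim: n => [|n IH]; first by rewrite e2ipi0.
rewrite -natr1 e2ipiD IH mul1r /e2ipi mulr1 mulr_natl cos2pi sin2pi.
by [].
Qed.

Let int_FTC (f F : R -> R) : (forall x : R, is_derive x (1 : R) F (f x)) -> continuous f ->
  \int[lebesgue_measure]_(x in `[0, 1]) f x = F 1 - F 0.
Proof.
move=> dF cf; rewrite /Rintegral (@continuous_FTC2 _ f F 0 1) //=.
- by apply: continuous_subspaceT => x; exact: cf.
- have cF : continuous F.
    by move=> x; apply: differentiable_continuous; apply/derivable1_diffP; have [] := dF x.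
  split; first by move=> x _; have [] := dF x.
    by apply: cvg_at_right_filter; exact: cF.
  by apply: cvg_at_left_filter; exact: cF.
- by move=> x _; rewrite derive1E; have [_ ->] := dF x.
Qed.

Lemma cintegral_e2ipi (n : nat) : (0 < n)%N ->
  cintegral01 (fun nu : R => e2ipi (n%:R * nu)) = 0.
Proof.
move=> n0; pose a : R := 2 * pi * n%:R.
have a0 : a != 0 by rewrite !mulf_neq0 ?pnatr_eq0 -?lt0n// gt_eqF// pi_gt0.
have aE (x : R) : 2 * pi * (n%:R * x) = a * x by rewrite mulrA.
have dS (x : R) : is_derive x (1 : R) (fun x => a^-1 * sin (a * x)) (cos (a * x)).
  have -> : (fun x => a^-1 * sin (a * x)) = a^-1 *: (sin \o (a *: id)).
    by apply/funext => y.
  apply: is_derive_eq; rewrite /GRing.scale /= mulr1 mulrCA mulVf ?mulr1//.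
have dC (x : R) : is_derive x (1 : R) (fun x => - (a^-1 * cos (a * x))) (sin (a * x)).
  have -> : (fun x => - (a^-1 * cos (a * x))) = (- a^-1) *: (cos \o (a *: id)).
    by apply/funext => y; rewrite -mulNr.
  apply: is_derive_eq; rewrite /GRing.scale /= mulr1 mulrCA.
  by rewrite [- a^-1 * a]mulNr mulVf// mulrNN mulr1.
have [c1 s1] : cos a = 1 /\ sin a = 0.
  by move: (e2ipi_nat n); rewrite /e2ipi -/a => -[-> ->].
apply: complex_ext; rewrite /cintegral01 /e2ipi /=;
  under eq_Rintegral do rewrite aE.
  apply: etrans (int_FTC dS _) _.
    move=> x; apply: continuous_comp; last exact: continuous_cos.
    exact: mulrl_continuous.
  by rewrite mulr1 mulr0 s1 sin0 subrr.
apply: etrans (int_FTC dC _) _.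
  move=> x; apply: continuous_comp; last exact: continuous_sin.
  exact: mulrl_continuous.
by rewrite mulr1 mulr0 c1 cos0 subrr.
Qed.

End Exponential.

Section ComplexIntegral.
Variable R : realType.
Notation C := R[i].
Local Notation I01 := (`[0%R, 1%R]%classic : set R).
Local Notation leb := (@lebesgue_measure R).

Definition bounded_measurable (f : R -> C) : Prop :=
  [/\ measurable_fun I01 (fun x => complex.Re (f x)),
      measurable_fun I01 (fun x => complex.Im (f x))
    & exists B : R, forall x, I01 x -> cmod (f x) <= B].

Lemma bm_cst (a : C) : bounded_measurable (fun=> a).
Proof.
split; [exact: measurable_cst|exact: measurable_cst|].
by exists (cmod a).
Qed.

Lemma bmD f g : bounded_measurable f -> bounded_measurable g ->
  bounded_measurable (fun x => f x + g x).
Proof.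
move=> [f1 f2 [Bf fB]] [g1 g2 [Bg gB]]; split.
- have -> : (fun x => complex.Re (f x + g x)) = (fun x => complex.Re (f x) + complex.Re (g x)).
    by apply/funext => x; rewrite ReD.
  exact: measurable_funD.
- have -> : (fun x => complex.Im (f x + g x)) = (fun x => complex.Im (f x) + complex.Im (g x)).
    by apply/funext => x; rewrite ImD.
  exact: measurable_funD.
- exists (Bf + Bg) => x x01; apply: le_trans (cmodD _ _) _.
  by apply: lerD; [exact: fB|exact: gB].
Qed.

Lemma bmM f g : bounded_measurable f -> bounded_measurable g ->
  bounded_measurable (fun x => f x * g x).
Proof.
move=> [f1 f2 [Bf fB]] [g1 g2 [Bg gB]]; split.
- have -> : (fun x => complex.Re (f x * g x)) = (fun x => complex.Re (f x) * complex.Re (g x) - complex.Im (f x) * complex.Im (g x)).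
    by apply/funext => x; rewrite ReM.
  by apply: measurable_funB; exact: measurable_funM.
- have -> : (fun x => complex.Im (f x * g x)) = (fun x => complex.Re (f x) * complex.Im (g x) + complex.Im (f x) * complex.Re (g x)).
    by apply/funext => x; rewrite ImM.
  by apply: measurable_funD; exact: measurable_funM.
- exists (Bf * Bg) => x x01; rewrite cmodM.
  by rewrite ler_pM ?cmod_ge0//; [exact: fB|exact: gB].
Qed.

Lemma bm_conj f : bounded_measurable f -> bounded_measurable (fun x => (f x)^*%R).
Proof.
move=> [f1 f2 [Bf fB]]; split.
- have -> : (fun x => complex.Re (f x)^*%R) = (fun x => complex.Re (f x)).
    by apply/funext => x; rewrite Re_conj.
  by [].
- have -> : (fun x => complex.Im (f x)^*%R) = (fun x => - complex.Im (f x)).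
    by apply/funext => x; rewrite Im_conj.
  exact: measurable_funN.
- exists Bf => x x01; apply: le_trans (fB x x01).
  by rewrite -lecR -!normcE_cmod norm_conjC.
Qed.

Lemma bm_sum J (r : seq J) (f : J -> R -> C) :
  (forall j, bounded_measurable (f j)) ->
  bounded_measurable (fun x => \sum_(j <- r) f j x).
Proof.
move=> bf; elim: r => [|j r IH].
  by under eq_fun do rewrite big_nil; exact: bm_cst.
by under eq_fun do rewrite big_cons; exact: bmD.
Qed.

Lemma bm_real (s : R -> R) (B : R) : measurable_fun I01 s ->
  (forall x, I01 x -> `|s x| <= B) -> bounded_measurable (fun x => (s x)%:C).
Proof.
move=> ms sB; split; [exact: ms|exact: (@measurable_cst _ _ _ _ _ (0 : R))|].
by exists B => x x01; rewrite cmodR sB.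
Qed.

Lemma bm_e2ipi (a : R) : bounded_measurable (fun x => e2ipi (a * x)).
Proof.
have lin : continuous (fun x : R => 2 * pi * (a * x)).
  have -> : (fun x => 2 * pi * (a * x)) = *%R (2 * pi * a).
    by apply/funext => x; rewrite mulrA.
  exact: mulrl_continuous.
split.
- apply: measurable_funTS; apply: continuous_measurable_fun => x.
  apply: (@continuous_comp _ _ _ (fun x => 2 * pi * (a * x)) cos).
    exact: lin.
  exact: continuous_cos.
- apply: measurable_funTS; apply: continuous_measurable_fun => x.
  apply: (@continuous_comp _ _ _ (fun x => 2 * pi * (a * x)) sin).
    exact: lin.
  exact: continuous_sin.
- by exists 1 => x _; rewrite cmod_e2ipi.
Qed.

Let mI01 : measurable I01. Proof. exact: measurable_itv. Qed.

Let mu01 : lebesgue_measure I01 = 1%E.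
Proof. by rewrite lebesgue_measure_itv /= lte_fin ltr01 -EFinB subr0. Qed.

Lemma bm_integrable f : bounded_measurable f ->
  leb.-integrable I01 (EFin \o (fun x => complex.Re (f x))) /\
  leb.-integrable I01 (EFin \o (fun x => complex.Im (f x))).
Proof.
move=> [f1 f2 [B fB]].
have key (g : R -> R) : measurable_fun I01 g -> (forall x, I01 x -> `|g x| <= B) ->
    leb.-integrable I01 (EFin \o g).
  move=> mg gB; apply: measurable_bounded_integrable => //.
    apply: (@le_lt_trans _ _ 1%E); last exact: ltry.
    by rewrite -mu01.
  exists B; split; first exact: num_real.
  by move=> M BM x x01; apply: le_trans (gB x x01) _; exact: ltW.
split; apply: key => // x x01; apply: le_trans (fB x x01).
  exact: Re_le_cmod.
exact: Im_le_cmod.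
Qed.

Lemma cintegralD f g : bounded_measurable f -> bounded_measurable g ->
  cintegral01 (fun x => f x + g x) = cintegral01 f + cintegral01 g.
Proof.
move=> /bm_integrable[f1 f2] /bm_integrable[g1 g2].
apply: complex_ext; rewrite ?ReD ?ImD /= -RintegralD//.
  by apply: eq_Rintegral => x _; rewrite ReD.
by apply: eq_Rintegral => x _; rewrite ImD.
Qed.

Lemma cintegralZ (a : C) f : bounded_measurable f ->
  cintegral01 (fun x => a * f x) = a * cintegral01 f.
Proof.
move=> /bm_integrable[f1 f2].
have iZ b (g : R -> R) : leb.-integrable I01 (EFin \o g) ->
    leb.-integrable I01 (EFin \o (fun x => b * g x)).
  move=> ig.
  have -> : EFin \o (fun x => b * g x) = (fun x => b%:E * (EFin \o g) x)%E.
    by apply/funext => x /=; rewrite EFinM.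
  by apply: integrableZl => //; exact: mI01.
apply: complex_ext; rewrite ?ReM ?ImM /= -!RintegralZl//.
  rewrite -RintegralB//; [|exact: iZ|exact: iZ].
  by apply: eq_Rintegral => x _; rewrite ReM.
rewrite -RintegralD//; [|exact: iZ|exact: iZ].
by apply: eq_Rintegral => x _; rewrite ImM.
Qed.

Lemma cintegral_conj f : bounded_measurable f ->
  cintegral01 (fun x => (f x)^*%R) = (cintegral01 f)^*%R.
Proof.
move=> /bm_integrable[f1 f2].
apply: complex_ext; rewrite ?Re_conj ?Im_conj /=.
  by apply: eq_Rintegral => x _; rewrite Re_conj.
rewrite -[RHS]mulN1r -RintegralZl//.
by apply: eq_Rintegral => x _; rewrite Im_conj mulN1r.
Qed.

Lemma cintegral_ge0 f : (forall x, I01 x -> 0 <= f x) -> 0 <= cintegral01 f.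
Proof.
move=> f0; rewrite ge0_complex /=; apply/andP; split.
  rewrite (@eq_Rintegral _ _ _ _ _ (fun=> 0)) ?Rintegral_cst ?mul0r//.
  by move=> x /set_mem/f0; rewrite ge0_complex => /andP[/eqP].
by apply: Rintegral_ge0 => x /f0; rewrite ge0_complex => /andP[_].
Qed.

Lemma eq_cintegral (f g : R -> C) : (forall x, f x = g x) -> cintegral01 f = cintegral01 g.
Proof. by move=> fg; congr cintegral01; exact/funext. Qed.

Lemma cintegral_cst (a : C) : cintegral01 (fun=> a) = a.
Proof.
have mu1 : fine (leb I01) = 1.
  by rewrite -[RHS]/(fine 1%E); congr fine; exact: mu01.
by apply: complex_ext; rewrite /= Rintegral_cst// mu1 mulr1.
Qed.

Lemma cintegral_sum J (r : seq J) (f : J -> R -> C) :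
  (forall j, bounded_measurable (f j)) ->
  cintegral01 (fun x => \sum_(j <- r) f j x) = \sum_(j <- r) cintegral01 (f j).
Proof.
move=> bf; elim: r => [|j r IH].
  by rewrite big_nil -[RHS]cintegral_cst; apply: eq_cintegral => x; rewrite big_nil.
rewrite big_cons -IH -cintegralD//; last exact: bm_sum.
by apply: eq_cintegral => x; rewrite big_cons.
Qed.

End ComplexIntegral.

Section CPMapClosure.
Variable C : numClosedFieldType.

(** The bound at 1 is left out so that the class is stable under sums and conjugations; the constant
    is computed once, on the final map. *)
Record cp m n (Phi : 'M[C]_m -> 'M[C]_n) : Prop := CP {
  cp_lin : forall a A B, Phi (a *: A + B) = a *: Phi A + Phi B;
  cp_adj : forall A, Phi (A^t* ) = (Phi A)^t*;
  cp_dom : forall Y1 Y2 D, dom Y1 Y2 D -> dom (Phi Y1) (Phi Y2) (Phi D) }.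

Lemma cp_cpmap m n (Phi : 'M[C]_m -> 'M[C]_n) h : cp Phi ->
  (forall x, form x (Phi 1%:M) x <= h * sqn x) -> cpmap Phi h.
Proof.
move=> [p1 p2 p3] p4; split=> // x.
by rewrite formB form_scalar subr_ge0; exact: p4.
Qed.

Lemma domM m n (R : 'M[C]_(m, n)) (Y1 Y2 D : 'M[C]_m) : dom Y1 Y2 D ->
  dom (R^t* *m Y1 *m R) (R^t* *m Y2 *m R) (R^t* *m D *m R).
Proof.
move=> h x y; rewrite !trmxCM trmxCK mulmxA !form_mulmx trmxCK.
exact: h.
Qed.

Lemma cp_conjr m n p (Phi : 'M[C]_m -> 'M[C]_n) (R : 'M[C]_(n, p)) :
  cp Phi -> cp (fun A => R^t* *m Phi A *m R).
Proof.
move=> [p1 p2 p3]; split.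
- by move=> a A B; rewrite p1 mulmxDr mulmxDl -scalemxAr -scalemxAl.
- by move=> A; rewrite p2 !trmxCM trmxCK mulmxA.
- by move=> Y1 Y2 D /p3; exact: domM.
Qed.

Lemma cp_conjl m n p (Phi : 'M[C]_m -> 'M[C]_n) (R : 'M[C]_(p, m)) :
  cp Phi -> cp (fun A => Phi (R^t* *m A *m R)).
Proof.
move=> [p1 p2 p3]; split.
- by move=> a A B; rewrite mulmxDr mulmxDl -scalemxAr -scalemxAl p1.
- by move=> A; rewrite -p2 !trmxCM trmxCK mulmxA.
- by move=> Y1 Y2 D /(domM R); exact: p3.
Qed.

Lemma cp0 m n : cp (fun _ : 'M[C]_m => 0 : 'M[C]_n).
Proof.
split.
- by move=> a A B; rewrite scaler0 addr0.
- by move=> A; rewrite -[in RHS](scale0r (0 : 'M[C]_n)) trmxCZ rmorph0 scale0r.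
- by move=> Y1 Y2 D h x y; rewrite -conj_form !form0 rmorph0 !addr0.
Qed.

Lemma cpD m n (Phi Psi : 'M[C]_m -> 'M[C]_n) : cp Phi -> cp Psi ->
  cp (fun A => Phi A + Psi A).
Proof.
move=> [p1 p2 p3] [q1 q2 q3]; split.
- by move=> a A B; rewrite p1 q1 scalerDr addrACA.
- by move=> A; rewrite p2 q2 trmxCD.
- move=> Y1 Y2 D h x y; rewrite trmxCD !formD.
  have := addr_ge0 (p3 _ _ _ h x y) (q3 _ _ _ h x y) => h'; apply: le_trans h' _.
  by rewrite le_eqVlt; apply/orP; left; apply/eqP; ring.
Qed.

Lemma cp_sum m n I (r : seq I) (Phi : I -> 'M[C]_m -> 'M[C]_n) :
  (forall i, cp (Phi i)) -> cp (fun A => \sum_(i <- r) Phi i A).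
Proof.
move=> cPhi; elim: r => [|i r IH].
  rewrite (_ : (fun _ => _) = fun=> 0); first exact: cp0.
  by apply/funext => A; rewrite big_nil.
rewrite (_ : (fun _ => _) = fun A => Phi i A + \sum_(j <- r) Phi j A).
  exact: cpD.
by apply/funext => A; rewrite big_cons.
Qed.

Lemma cpZ m n (Phi : 'M[C]_m -> 'M[C]_n) (a : C) : 0 <= a -> cp Phi ->
  cp (fun A => a *: Phi A).
Proof.
move=> a0 [p1 p2 p3]; split.
- by move=> b A B; rewrite p1 scalerDr !scalerA mulrC.
- by move=> A; rewrite p2 trmxCZ (CrealP _)// ger0_real.
- by move=> Y1 Y2 D /p3; exact: domZ.
Qed.

End CPMapClosure.

(** * Maps in integral Kraus form *)

Section Kraus.
Variable R : realType.
Notation C := R[i].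
Local Notation I01 := (`[0%R, 1%R]%classic : set R).

Definition bm_mx m n (F : R -> 'M[C]_(m, n)) : Prop :=
  forall i j, bounded_measurable (fun x => F x i j).

Lemma bm_mulmx m n p (F : R -> 'M[C]_(m, n)) (G : R -> 'M[C]_(n, p)) :
  bm_mx F -> bm_mx G -> bm_mx (fun x => F x *m G x).
Proof.
move=> bF bG i j.
rewrite (_ : (fun x => _) = fun x => \sum_k F x i k * G x k j).
  by apply: bm_sum => k; exact: bmM.
by apply/funext => x; rewrite mxE.
Qed.

Lemma bm_trmxC m n (F : R -> 'M[C]_(m, n)) : bm_mx F -> bm_mx (fun x => (F x)^t* ).
Proof.
move=> bF i j; rewrite (_ : (fun x => _) = fun x => (F x j i)^*%R).
  exact: bm_conj.
by apply/funext => x; rewrite !mxE.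
Qed.

Lemma bm_mx_cst m n (A : 'M[C]_(m, n)) : bm_mx (fun=> A).
Proof. by move=> i j; exact: bm_cst. Qed.

Lemma bm_scale m n (s : R -> C) (F : R -> 'M[C]_(m, n)) :
  bounded_measurable s -> bm_mx F -> bm_mx (fun x => s x *: F x).
Proof.
move=> bs bF i j; rewrite (_ : (fun x => _) = fun x => s x * F x i j).
  exact: bmM.
by apply/funext => x; rewrite mxE.
Qed.

Lemma form_mxintegral m n (F : R -> 'M[C]_(m, n)) x y : bm_mx F ->
  form x (mxintegral01 F) y = cintegral01 (fun nu => form x (F nu) y).
Proof.
move=> bF; rewrite form_entries.
under [RHS]eq_cintegral do rewrite form_entries.
have b1 i j : bounded_measurable (fun nu => (x i 0)^*%R * F nu i j * y j 0).
  by apply: bmM (bm_cst _); apply: bmM (bm_cst _) _; exact: bF.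
rewrite cintegral_sum; last by move=> i; apply: bm_sum.
apply: eq_bigr => i _; rewrite cintegral_sum//; apply: eq_bigr => j _.
rewrite mxE mulrAC -cintegralZ; last exact: bF.
by apply: eq_cintegral => nu; rewrite mulrAC.
Qed.

Definition kraus p q (s : R -> R) (U : R -> 'M[C]_(p, q)) (A : 'M[C]_p) : 'M[C]_q :=
  mxintegral01 (fun nu => (s nu)%:C *: ((U nu)^t* *m A *m U nu)).

Variables (p q : nat) (s : R -> R) (U : R -> 'M[C]_(p, q)).
Hypothesis bs : bounded_measurable (fun nu => (s nu)%:C).
Hypothesis bU : bm_mx U.
Hypothesis s_ge0 : forall nu, I01 nu -> 0 <= s nu.

Let bK A : bm_mx (fun nu => (s nu)%:C *: ((U nu)^t* *m A *m U nu)).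
Proof.
apply: bm_scale => //; apply: bm_mulmx => //; apply: bm_mulmx; last exact: bm_mx_cst.
exact: bm_trmxC.
Qed.

Let bf x A y : bounded_measurable (fun nu => form x ((s nu)%:C *: ((U nu)^t* *m A *m U nu)) y).
Proof.
rewrite /form; apply: bm_mulmx; last exact: bm_mx_cst.
by apply: bm_mulmx => //; exact: bm_mx_cst.
Qed.

Lemma form_kraus x A y : form x (kraus s U A) y =
  cintegral01 (fun nu => (s nu)%:C * form (U nu *m x) A (U nu *m y)).
Proof.
rewrite /kraus form_mxintegral//; apply: eq_cintegral => nu.
by rewrite formZ form_mulmx trmxCK.
Qed.

Let bform x A y : bounded_measurable
  (fun nu => (s nu)%:C * form (U nu *m x) A (U nu *m y)).
Proof.
rewrite (_ : (fun nu => _) = fun nu => form x ((s nu)%:C *: ((U nu)^t* *m A *m U nu)) y)//.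
by apply/funext => nu; rewrite formZ form_mulmx trmxCK.
Qed.

Lemma kraus_cp : cp (kraus s U).
Proof.
move: (kraus s U) form_kraus => Phi PhiE; split.
- move=> a A B; apply: form_inj => x y.
  rewrite PhiE formD formZ !PhiE.
  rewrite -cintegralZ// -cintegralD//; last by apply: bmM (bm_cst _) _.
  by apply: eq_cintegral => nu; rewrite formD formZ; ring.
- move=> A; apply: form_inj => x y.
  rewrite -conj_form !PhiE.
  rewrite -cintegral_conj//; apply: eq_cintegral => nu.
  by rewrite rmorphM /= conj_form conj_real_complex.
- move=> Y1 Y2 D h x y; rewrite -conj_form !PhiE.
  rewrite -cintegral_conj// -!cintegralD//; first last.
  + by apply: bmD.
  + by apply: bm_conj.
  + by apply: bmD => //; apply: bmD.
  apply: cintegral_ge0 => nu nu01.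
  rewrite rmorphM /= conj_form conj_real_complex -!mulrDr mulr_ge0 ?h//.
  by rewrite ler0c s_ge0.
Qed.

Lemma le_form_kraus A (b : R) x : (forall nu, I01 nu -> s nu <= b) -> psd A ->
  form x (kraus s U A) x <=
  b%:C * cintegral01 (fun nu => form (U nu *m x) A (U nu *m x)).
Proof.
move=> sb pA; have bb : bounded_measurable (fun nu => form (U nu *m x) A (U nu *m x)).
  rewrite (_ : (fun nu => _) = fun nu => form x ((U nu)^t* *m A *m U nu) x); last first.
    by apply/funext => nu; rewrite form_mulmx trmxCK.
  rewrite /form; apply: bm_mulmx; last exact: bm_mx_cst.
  apply: bm_mulmx; first exact: bm_mx_cst.
  apply: bm_mulmx => //; apply: bm_mulmx; last exact: bm_mx_cst.
  exact: bm_trmxC.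
rewrite -cintegralZ// form_kraus -subr_ge0 -mulN1r -cintegralZ// -cintegralD//.
- apply: cintegral_ge0 => nu nu01; rewrite mulN1r -mulrBl mulr_ge0//.
  by rewrite -rmorphB ler0c subr_ge0 sb.
- by apply: bmM => //; exact: bm_cst.
- by apply: bmM => //; exact: bm_cst.
Qed.

End Kraus.

Section Operators.
Variable R : realType.
Notation C := R[i].
Local Notation I01 := (`[0%R, 1%R]%classic : set R).

Definition conjmx m n (A : 'M[C]_(m, n)) : 'M[C]_(m, n) := map_mx Num.conj A.

Lemma bm_dvec K : bm_mx (@dvec R K).
Proof.
move=> i j; rewrite (_ : (fun x => _) = fun x => e2ipi (i%:R * x)).
  exact: bm_e2ipi.
by apply/funext => x; rewrite mxE.
Qed.

Lemma bm_avec K : bm_mx (@avec R K).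
Proof. by apply: bm_scale; [exact: bm_cst|exact: bm_dvec]. Qed.

Lemma bm_conjmx m n (F : R -> 'M[C]_(m, n)) : bm_mx F -> bm_mx (fun x => conjmx (F x)).
Proof.
move=> bF i j; rewrite (_ : (fun x => _) = fun x => (F x i j)^*%R).
  exact: bm_conj.
by apply/funext => x; rewrite mxE.
Qed.

Lemma conj_quad n (a : 'cV[C]_n) (A : 'M[C]_n) :
  (conjmx a)^t* *m A *m conjmx a = (a^t* *m A^T *m a)^T.
Proof.
rewrite !trmx_mul trmxK mulmxA.
have -> : (conjmx a)^t* = a^T by apply/matrixP => i j; rewrite !mxE conjCK.
have -> : (a^t* )^T = conjmx a by apply/matrixP => i j; rewrite !mxE.
by [].
Qed.

Lemma rank1_conj p q (a : 'cV[C]_p) (e : 'cV[C]_q) (A : 'M[C]_p) :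
  (a *m e^t* )^t* *m A *m (a *m e^t* ) = form a A a *: (e *m e^t* ).
Proof.
rewrite trmxCM trmxCK !mulmxA -(mulmxA e) -(mulmxA e).
by rewrite [a^t* *m A *m a]mx11_scalar mul_mx_scalar -scalemxAl.
Qed.

Lemma conj_form_tr n (a : 'cV[C]_n) (A : 'M[C]_n) :
  form (conjmx a) A (conjmx a) = form a A^T a.
Proof. by rewrite /form conj_quad mxE. Qed.

Lemma conj_rank1 q (e : 'cV[C]_q) :
  conjmx e *m (conjmx e)^t* = (e *m e^t* )^T.
Proof.
by apply/matrixP => i j; rewrite !mxE !big_ord1 !mxE conjCK mulrC.
Qed.

(** Composition with a transpose destroys 2-positivity in general. Here the argument enters only
    through a^H A^T a, which equals the form of A at the conjugate of a, so the transpose merely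
    conjugates [avec]; a transpose of the result conjugates [dvec] in the same way. *)
Lemma PsiK_tr_kraus (s : R -> R) P K (A : 'M[C]_P) :
  PsiK s K A^T = kraus s (fun nu => conjmx (avec P nu) *m (dvec K nu)^t* ) A.
Proof.
congr mxintegral01; apply/funext => nu.
by rewrite rank1_conj conj_form_tr scalerA.
Qed.

Lemma tr_mxintegral p q (F : R -> 'M[C]_(p, q)) :
  (mxintegral01 F)^T = mxintegral01 (fun nu => (F nu)^T).
Proof.
by apply/matrixP => i j; rewrite !mxE; apply: eq_cintegral => nu; rewrite mxE.
Qed.

Lemma tr_PsiK_kraus (s : R -> R) P K (A : 'M[C]_P) :
  (PsiK s K A)^T = kraus s (fun nu => avec P nu *m (conjmx (dvec K nu))^t* ) A.
Proof.
rewrite tr_mxintegral; congr mxintegral01; apply/funext => nu.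
by rewrite rank1_conj conj_rank1 linearZ scalerA.
Qed.

Lemma parseval K : mxintegral01 (fun nu : R => dvec K nu *m (dvec K nu)^t* ) = 1%:M.
Proof.
have gtc (k l : nat) : (l < k)%N ->
    cintegral01 (fun nu : R => e2ipi (k%:R * nu) * (e2ipi (l%:R * nu))^*%R) = 0.
  move=> lk; rewrite -[RHS](@cintegral_e2ipi R (k - l)); last by rewrite subn_gt0.
  apply: eq_cintegral => nu; rewrite conj_e2ipi -e2ipiD natrB; last exact: ltnW.
  by rewrite mulrBl.
apply/matrixP => i j; rewrite !mxE.
transitivity (cintegral01 (fun nu : R => e2ipi (i%:R * nu) * (e2ipi (j%:R * nu))^*%R)).
  by apply: eq_cintegral => nu; rewrite mxE big_ord1 !mxE.
have [<-|ij] := eqVneq i j.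
  rewrite -[RHS](cintegral_cst (1 : C)); apply: eq_cintegral => nu.
  by rewrite mulrC conj_e2ipiM.
case: (ltngtP i j) => h; last by case/eqP: ij; exact: val_inj.
- rewrite mulr0n -[RHS]conjC0 -(gtc _ _ h) -cintegral_conj.
    by apply: eq_cintegral => nu; rewrite rmorphM /= conjCK mulrC.
  by apply: bmM; [exact: bm_e2ipi|apply: bm_conj; exact: bm_e2ipi].
- exact: gtc.
Qed.

Lemma sqn_avec P (nu : R) : (0 < P)%N -> sqn (avec P nu) = 1.
Proof.
move=> P0; rewrite sqnZ sqnE.
under eq_bigr do rewrite mxE normcE_cmod cmod_e2ipi expr1n.
rewrite sumr_const card_ord normcE_cmod cmodR ger0_norm ?invr_ge0 ?sqrtr_ge0//.
rewrite -rmorphXn /= exprVn sqr_sqrtr// -(rmorph_nat (real_complex R)) -rmorphM /=.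
by rewrite mulVf// pnatr_eq0 -lt0n.
Qed.

Lemma sqn_conjmx K (x : 'cV[C]_K) : sqn (conjmx x) = sqn x.
Proof. by rewrite !sqnE; apply: eq_bigr => i _; rewrite mxE norm_conjC. Qed.

(** As a has norm 1, the integrand at 1 is s times e e^H, and the integral of e e^H is the identity.
    This makes the constant independent of the dimensions. *)
Lemma form_kraus1 (s : R -> R) (b : R) p q (a : R -> 'cV[C]_p) (e : R -> 'cV[C]_q) x :
  bounded_measurable (fun nu => (s nu)%:C) -> (forall nu, I01 nu -> s nu <= b) ->
  bm_mx a -> bm_mx e -> (forall nu, sqn (a nu) = 1) ->
  mxintegral01 (fun nu => e nu *m (e nu)^t* ) = 1%:M ->
  form x (kraus s (fun nu => a nu *m (e nu)^t* ) 1%:M) x <= b%:C * sqn x.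
Proof.
move=> bs sb ba be a1 ee.
have bU : bm_mx (fun nu => a nu *m (e nu)^t* ).
  by apply: bm_mulmx => //; exact: bm_trmxC.
have p1 : psd (1%:M : 'M[C]_p) by move=> y; exact: sqn_ge0.
apply: le_trans (le_form_kraus bs bU x sb p1) _.
rewrite le_eqVlt; apply/orP; left; apply/eqP; congr (_ * _).
rewrite -[sqn x]/(form x 1%:M x) -ee form_mxintegral; last first.
  by apply: bm_mulmx => //; exact: bm_trmxC.
apply: eq_cintegral => nu.
rewrite -[LHS]/(sqn (a nu *m (e nu)^t* *m x)) -mulmxA.
rewrite [(e nu)^t* *m x]mx11_scalar mul_mx_scalar sqnZ a1 mulr1 normCK mulrC.
transitivity ((((e nu)^t* *m x)^t* *m ((e nu)^t* *m x)) 0 0).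
  by rewrite [RHS]mxE big_ord1; congr (_ * _); rewrite !mxE.
by rewrite trmxCM trmxCK /form !mulmxA.
Qed.

Lemma bm_density (s : R -> R) (b : R) : measurable_fun I01 s ->
  (forall nu, I01 nu -> 0 <= s nu <= b) -> bounded_measurable (fun nu => (s nu)%:C).
Proof.
move=> ms sb; apply: (bm_real (B := b)) => // nu /sb/andP[h1 h2].
by rewrite ger0_norm.
Qed.

Section Density.
Variables (s : R -> R) (b : R).
Hypothesis ms : measurable_fun I01 s.
Hypothesis sb : forall nu, I01 nu -> 0 <= s nu <= b.

Let bs := bm_density ms sb.
Let s0 nu : I01 nu -> 0 <= s nu. Proof. by move=> /sb/andP[]. Qed.
Let sleb nu : I01 nu -> s nu <= b. Proof. by move=> /sb/andP[]. Qed.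

Lemma cp_PsiK_tr P K : cp (fun A : 'M[C]_P => PsiK s K A^T).
Proof.
rewrite (_ : (fun A => _) = kraus s (fun nu => conjmx (avec P nu) *m (dvec K nu)^t* )).
  apply: (kraus_cp bs _ s0); apply: bm_mulmx.
    by apply: bm_conjmx; exact: bm_avec.
  by apply: bm_trmxC; exact: bm_dvec.
by apply/funext => A; exact: PsiK_tr_kraus.
Qed.

Lemma cp_tr_PsiK P K : cp (fun A : 'M[C]_P => (PsiK s K A)^T).
Proof.
rewrite (_ : (fun A => _) = kraus s (fun nu => avec P nu *m (conjmx (dvec K nu))^t* )).
  apply: (kraus_cp bs _ s0); apply: bm_mulmx; first exact: bm_avec.
  by apply: bm_trmxC; apply: bm_conjmx; exact: bm_dvec.
by apply/funext => A; exact: tr_PsiK_kraus.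
Qed.

Lemma PsiK_tr_unit P K x : (0 < P)%N ->
  form x (PsiK s K (1%:M : 'M[C]_P)^T) x <= b%:C * sqn x.
Proof.
move=> P0; rewrite PsiK_tr_kraus; apply: form_kraus1 => //.
- by apply: bm_conjmx; exact: bm_avec.
- exact: bm_dvec.
- by move=> nu; rewrite sqn_conjmx sqn_avec.
- exact: parseval.
Qed.

Lemma tr_PsiK_unit P K x : (0 < P)%N ->
  form x (PsiK s K (1%:M : 'M[C]_P))^T x <= b%:C * sqn x.
Proof.
move=> P0; rewrite tr_PsiK_kraus; apply: form_kraus1 => //.
- exact: bm_avec.
- by apply: bm_conjmx; exact: bm_dvec.
- by move=> nu; rewrite sqn_avec.
- under eq_fun do rewrite conj_rank1.
  by rewrite -tr_mxintegral parseval trmx1.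
Qed.

End Density.

(** * Block extraction as conjugation *)

Section Blocks.
Variables (M L : nat).

(** Selecting rows turns block extraction and block-diagonal assembly into conjugations, under which
    the class [cp] is stable. *)
Definition selmx (m : 'I_M) : 'M[C]_(L, dimML M L) :=
  \matrix_(i, j) (j == tagnat.Rank (p_ := fun=> L) m i)%:R.

Lemma selmx_mul (m : 'I_M) q (A : 'M[C]_(dimML M L, q)) i j :
  (selmx m *m A) i j = A (tagnat.Rank (p_ := fun=> L) m i) j.
Proof.
rewrite mxE (bigD1 (tagnat.Rank (p_ := fun=> L) m i))//= mxE eqxx mul1r.
by rewrite big1 ?addr0// => k /negbTE ki; rewrite mxE ki mul0r.
Qed.

Lemma trselmx_mul (m : 'I_M) q (A : 'M[C]_(q, dimML M L)) i j :
  (A *m (selmx m)^t* ) i j = A i (tagnat.Rank (p_ := fun=> L) m j).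
Proof.
rewrite mxE (bigD1 (tagnat.Rank (p_ := fun=> L) m j))//= !mxE eqxx rmorph1 mulr1.
by rewrite big1 ?addr0// => k /negbTE ki; rewrite !mxE ki rmorph0 mulr0.
Qed.

Lemma submxblock_sel2 (A : 'M[C]_(dimML M L)) (m m' : 'I_M) :
  @submxblock C M M (fun=> L) (fun=> L) A m m' = selmx m *m A *m (selmx m')^t*.
Proof. by apply/matrixP => i j; rewrite trselmx_mul selmx_mul !mxE. Qed.

Lemma selmx_orth (m m' : 'I_M) :
  selmx m *m (selmx m')^t* = if m == m' then 1%:M else 0.
Proof.
apply/matrixP => i j; rewrite trselmx_mul mxE.
have -> : (tagnat.Rank (p_ := fun=> L) m' j == tagnat.Rank (p_ := fun=> L) m i) =
    (m == m') && (i == j).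
  rewrite -val_eqE /= (tagnat.eq_Rank (p_ := fun=> L)) eq_sym.
  by rewrite [X in _ && X]eq_sym.
by case: eqP => _; rewrite mxE.
Qed.

Lemma mxdiag_sel (B : 'I_M -> 'M[C]_L) :
  \mxdiag_(m < M) B m = \sum_m (selmx m)^t* *m B m *m selmx m.
Proof.
set S := \sum_m _; rewrite -[RHS](@submxblockK _ _ _ (fun=> L) (fun=> L)).
apply: eq_mxblock => m m'; rewrite submxblock_sel2 /S mulmx_sumr mulmx_suml.
rewrite (bigD1 m)//= big1 ?addr0 => [|k km].
  rewrite !mulmxA selmx_orth eqxx mul1mx -mulmxA selmx_orth.
  case: eqP => [mm'|_]; last by rewrite mulmx0.
  by subst m'; rewrite mulmx1 conform_mx_id.
by rewrite !mulmxA selmx_orth eq_sym (negbTE km) !mul0mx.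
Qed.

Lemma sel_sqn (x : 'cV[C]_(dimML M L)) : \sum_m sqn (selmx m *m x) = sqn x.
Proof.
have := @mxdiag_sel (fun=> 1%:M); rewrite mxdiagZ => /(congr1 (fun A => form x A x)).
rewrite [RHS](@form_sum C _ _ _ _ _ (fun m => (selmx m)^t* *m 1%:M *m selmx m)).
move=> h; apply/esym; apply: etrans h _; apply: eq_bigr => m _.
by rewrite form_mulmx trmxCK.
Qed.

End Blocks.

Lemma tr_scale_sum (I : finType) n (a : C) (F G : I -> 'M[C]_n) :
  (forall i, (F i)^T = G i) -> (a *: \sum_i F i)^T = a *: \sum_i G i.
Proof.
move=> FG; rewrite linearZ /= raddf_sum /=; congr (_ *: _).
by apply: eq_bigr => i _.
Qed.

Section PsiMaps.
Variables (M L N : nat) (S : 'I_M -> R -> R) (b : R).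
Hypotheses (M_gt0 : (0 < M)%N) (L_gt0 : (0 < L)%N) (N_gt0 : (0 < N)%N).
Hypothesis mS : forall m, measurable_fun I01 (S m).
Hypothesis Sb : forall m nu, I01 nu -> 0 <= S m nu <= b.

Lemma cpmap_Psi : cpmap (fun Q : 'M[C]_N => Psi L S Q^T) b%:C.
Proof.
have PsiE (Q : 'M[C]_N) : Psi L S Q^T =
  \sum_m (selmx L m)^t* *m PsiK (S m) L Q^T *m selmx L m by exact: mxdiag_sel.
apply: cp_cpmap.
  rewrite (_ : (fun Q => _) = fun Q : 'M[C]_N =>
    \sum_m (selmx L m)^t* *m PsiK (S m) L Q^T *m selmx L m); last exact/funext.
  by apply: cp_sum => m; apply: cp_conjr; exact: (cp_PsiK_tr (mS m) (@Sb m)).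
move=> x; rewrite PsiE.
rewrite (@form_sum C _ _ _ _ _ (fun m => (selmx L m)^t* *m PsiK (S m) L (1%:M)^T *m selmx L m)).
rewrite -sel_sqn mulr_sumr; apply: ler_sum => m _; rewrite form_mulmx trmxCK.
exact: (PsiK_tr_unit (mS m) (@Sb m)).
Qed.

Lemma cpmap_Psibar :
  cpmap (fun P : 'M[C]_(dimML M L) => (ratio R M L N)%:C *: (Psibar N S P)^T)
    (ratio R M L N * b)%:C.
Proof.
have r0 : 0 <= (ratio R M L N)%:C :> C.
  by rewrite ler0c divr_ge0.
have M0 : 0 <= (M%:R : C)^-1 by rewrite invr_ge0.
have E (P : 'M[C]_(dimML M L)) : (Psibar N S P)^T = (M%:R)^-1 *:
   \sum_m (PsiK (S m) N (((selmx L m)^t* )^t* *m P *m (selmx L m)^t* ))^T.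
  by apply: tr_scale_sum => m; rewrite submxblock_sel2 trmxCK.
apply: cp_cpmap.
  apply: cpZ => //.
  rewrite (_ : (fun P => _) = fun P => (M%:R)^-1 *:
   \sum_m (PsiK (S m) N (((selmx L m)^t* )^t* *m P *m (selmx L m)^t* ))^T); last exact/funext.
  apply: cpZ => //; apply: cp_sum => m.
  exact: (cp_conjl ((selmx L m)^t* ) (cp_tr_PsiK (mS m) (@Sb m) _ _)).
move=> x; rewrite formZ E formZ form_sum [(_ * b)%:C]rmorphM -[X in _ <= X]mulrA.
rewrite ler_wpM2l//.
rewrite ler_pdivrMl ?ltr0n//.
apply: le_trans (_ : \sum_(m < M) b%:C * sqn x <= _); last first.
  by rewrite sumr_const card_ord mulr_natl.
apply: ler_sum => m _; rewrite mulmx1 trmxCK selmx_orth eqxx.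
exact: (tr_PsiK_unit (mS m) (@Sb m)).
Qed.

End PsiMaps.

End Operators.

(** * Existence and uniqueness *)

Section System.
Variable R : realType.
Notation C := R[i].

Lemma ge0_real_complex (a : C) : 0 <= a -> a = (complex.Re a)%:C.
Proof. by move=> a0; rewrite RRe_real// ger0_real. Qed.

Lemma geometric_vanish (k c : C) : 0 <= k -> k < 1 -> 0 <= c ->
  forall e : R, 0 < e -> exists j0, forall j, (j0 <= j)%N -> k ^+ j * c <= e%:C.
Proof.
move=> k0 k1 c0 e e0.
rewrite (ge0_real_complex k0) (ge0_real_complex c0).
set kr := complex.Re k; set cr := complex.Re c.
have kr0 : 0 <= kr by rewrite -ler0c -ge0_real_complex.
have kr1 : kr < 1 by rewrite -ltcR -ge0_real_complex.
have : kr ^+ j * cr @[j --> \oo] --> (0 * cr : R).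
  by apply: cvgM; [apply: cvg_expr; rewrite ger0_norm|exact: cvg_cst].
rewrite mul0r => /cvgrPdist_le/(_ e e0)[j0 _ hj0]; exists j0 => j jj0.
rewrite -rmorphXn -rmorphM lecR.
by have := hj0 j jj0; rewrite sub0r normrN; apply: le_trans; exact: ler_norm.
Qed.

Lemma contraction_lt1 (v a : C) : 0 < v -> 0 <= a -> 0 <= a / (v + a) < 1.
Proof.
move=> v0 a0; have va : 0 < v + a by rewrite ltr_wpDr.
by rewrite divr_ge0 ?(ltW va)//= ltr_pdivrMr// mul1r ltrDr.
Qed.

Lemma eq_step m n (Phi : 'M[C]_m -> 'M[C]_n) h (w z : C) Q T :
  cpmap Phi h -> w * w = z -> z != 0 -> 1%:M + Phi Q \in unitmx ->
  T = - z^-1 *: invmx (1%:M + Phi Q) -> step Phi w (w *: Q) (w *: T).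
Proof.
move=> cp wz z0 uA ->; rewrite /step.
have -> : w%:M + Phi (w *: Q) = w *: (1%:M + Phi Q).
  by rewrite (cpmapZ cp) scalerDr scalemx1.
rewrite -scalemxAr -!scalemxAl mulVmx// !scalerA wz mulrN mulfV//.
by rewrite scaleN1r.
Qed.

Lemma iter_close m n (Phi1 : 'M[C]_n -> 'M[C]_m) (Phi2 : 'M[C]_m -> 'M[C]_n)
    (h w b : C) (P P' : nat -> 'M[C]_m) (Q Q' : nat -> 'M[C]_n) :
  0 <= h -> 0 <= b -> 0 < complex.Im w -> cpmap Phi1 h -> cpmap Phi2 h ->
  (forall j, [/\ halfplane b (P j), halfplane b (Q j),
     step Phi1 w (Q j) (P j.+1) & step Phi2 w (P j) (Q j.+1)]) ->
  (forall j, [/\ halfplane b (P' j), halfplane b (Q' j),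
     step Phi1 w (Q' j) (P' j.+1) & step Phi2 w (P' j) (Q' j.+1)]) ->
  forall e : R, 0 < e -> exists j0, forall j, (j0 <= j)%N ->
    forall i k, cmod (P j.+1 i k - P' j.+1 i k) <= e.
Proof.
move=> h0 b0 w0 cp1 cp2 H H' e e0.
have vw : 0 < (2 * 'i%R)^-1 * (w - (w^* )%R) by rewrite half_im ltcR.
have hb : 0 <= h * b by rewrite mulr_ge0.
have /andP[k0 k1] := contraction_lt1 vw hb.
have H1 := iter_contract h0 b0 cp1 cp2 vw H H'.
set k := h * b / _ in k0 k1 H1.
set d := b * _ / _ *+ 2 in H1.
have d0 : 0 <= d.
  apply/mulrn_wge0/divr_ge0; last exact: ltW.
  by rewrite mulr_ge0// exprn_ge0// addr_ge0.
have c0 : 0 <= d * b * 2 by rewrite !mulr_ge0.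
have [j0 hj] := geometric_vanish k0 k1 c0 e0; exists j0 => j jj0 i l.
have := H1 j (delta_mx i 0) (delta_mx l 0).
rewrite form_delta !mxE normcE_cmod.
have sd (i' : 'I_m) : sqn (delta_mx i' 0 : 'cV[C]_m) = 1.
  by rewrite /sqn form_delta mxE eqxx.
rewrite !sd (_ : 1 + 1 = 2)// => H2.
have {H2} : (cmod (P j.+1 i l - P' j.+1 i l))%:C *+ 2 <= e%:C.
  by apply: le_trans H2 _; have := hj j jj0; rewrite !mulrA.
rewrite -rmorphMn lecR; apply: le_trans.
by rewrite mulr2n lerDl cmod_ge0.
Qed.

Variables (n1 n2 : nat) (Phi1 : 'M[C]_n2 -> 'M[C]_n1) (Phi2 : 'M[C]_n1 -> 'M[C]_n2).
Variable h : R.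
Hypotheses (h_ge0 : 0 <= h) (cp1 : cpmap Phi1 h%:C) (cp2 : cpmap Phi2 h%:C).

Let hC : 0 <= h%:C :> C. Proof. by rewrite ler0c. Qed.

Definition system (F1 : cut_plane R -> 'M[C]_n1) (F2 : cut_plane R -> 'M[C]_n2) : Prop :=
  forall z : cut_plane R,
    let A := 1%:M + Phi1 (F2 z) in
    let B := 1%:M + Phi2 (F1 z) in
    [/\ A \in unitmx, F1 z = - (val z)^-1 *: invmx A,
        B \in unitmx & F2 z = - (val z)^-1 *: invmx B].

Let cut_neq0 (z : cut_plane R) : val z != 0.
Proof. by apply: contraNneq (valP z) => ->. Qed.

Let bound (w : C) (z : cut_plane R) : C := `|w| / (delta (val z))%:C.

Let bound_ge0 w z : 0 <= bound w z.
Proof. by rewrite divr_ge0// ler0c ltW//; exact: delta_gt0 (valP z). Qed.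

Section Uniqueness.
Variables (F1 F1' : cut_plane R -> 'M[C]_n1) (F2 F2' : cut_plane R -> 'M[C]_n2).
Hypotheses (st1 : stieltjes_class F1) (st2 : stieltjes_class F2)
  (st1' : stieltjes_class F1') (st2' : stieltjes_class F2').
Hypotheses (sys : system F1 F2) (sys' : system F1' F2').

Lemma system_unique_aux z : F1 z = F1' z /\ F2 z = F2' z.
Proof.
have [w wz w0] := sqrt_upper (valP z).
have wn0 : w != 0 by apply: contraNneq (cut_neq0 z) => w00; rewrite -wz w00 mul0r.
have [uA e1 uB e2] := sys z; have [uA' e1' uB' e2'] := sys' z.
have sP := eq_step cp1 wz (cut_neq0 z) uA e1.
have sQ := eq_step cp2 wz (cut_neq0 z) uB e2.
have sP' := eq_step cp1 wz (cut_neq0 z) uA' e1'.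
have sQ' := eq_step cp2 wz (cut_neq0 z) uB' e2'.
have hp1 := stieltjes_halfplane st1 wz w0; have hp2 := stieltjes_halfplane st2 wz w0.
have hp1' := stieltjes_halfplane st1' wz w0; have hp2' := stieltjes_halfplane st2' wz w0.
have eqM n (A A' : 'M[C]_n) : (forall e : R, 0 < e -> forall i k,
    cmod ((w *: A) i k - (w *: A') i k) <= e) -> A = A'.
  move=> H; apply: (scalerI wn0); apply/matrixP => i k; apply/eqP.
  rewrite -subr_eq0; apply/eqP/cmod_eq0/eqP; rewrite eq_le cmod_ge0 andbT.
  by apply/ler_addgt0Pr => e e0; rewrite add0r; exact: H.
split; apply: eqM => e e0.
  (* A solution is a constant sequence satisfying the step equations, so a fixed difference is
     bounded by a geometric sequence. *)
  have [j0 hj] := iter_close (P := fun=> w *: F1 z) (P' := fun=> w *: F1' z)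
    hC (bound_ge0 w z) w0 cp1 cp2 (fun=> And4 hp1 hp2 sP sQ)
    (fun=> And4 hp1' hp2' sP' sQ') e0.
  exact: hj (leqnn j0).
have [j0 hj] := iter_close (P := fun=> w *: F2 z) (P' := fun=> w *: F2' z)
    hC (bound_ge0 w z) w0 cp2 cp1 (fun=> And4 hp2 hp1 sQ sP)
    (fun=> And4 hp2' hp1' sQ' sP') e0.
exact: hj (leqnn j0).
Qed.

End Uniqueness.

Lemma system_lower_bound (F1 : cut_plane R -> 'M[C]_n1) (F2 : cut_plane R -> 'M[C]_n2) z :
  stieltjes_class F2 -> system F1 F2 -> lower_bound (h + 1) F1 z.
Proof.
move=> st2 sys x; rewrite -/(form x _ x).
have [w wz w0] := sqrt_upper (valP z); have [uA e1 _ _] := sys z.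
have sP := eq_step cp1 wz (cut_neq0 z) uA e1.
have [hp _] := stieltjes_halfplane st2 wz w0.
have := step_lower' hC cp1 (bound_ge0 w z) hp sP x.
rewrite trmxCZ -scalemxAl sqnZ norm_conjC formB form_scalar subr_ge0 -/(sqn x).
have d0 : 0 < delta (val z) := delta_gt0 (valP z).
have dz : delta (val z) <= cmod (val z) := delta_le_cmod (val z).
have wz2 : cmod w ^+ 2 = cmod (val z) by rewrite expr2 -cmodM wz.
have -> : form x (F1 z *m (F1 z)^t* ) x = sqn ((F1 z)^t* *m x).
  by rewrite sqnM trmxCK.
rewrite /bound !normcE_cmod (ge0_real_complex (sqn_ge0 x)).
rewrite (ge0_real_complex (sqn_ge0 ((F1 z)^t* *m x))).
set a := complex.Re (sqn x); set t := complex.Re (sqn _).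
have a0 : 0 <= a by rewrite -ler0c -ge0_real_complex ?sqn_ge0.
have t0 : 0 <= t by rewrite -ler0c -ge0_real_complex ?sqn_ge0.
rewrite -fmorphV -!rmorphM -rmorphD -!rmorphXn -!rmorphM !lecR wz2.
set r := cmod (val z) in dz wz2 *; set u := delta (val z) in d0 dz *.
have -> : (cmod w + h * (cmod w / u)) ^+ 2 * (r * t) = (r * (u + h) / u) ^+ 2 * t.
  by rewrite -wz2; field; rewrite gt_eqF.
set eta2 := (h + 1) ^+ 2 + r ^+ 2.
have r0 : 0 <= r := cmod_ge0 _.
have e0 : 0 < eta2 by rewrite ltr_wpDr ?exprn_ge0// exprn_gt0// ltr_wpDl.
(* The square root of the claimed inequality. As u <= r, it reduces to a polynomial in r and h whose
   gap is a sum of nonnegative terms; taking h + 1 for eta keeps it positive when h = 0. *)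
have le1 : r * (u + h) <= 4 * eta2.
  apply: (@le_trans _ _ (r * (r + h))); first by rewrite ler_wpM2l// lerD2r.
  rewrite /eta2 -subr_ge0.
  have -> : 4 * ((h + 1) ^+ 2 + r ^+ 2) - r * (r + h) =
     (r - h / 2) ^+ 2 + 2 * r ^+ 2 + (15 / 4) * h ^+ 2 + 8 * h + 4 by field.
  by rewrite !addr_ge0 ?sqr_ge0 ?mulr_ge0 ?sqr_ge0.
move=> H; apply: le_trans (ler_wpM2l _ H) _.
  by rewrite divr_ge0 ?exprn_ge0 ?(ltW d0)// mulr_ge0// exprn_ge0// ltW.
have -> : u ^+ 2 / (16 * eta2 ^+ 2) * ((r * (u + h) / u) ^+ 2 * t) =
    (r * (u + h) / (4 * eta2)) ^+ 2 * t.
  by field; rewrite !gt_eqF.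
rewrite ler_piMl// exprn_ile1//.
  by apply: divr_ge0; apply: mulr_ge0 => //; [rewrite addr_ge0// ltW|exact: ltW].
by rewrite ler_pdivrMr ?mul1r// mulr_gt0.
Qed.

(** The mass may be smaller than 1 so that the starting point 0 belongs, with no atom at all; one
    step restores mass 1 and yields the moment bound. V and l are the same for every z. *)
Definition subresolvent n (F : C -> 'M[C]_n) : Prop :=
  exists p (V : 'M[C]_(p, n)) (l : 'rV[C]_p),
    [/\ forall i, 0 <= l 0 i, psd (1%:M - V^t* *m V)
      & forall z, ~~ (0 <= z) -> F z = res V l z].

(** The data are packed in one dependent pair for [choice] to select them for all iterates, and the
    atoms are real as [res_limit] expects. *)
Definition resolvent n (F : C -> 'M[C]_n)
    (r : {p : nat & ('M[C]_(p, n) * ('I_p -> R))%type}) : Prop :=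
  let V := (projT2 r).1 in let l := (projT2 r).2 in
  [/\ V^t* *m V = 1%:M, forall k, 0 <= l k,
      psd (h%:C%:M - V^t* *m diag_mx (\row_k (l k)%:C) *m V)
    & forall z, ~~ (0 <= z) -> F z = res V (\row_k (l k)%:C) z].

Lemma resolvent_sub n (F : C -> 'M[C]_n) r : resolvent F r -> subresolvent F.
Proof.
case: r => p [V l] [/= V1 l0 _ FE]; exists p, V, (\row_k (l k)%:C).
by split=> // [k|]; [rewrite mxE ler0c|rewrite V1 subrr => x; rewrite form0].
Qed.

Lemma subresolvent0 n : subresolvent (fun=> 0 : 'M[C]_n).
Proof.
exists 0%N, 0, 0; split=> [[]//||z _]; last by rewrite /res mulmx0.
by rewrite mulmx0 subr0; exact: sqn_ge0.
Qed.

Lemma subresolvent_step m n (Phi : 'M[C]_m -> 'M[C]_n) (F : C -> 'M[C]_m) :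
  cpmap Phi h%:C -> subresolvent F ->
  (exists r, resolvent (fun z => - z^-1 *: invmx (1%:M + Phi (F z))) r) /\
  forall z, ~~ (0 <= z) -> 1%:M + Phi (F z) \in unitmx.
Proof.
move=> cp [p [V [l [l0 V1 FE]]]].
have [q [V' [l' [l'0 V'1 mom H]]]] := res_step cp l0 V1.
have l'E : l' = \row_k (complex.Re (l' 0 k))%:C.
  by apply/rowP => k; rewrite mxE -ge0_real_complex.
split; last by move=> z z0; rewrite FE//; exact: (H z z0).1.
exists (existT _ q (V', fun k => complex.Re (l' 0 k))); split => /=.
- by [].
- by move=> k; rewrite -ler0c -ge0_real_complex.
- by rewrite -l'E.
- by move=> z z0; rewrite -l'E FE//; exact: (H z z0).2.
Qed.

Lemma subresolvent_halfplane n (F : C -> 'M[C]_n) (z : cut_plane R) w :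
  subresolvent F -> w * w = val z -> 0 < complex.Im w ->
  halfplane (bound w z) (w *: F (val z)).
Proof.
move=> [p [V [l [l0 V1 FE]]]] wz w0; rewrite FE ?(valP z)// /res gram_sum.
have lR k : l 0 k = (complex.Re (l 0 k))%:C by rewrite -ge0_real_complex.
have lR0 k : 0 <= complex.Re (l 0 k) by rewrite -ler0c -lR.
apply: halfplane_sum; first exact: bound_ge0.
- by move=> k; exact: psd_gram.
- have <- // : V^t* *m V = \sum_k (row k V)^t* *m row k V.
  rewrite -[in LHS](mulmx1 (V^t* )) -diag_const_mx gram_sum.
  by apply: eq_bigr => k _; rewrite mxE scale1r.
- move=> k; rewrite mxE lR normrM [X in _ * X]normcE_cmod /bound -fmorphV.
  by rewrite ler_wpM2l// lecR cmod_kernel//; exact: valP z.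
- by move=> k; rewrite mxE lR -wz Im_kernel// wz; exact: valP z.
Qed.

Definition iterate (j : nat) (z : C) : 'M[C]_n1 * 'M[C]_n2 :=
  iter j (fun X => (- z^-1 *: invmx (1%:M + Phi1 X.2),
                    - z^-1 *: invmx (1%:M + Phi2 X.1))) (0, 0).

Lemma iterate_subresolvent j :
  subresolvent (fun z => (iterate j z).1) /\ subresolvent (fun z => (iterate j z).2).
Proof.
elim: j => [|j [IH1 IH2]]; first by split; exact: subresolvent0.
have [[r1 hr1] _] := subresolvent_step cp1 IH2.
have [[r2 hr2] _] := subresolvent_step cp2 IH1.
by split; [exact: resolvent_sub hr1|exact: resolvent_sub hr2].
Qed.

Lemma iterate_unit j z : ~~ (0 <= z) ->
  1%:M + Phi1 (iterate j z).2 \in unitmx /\ 1%:M + Phi2 (iterate j z).1 \in unitmx.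
Proof.
move=> z0; have [IH1 IH2] := iterate_subresolvent j.
have [_ h1] := subresolvent_step cp1 IH2; have [_ h2] := subresolvent_step cp2 IH1.
by split; [exact: h1|exact: h2].
Qed.

Lemma iterate_close (z : cut_plane R) (e : R) : 0 < e -> exists j0, forall j, (j0 <= j)%N ->
  (forall i k, cmod ((iterate j.+1 (val z)).1 i k - (iterate j.+2 (val z)).1 i k) <= e) /\
  (forall i k, cmod ((iterate j.+1 (val z)).2 i k - (iterate j.+2 (val z)).2 i k) <= e).
Proof.
move=> e0; have [w wz w0] := sqrt_upper (valP z).
have wn0 : w != 0 by apply: contraNneq (cut_neq0 z) => w00; rewrite -wz w00 mul0r.
have cw0 : 0 < cmod w by rewrite lt_neqAle cmod_ge0 eq_sym andbT; apply: contraNneq wn0 => /cmod_eq0 ->.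
have H j : [/\ halfplane (bound w z) (w *: (iterate j (val z)).1),
    halfplane (bound w z) (w *: (iterate j (val z)).2),
    step Phi1 w (w *: (iterate j (val z)).2) (w *: (iterate j.+1 (val z)).1)
    & step Phi2 w (w *: (iterate j (val z)).1) (w *: (iterate j.+1 (val z)).2)].
  have [s1 s2] := iterate_subresolvent j; have [u1 u2] := iterate_unit j (valP z).
  split; [exact: (subresolvent_halfplane s1 wz w0)|exact: (subresolvent_halfplane s2 wz w0)|
    exact: (eq_step cp1 wz (cut_neq0 z) u1)|exact: (eq_step cp2 wz (cut_neq0 z) u2)].
have ew : 0 < cmod w * e by rewrite mulr_gt0.
have Hsw j : [/\ halfplane (bound w z) (w *: (iterate j (val z)).2),
    halfplane (bound w z) (w *: (iterate j (val z)).1),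
    step Phi2 w (w *: (iterate j (val z)).1) (w *: (iterate j.+1 (val z)).2)
    & step Phi1 w (w *: (iterate j (val z)).2) (w *: (iterate j.+1 (val z)).1)].
  by have [] := H j.
(* The iteration is compared with its own shift. *)
have [j1 h1] := iter_close hC (bound_ge0 w z) w0 cp1 cp2 H (fun j => H j.+1) ew.
have [j2 h2] := iter_close hC (bound_ge0 w z) w0 cp2 cp1 Hsw (fun j => Hsw j.+1) ew.
exists (maxn j1 j2) => j; rewrite geq_max => /andP[le1 le2].
have eqM n (X Y : 'M[C]_n) i k :
    cmod ((w *: X) i k - (w *: Y) i k) = cmod w * cmod (X i k - Y i k).
  by rewrite !mxE -mulrBr cmodM.
by split=> i k; rewrite -(ler_pM2l cw0) -eqM; [exact: h1|exact: h2].
Qed.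

Lemma clim_mulmx (T : Type) (U : set_system T) m n p (A : T -> 'M[C]_(m, n))
    (B : T -> 'M[C]_(n, p)) (A0 : 'M[C]_(m, n)) (B0 : 'M[C]_(n, p)) : ProperFilter U ->
  (forall i j, clim U (fun t => A t i j) (A0 i j)) ->
  (forall i j, clim U (fun t => B t i j) (B0 i j)) ->
  forall i j, clim U (fun t => (A t *m B t) i j) ((A0 *m B0) i j).
Proof.
move=> FU hA hB i j; rewrite mxE; under eq_fun do rewrite mxE.
by apply: clim_sum => k; exact: climM.
Qed.

Lemma clim_cpmap (T : Type) (U : set_system T) m n (Phi : 'M[C]_m -> 'M[C]_n) k
    (A : T -> 'M[C]_m) (A0 : 'M[C]_m) : ProperFilter U -> cpmap Phi k ->
  (forall i j, clim U (fun t => A t i j) (A0 i j)) ->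
  forall i j, clim U (fun t => Phi (A t) i j) (Phi A0 i j).
Proof.
move=> FU cp hA i j.
have PE (X : 'M[C]_m) : Phi X i j = \sum_a \sum_b X a b * Phi (delta_mx a b) i j.
  rewrite {1}(matrix_sum_delta X) (cpmap_sum cp) summxE; apply: eq_bigr => a _.
  rewrite (cpmap_sum cp) summxE; apply: eq_bigr => b _.
  by rewrite (cpmapZ cp) mxE.
rewrite PE; under eq_fun do rewrite PE.
apply: clim_sum => a; apply: clim_sum => b; apply: climM => //; exact: clim_cst.
Qed.

(** The limit is taken in the product of B and 1 + Phi A, not in the inverse; since z is nonzero,
    the limiting product shows that 1 + Phi A0 is invertible. *)
Lemma clim_equation (T : Type) (U : set_system T) m n (Phi : 'M[C]_m -> 'M[C]_n) k
    (A : T -> 'M[C]_m) (B : T -> 'M[C]_n) (A0 : 'M[C]_m) (B0 : 'M[C]_n) (z : C) : ProperFilter U -> cpmap Phi k -> z != 0 ->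
  (forall i j, clim U (fun t => A t i j) (A0 i j)) ->
  (forall i j, clim U (fun t => B t i j) (B0 i j)) ->
  (forall t, 1%:M + Phi (A t) \in unitmx) ->
  (forall t, B t = - z^-1 *: invmx (1%:M + Phi (A t))) ->
  1%:M + Phi A0 \in unitmx /\ B0 = - z^-1 *: invmx (1%:M + Phi A0).
Proof.
move=> PU cp z0 hA hB uA eB.
have e : B0 *m (1%:M + Phi A0) = - z^-1 *: 1%:M.
  apply/matrixP => i j; apply: (@clim_unique _ _ U _ (fun t => (B t *m (1%:M + Phi (A t))) i j)).
    apply: clim_mulmx => // {}i {}j; rewrite mxE; under eq_fun do rewrite mxE.
    by apply: climD; [exact: clim_cst|exact: (clim_cpmap PU cp hA)].
  under eq_fun do rewrite eB -scalemxAl mulVmx//.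
  exact: clim_cst.
have e' : (- z *: B0) *m (1%:M + Phi A0) = 1%:M.
  by rewrite -scalemxAl e scalerA mulrNN mulfV// scale1r.
have [_ u] := mulmx1_unit e'; split => //.
by rewrite -[B0](mulmxK u) e -scalemxAl mul1mx.
Qed.

Lemma system_exists : exists F1 F2,
  [/\ stieltjes_class F1, stieltjes_class F2 & system F1 F2].
Proof.
have hr j : exists r, resolvent (fun z => (iterate j.+1 z).1) r.1 /\
                      resolvent (fun z => (iterate j.+1 z).2) r.2.
  have [s1 s2] := iterate_subresolvent j.
  have [[r1 hr1] _] := subresolvent_step cp1 s2.
  have [[r2 hr2] _] := subresolvent_step cp2 s1.
  by exists (r1, r2).
have [r rP] := choice hr.
have [U [UU Uoo]] := ultraFilterLemma (eventually_filter : ProperFilter \oo).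
have UF := @ultra_proper _ _ UU.
have [F1 [st1 lim1]] := @res_limit R U UU n1 _
  (fun j => (projT2 (r j).1).1) (fun j => (projT2 (r j).1).2) h
  (fun j => let: conj (And4 H _ _ _) _ := rP j in H)
  (fun j => let: conj (And4 _ H _ _) _ := rP j in H)
  (fun j => let: conj (And4 _ _ H _) _ := rP j in H).
have [F2 [st2 lim2]] := @res_limit R U UU n2 _
  (fun j => (projT2 (r j).2).1) (fun j => (projT2 (r j).2).2) h
  (fun j => let: conj _ (And4 H _ _ _) := rP j in H)
  (fun j => let: conj _ (And4 _ H _ _) := rP j in H)
  (fun j => let: conj _ (And4 _ _ H _) := rP j in H).
have l1 (z : cut_plane R) i k : clim U (fun j => (iterate j.+1 (val z)).1 i k) (F1 z i k).
  have -> // : (fun j => (iterate j.+1 (val z)).1 i k) = fun j =>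
      res (projT2 (r j).1).1 (\row_k ((projT2 (r j).1).2 k)%:C) (val z) i k.
  by apply/funext => j; have [[_ _ _ H] _] := rP j; rewrite (H _ (valP z)).
have l2 (z : cut_plane R) i k : clim U (fun j => (iterate j.+1 (val z)).2 i k) (F2 z i k).
  have -> // : (fun j => (iterate j.+1 (val z)).2 i k) = fun j =>
      res (projT2 (r j).2).1 (\row_k ((projT2 (r j).2).2 k)%:C) (val z) i k.
  by apply/funext => j; have [_ [_ _ _ H]] := rP j; rewrite (H _ (valP z)).
(* An ultrafilter is not invariant under the shift, so consecutive iterates could have different
   limits; vanishing increments exclude this, because U refines the filter at infinity. *)
have shift (u : nat -> C) a : clim U u a ->
    (forall e : R, 0 < e -> exists j0, forall j, (j0 <= j)%N -> cmod (u j - u j.+1) <= e) ->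
    clim U (fun j => u j.+1) a.
  move=> ua us.
  have d0 : clim U (fun j => u j - u j.+1) 0.
    split; apply/cvgrPdist_le => e e0; have [j0 hj] := us e e0;
      apply: Uoo; exists j0 => // j /= /hj; apply: le_trans;
      rewrite sub0r normrN; [exact: Re_le_cmod|exact: Im_le_cmod].
  have := climB UF ua d0; rewrite subr0.
  by under eq_fun do rewrite opprB addrC subrK.
have l1' (z : cut_plane R) i k : clim U (fun j => (iterate j.+2 (val z)).1 i k) (F1 z i k).
  apply: (shift (fun j => (iterate j.+1 (val z)).1 i k)) => // e e0.
  by have [j0 hj] := iterate_close z e0; exists j0 => j /hj[].
have l2' (z : cut_plane R) i k : clim U (fun j => (iterate j.+2 (val z)).2 i k) (F2 z i k).
  apply: (shift (fun j => (iterate j.+1 (val z)).2 i k)) => // e e0.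
  by have [j0 hj] := iterate_close z e0; exists j0 => j /hj[].
exists F1, F2; split=> // z /=.
have [u1 e1] := clim_equation UF cp1 (cut_neq0 z) (l2 z) (l1' z)
  (fun j => (iterate_unit j.+1 (valP z)).1) (fun=> erefl).
have [u2 e2] := clim_equation UF cp2 (cut_neq0 z) (l1 z) (l2' z)
  (fun j => (iterate_unit j.+1 (valP z)).2) (fun=> erefl).
by split.
Qed.

End System.

Section CanonicalSystem.
Variable R : realType.
Notation C := R[i].

Lemma system_sym n1 n2 (Phi1 : 'M[C]_n2 -> 'M[C]_n1) (Phi2 : 'M[C]_n1 -> 'M[C]_n2) F1 F2 :
  system Phi1 Phi2 F1 F2 -> system Phi2 Phi1 F2 F1.
Proof. by move=> sys z; have [] := sys z. Qed.

Lemma canonical_equationsE M L N (S : 'I_M -> R -> R)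
    (T : cut_plane R -> 'M[C]_(dimML M L)) (Tt : cut_plane R -> 'M[C]_N) :
  canonical_equations S T Tt <->
  system (fun Q : 'M[C]_N => Psi L S Q^T)
    (fun P : 'M[C]_(dimML M L) => (ratio R M L N)%:C *: (Psibar N S P)^T) T Tt.
Proof. by []. Qed.

End CanonicalSystem.

Lemma ratio_bounded (R : realType) (M L : nat -> nat) (c : R) :
  (fun N => ratio R (M N) (L N) N) @ \oo --> c ->
  exists2 r : R, 0 <= r & forall N, ratio R (M N) (L N) N <= r.
Proof.
move=> cl.
have /cvg_seq_bounded[A [_ hA]] : cvg ((fun N => ratio R (M N) (L N) N) @ \oo).
  by apply/cvg_ex; exists c.
exists (`|A| + 1); first by rewrite addr_ge0.
move=> N; apply: le_trans (ler_norm _) _; apply: (hA (`|A| + 1)) => //.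
by rewrite (le_lt_trans (ler_norm A))// ltrDl.
Qed.

Theorem proposition5p1 (R : realType) (M L : nat -> nat) (c : R)
    (S : forall M0 : nat, 'I_M0 -> R -> R)
    (M_gt0 : forall N, (0 < N)%N -> (0 < M N)%N)
    (L_gt0 : forall N, (0 < N)%N -> (0 < L N)%N)
    (M_infty : M @ \oo --> \oo)
    (c_gt0 : 0 < c)
    (c_lim : (fun N => ratio R (M N) (L N) N) @ \oo --> c)
    (S_gt0 : positive_densities S)
    (S_sum : summable_covariances S)
    (S_ub : bounded_above_densities S)
    (S_lb : bounded_below_densities S) :
  (forall N, (0 < N)%N ->
     exists! T : (cut_plane R -> 'M[R[i]]_(dimML (M N) (L N)))
                 * (cut_plane R -> 'M[R[i]]_N),
       canonical_solution (S (M N)) T) /\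
  (exists eta etat : R,
     [/\ 0 < eta, 0 < etat
       & forall N, (0 < N)%N ->
         forall T : (cut_plane R -> 'M[R[i]]_(dimML (M N) (L N)))
                    * (cut_plane R -> 'M[R[i]]_N),
           canonical_solution (S (M N)) T ->
         forall z : cut_plane R,
           lower_bound eta T.1 z /\ lower_bound etat T.2 z]).
Proof.
have [b Sb] := S_ub; have [r r0 hr] := ratio_bounded c_lim.
(* One constant for both maps: the first is bounded by |b|, the second by the ratio times |b|, and
   the ratio is at most r for every N. *)
pose h : R := `|b| * (1 + r).
have h0 : 0 <= h by rewrite mulr_ge0// addr_ge0.
have mS M0 (m : 'I_M0) := (S_gt0 M0 m).1.
have Sb' M0 (m : 'I_M0) nu : `[0%R, 1%R]%classic nu -> 0 <= S M0 m nu <= `|b|.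
  move=> nu01; have nu01' : nu \in `[0%R, 1%R] by [].
  by rewrite ltW ?(S_gt0 M0 m).2//= (le_trans (Sb _ _ _ nu01'))// ler_norm.
have cp1 N : (0 < N)%N ->
    cpmap (fun Q : 'M[R[i]]_N => Psi (L N) (S (M N)) Q^T) h%:C.
  move=> N0; apply: (cpmap_le_const (h := `|b|%:C)).
    by rewrite lecR ler_peMr// lerDl.
  exact: (cpmap_Psi (L N) N0 (mS (M N)) (Sb' (M N))).
have cp2 N : (0 < N)%N ->
    cpmap (fun P : 'M[R[i]]_(dimML (M N) (L N)) =>
      (ratio R (M N) (L N) N)%:C *: (Psibar N (S (M N)) P)^T) h%:C.
  move=> N0; apply: (cpmap_le_const (h := (ratio R (M N) (L N) N * `|b|)%:C)).
    by rewrite lecR /h mulrC ler_wpM2l// (le_trans (hr N))// lerDr.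
  exact: (cpmap_Psibar N (M_gt0 N N0) (L_gt0 N N0) (mS (M N)) (Sb' (M N))).
split=> [N N0|].
  have [F1 [F2 [st1 st2 sys]]] := system_exists h0 (cp1 N N0) (cp2 N N0).
  exists (F1, F2); split=> [|[F1' F2'] [st1' st2' sys']]; first by split.
  by congr pair; apply/funext => z;
    have [] := system_unique_aux h0 (cp1 N N0) (cp2 N N0) st1 st2 st1' st2' sys sys' z.
have h1 : 0 < h + 1 by rewrite ltr_wpDl.
exists (h + 1), (h + 1); split=> // N N0 [F1 F2] /= [st1 st2 sys] z.
have {}sys := (canonical_equationsE _ _ _).1 sys.
split; first exact: (system_lower_bound h0 (cp1 N N0) z st2 sys).
exact: (system_lower_bound h0 (cp2 N N0) z st1 (system_sym sys)).
Qed.
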